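(* Let $N\in\{3,4\}$, $2^*=\frac{2N}{N-2}$, and let $\beta>0$, $a,b>0$ and $\mu_1,\mu_2>0$. Then there is no $(\lambda_1,\lambda_2,u,v)\in\mathbb R^2\times H^1(\mathbb R^N)\times H^1(\mathbb R^N)$ with $u\ge0$, $v\ge0$, $(u,v)\ne(0,0)$ that solves $$\begin{cases}-\Delta u+\lambda_1u=\mu_1|u|^{2^*-2}u+\beta v&\text{in }\mathbb R^N,\\-\Delta v+\lambda_2v=\mu_2|v|^{2^*-2}v+\beta u&\text{in }\mathbb R^N,\end{cases}\qquad \int_{\mathbb R^N}u^2\,dx=a,\quad\int_{\mathbb R^N}v^2\,dx=b.$$
   Context: Functions are real-valued and solutions are understood in the weak sense. *)

(* Defs.v *)
From HB Require Import structures.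
From mathcomp Require Import all_boot all_order all_algebra.
From mathcomp Require Import all_classical all_reals all_analysis.
Set Implicit Arguments.
Unset Strict Implicit.
Unset Printing Implicit Defensive.
Import Order.TTheory GRing.Theory Num.Theory.
Import numFieldNormedType.Exports.
Local Open Scope classical_set_scope.
Local Open Scope ring_scope.

Definition measure_rV_display : measure_display. Proof. exact. Qed.

(* The sigma-algebra on R^n generated by the n coordinates (as for n.-tuple in
   the library), that is, the Borel sigma-algebra. *)
Section measurable_rV.
Variables (R : realType) (n : nat).

Let coord (i : 'I_n) (x : 'rV[R]_n) : R := x ord0 i.

Let rV_set0 : g_sigma_preimage coord set0.
Proof. exact: sigma_algebra0. Qed.

Let rV_setC A : g_sigma_preimage coord A -> g_sigma_preimage coord (~` A).
Proof. exact: sigma_algebraC. Qed.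

Let rV_bigcup (F : _^nat) : (forall i, g_sigma_preimage coord (F i)) ->
  g_sigma_preimage coord (\bigcup_i (F i)).
Proof. exact: sigma_algebra_bigcup. Qed.

HB.instance Definition _ := @isMeasurable.Build measure_rV_display
  'rV[R]_n (g_sigma_preimage coord) rV_set0 rV_setC rV_bigcup.

End measurable_rV.

Lemma measurable_coord (R : realType) n (i : 'I_n) :
  measurable_fun setT (fun x : 'rV[R]_n => x ord0 i : R).
Proof.
move=> _ Y mY; rewrite setTI; apply: sub_sigma_algebra => /=.
rewrite -bigcup_seq/=; exists i => /=; first by rewrite mem_index_enum.
by exists Y => //; rewrite setTI.
Qed.

Lemma measurable_fun_rVP (R : realType) d (T : measurableType d) n
    (f : T -> 'rV[R]_n) :
  (forall i, measurable_fun setT (fun x => f x ord0 i : R)) ->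
  measurable_fun setT f.
Proof.
move=> mf _ A mA; rewrite setTI.
suff : g_sigma_preimage (fun (i : 'I_n) (x : T) => f x ord0 i) `<=` measurable.
  apply; rewrite (g_sigma_preimage_comp (fun (i : 'I_n) (x : 'rV[R]_n) => x ord0 i) f).
  by exists A => //; rewrite setTI.
apply: smallest_sub; first exact: sigma_algebra_measurable.
case: n => [|n] in f mf A mA *; first by rewrite big_ord0.
rewrite -bigcup_mkord_ord; apply: bigcup_sub => i Ii.
by move=> B [C mC <-]; exact: mf.
Qed.

Section rV_cons.
Variables (R : realType) (n : nat).

Definition rV_cons (p : measurableTypeR R * 'rV[R]_n) : 'rV[R]_n.+1 :=
  \row_i oapp (p.2 ord0) p.1 (unlift ord0 i).

Definition rV_uncons (x : 'rV[R]_n.+1) : measurableTypeR R * 'rV[R]_n :=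
  (x ord0 ord0, \row_j x ord0 (lift ord0 j)).

Lemma rV_cons0 p : rV_cons p ord0 ord0 = p.1.
Proof. by rewrite mxE unlift_none. Qed.

Lemma rV_consS p j : rV_cons p ord0 (lift ord0 j) = p.2 ord0 j.
Proof. by rewrite mxE liftK. Qed.

Lemma rV_consK : cancel rV_cons rV_uncons.
Proof.
move=> [t y]; rewrite /rV_uncons rV_cons0; congr pair.
by apply/rowP => j; rewrite mxE rV_consS.
Qed.

Lemma measurable_rV_cons : measurable_fun setT rV_cons.
Proof.
apply: measurable_fun_rVP => i; have [j ->|->] := unliftP ord0 i.
  under eq_fun do rewrite rV_consS.
  exact: (measurableT_comp (measurable_coord j) measurable_snd).
by under eq_fun do rewrite rV_cons0; exact: measurable_fst.
Qed.

Lemma measurable_rV_uncons : measurable_fun setT rV_uncons.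
Proof.
apply: measurable_fun_pair; first exact: measurable_coord.
apply: measurable_fun_rVP => j; under eq_fun do rewrite mxE.
exact: measurable_coord.
Qed.

End rV_cons.

Section lebesgue_rV_succ.
Local Open Scope ereal_scope.
Variables (R : realType) (n : nat).
Variable m : {sigma_finite_measure set 'rV[R]_n -> \bar R}.

Definition lebesgue_rV_succ : set 'rV[R]_n.+1 -> \bar R :=
  pushforward (@lebesgue_measure R \x m) (@rV_cons R n).

Let succ0 : lebesgue_rV_succ set0 = 0.
Proof. by rewrite /lebesgue_rV_succ /pushforward preimage_set0 measure0. Qed.

Let succ_ge0 A : 0 <= lebesgue_rV_succ A.
Proof. exact: (measure_ge0 (@lebesgue_measure R \x m)). Qed.

Let preimage_cons A : measurable A -> measurable (@rV_cons R n @^-1` A).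
Proof.
by move=> mA; rewrite -[X in measurable X]setTI; exact: measurable_rV_cons.
Qed.

Let succ_sigma_additive : semi_sigma_additive lebesgue_rV_succ.
Proof.
move=> F mF tF mUF; rewrite /lebesgue_rV_succ /pushforward preimage_bigcup.
apply: (@measure_semi_sigma_additive _ _ _ (@lebesgue_measure R \x m)
  (fun k => @rV_cons R n @^-1` F k)).
- by move=> k; exact: preimage_cons.
- apply/trivIsetP => /= i j _ _ ij; rewrite -preimage_setI.
  by move/trivIsetP : tF => /(_ _ _ _ _ ij) ->//; rewrite preimage_set0.
- by rewrite -preimage_bigcup; exact: preimage_cons.
Qed.

HB.instance Definition _ := isMeasure.Build _ _ _
  lebesgue_rV_succ succ0 succ_ge0 succ_sigma_additive.

Let succ_sigma_finite : sigma_finite setT lebesgue_rV_succ.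
Proof.
have /sigma_finiteP[F [TF ndF Foo]] := sigma_finiteT (@lebesgue_measure R).
have /sigma_finiteP[G [TG ndG Goo]] := sigma_finiteT m.
exists (fun k => @rV_uncons R n @^-1` (F k `*` G k)).
  apply/esym/seteqP; split => // x _.
  have [i _ Fi] : (\bigcup_i F i) (rV_uncons x).1 by rewrite -TF.
  have [j _ Gj] : (\bigcup_i G i) (rV_uncons x).2 by rewrite -TG.
  exists (maxn i j) => //; split.
    by move: Fi; exact/subsetPset/ndF/leq_maxl.
  by move: Gj; exact/subsetPset/ndG/leq_maxr.
move=> k; have [mF Fk] := Foo k; have [mG Gk] := Goo k.
have mFG : measurable (F k `*` G k) by exact: measurableX.
split; first by rewrite -[X in measurable X]setTI; exact: measurable_rV_uncons.
rewrite /lebesgue_rV_succ /pushforward -comp_preimage.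
rewrite (_ : _ \o _ = id); last by apply/funext => p /=; rewrite rV_consK.
by rewrite preimage_id product_measure1E// lte_mul_pinfty// ge0_fin_numE.
Qed.

HB.instance Definition _ := Measure_isSigmaFinite.Build _ _ _
  lebesgue_rV_succ succ_sigma_finite.

End lebesgue_rV_succ.

(* Lebesgue measure on R^n, as the n-fold product of the one on R. *)
Fixpoint lebesgue_rV (R : realType) (n : nat) :
    {sigma_finite_measure set 'rV[R]_n -> \bar R} :=
  match n with
  | 0 => \d_ (0 : 'rV[R]_0)
  | n'.+1 => lebesgue_rV_succ (lebesgue_rV R n')
  end.

Lemma measurable_box (R : realType) n (A : 'I_n -> set R) :
  (forall i, measurable (A i)) ->
  measurable [set x : 'rV[R]_n | forall i, A i (x ord0 i)].
Proof.
move=> mA; rewrite (_ : mkset _ =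
    \bigcap_(i in [set: 'I_n]) ((fun x : 'rV[R]_n => x ord0 i) @^-1` A i)).
  apply: fin_bigcap_measurable => // i _.
  by rewrite -[X in measurable X]setTI; exact: measurable_coord.
by apply/seteqP; split => x /= Ax i; [move=> _|]; exact: Ax.
Qed.

Lemma lebesgue_rV_box (R : realType) n (A : 'I_n -> set R) :
  (forall i, measurable (A i)) ->
  lebesgue_rV R n [set x | forall i, A i (x ord0 i)] =
  (\prod_(i < n) lebesgue_measure (A i))%E.
Proof.
elim: n A => [|n IH] A mA.
  by rewrite big_ord0 /= /dirac indicE mem_set// => -[].
rewrite big_ord_recl -IH//= /lebesgue_rV_succ /pushforward.
rewrite -product_measure1E; first last.
- exact: (measurable_box (fun i => mA (lift ord0 i))).
- exact: mA.
congr (product_measure1 _ _ _); apply/seteqP; split => -[t y] /=.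
  move=> Aty; split=> [|i]; first by have := Aty ord0; rewrite rV_cons0.
  by have := Aty (lift ord0 i); rewrite rV_consS.
move=> [At Ay] i; have [j ->|->] := unliftP ord0 i.
  by rewrite rV_consS.
by rewrite rV_cons0.
Qed.

Section sobolev.
Variables (R : realType) (n : nat).
Implicit Types (u g f phi : 'rV[R]_n -> R).

Local Notation mu := (lebesgue_rV R n).

Definition partial (i : 'I_n) phi : 'rV[R]_n -> R :=
  'D_(delta_mx ord0 i) phi.

(* All iterated partial derivatives exist and are differentiable: C^oo. *)
Definition smooth phi := forall (s : seq 'I_n) (x : 'rV[R]_n),
  differentiable (foldr partial phi s) x.

Definition test_function phi :=
  smooth phi /\ compact (closure [set x | phi x != 0]).

Definition weak_partial (i : 'I_n) u g := forall phi, test_function phi ->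
  \int[mu]_x (u x * partial i phi x) = - \int[mu]_x (g x * phi x).

(* H^1(R^n), through representatives: functions are identified up to
   lebesgue_rV-almost everywhere equality. *)
Definition H1 u := u \in Lfun mu 2%:E /\
  forall i, exists2 g, g \in Lfun mu 2%:E & weak_partial i u g.

(* The i-th component of the weak gradient of u in H^1; as weak derivatives are
   unique almost everywhere, the choice made here is immaterial. *)
Definition wderiv (i : 'I_n) u : 'rV[R]_n -> R :=
  xget (fun=> 0) [set g | g \in Lfun mu 2%:E /\ weak_partial i u g].

(* u in H^1 is a weak solution of - Delta u + lambda u = f in R^n. *)
Definition weak_solution (lambda : R) u f :=
  forall phi, test_function phi ->
  \int[mu]_x (\sum_(i < n) wderiv i u x * partial i phi x
              + lambda * u x * phi x) =
  \int[mu]_x (f x * phi x).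

End sobolev.

Definition critical_exponent (R : realType) (N : nat) : R :=
  2 * N%:R / (N%:R - 2).

(* Main.v *)
(* Write Q(z) for the integral of lambda1 u^2 + lambda2 v^2 - 2 beta u v. If
   lambda1 <= 0, lambda2 <= 0 or lambda1 lambda2 <= beta^2, then u, v or
   u + (beta / lambda2) v is a nonnegative superharmonic function in L^2, and these
   vanish in dimensions 3 and 4. Otherwise Q is positive definite and the Pohozaev
   identity Q(z) = 0 gives a contradiction. The inequality Q(z) <= 0 is obtained
   without any regularity theory: let Z = (U, V), where U(x) = T^(2-N) u(T^-2 x), be the
   dilation preserving the Dirichlet and the critical norms. Testing with Z and with
   the inverse dilation yields
     (1 - T^-4) Q(z, Z) = sum of mu_i (u^(2*-1) U - U^(2*-1) u),
   whose right-hand side is quadratic in u - U up to a term of integral 0. The same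
   two equations bound the Dirichlet norm of z - Z by (u - U)^2 integrated against
   u^(2*-2) + U^(2*-2), a potential that is form-small up to a bounded compactly
   supported part, on which |u - U| is O(T - 1) in L^2. Hence (T - 1) Q(z) is
   O((T - 1)^2) as T tends to 1. *)
Require Import Defs.
From HB Require Import structures.
From mathcomp Require Import all_boot all_order all_algebra.
From mathcomp Require Import all_classical all_reals all_analysis.
From mathcomp Require Import measurable_realfun ring lra.
Set Implicit Arguments.
Unset Strict Implicit.
Unset Printing Implicit Defensive.
Import Order.TTheory GRing.Theory Num.Theory.
Import numFieldNormedType.Exports.
Local Open Scope classical_set_scope.
Local Open Scope ring_scope.

(** * Lebesgue integration on R^n *)

(** The dimension enters through decay: a nonzero nonnegative superharmonic function is at least of
    the order |x|^(2-N) at infinity, which fails to be square integrable exactly when N <= 4. In the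
    positive definite case the usual multiplier x . grad z need not lie in H^1 for a weak solution;
    the finite dilation takes its place because it keeps every test function in H^1. The factor 1 -
    T^-4 arises because the inverse dilation is the exact adjoint of the dilation for the Dirichlet
    form and for the critical term, but only up to T^-4 for the L^2 products. The gain (T - 1) Q(z)
    is of first order, so all errors must be of second order. A direct estimate of the right-hand
    side is only of first order; hence the removal of a part with integral 0 and the absorption of
    the Dirichlet norm of z - Z, in which the positivity of Q at z - Z is used. *)

Section lebesgue_line.
Local Open Scope ereal_scope.
Context {R : realType}.
Local Notation leb := (@lebesgue_measure R).

Let affine (c h : R) : measurableTypeR R -> measurableTypeR R :=
  fun t => (c * t + h)%R.

Let measurable_affine c h : measurable_fun setT (affine c h).
Proof. by apply: measurable_funD => //; exact: measurable_funM. Qed.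

Let push (f : measurableTypeR R -> measurableTypeR R)
    (mf : measurable_fun setT f) : {measure set (measurableTypeR R) -> \bar R} :=
  measure_function_pushforward__canonical__measure_function_Measure leb mf.

(** The multiple by c of the image measure agrees with Lebesgue measure on half-open intervals, and
    these determine it. *)
Lemma lebesgue_measure_affine (c h : R) (A : set R) : (0 < c)%R -> measurable A ->
  c%:E * leb ((fun t => c * t + h)%R @^-1` A) = leb A.
Proof.
move=> c0 mA.
pose nu : {measure set (measurableTypeR R) -> \bar R} :=
  mscale (NngNum (ltW c0)) (push (measurable_affine c h)).
rewrite (_ : c%:E * _ = nu A)//.
apply/esym/lebesgue_measure_unique => // _ [[a b]] _ <-.
have E : (fun t => c * t + h)%R @^-1` `]a, b] = `]((a - h) / c)%R, ((b - h) / c)%R]%classic.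
  apply/seteqP; split => t /=; rewrite !in_itv/= ltr_pdivrMr// ler_pdivlMr//.
    by rewrite ltrBlDr lerBrDr ![(t * c)%R]mulrC.
  by rewrite ltrBlDr lerBrDr ![(t * c)%R]mulrC.
rewrite [RHS](_ : _ = c%:E * leb ((fun t => c * t + h)%R @^-1` `]a, b]))// E !lebesgue_measure_itv/= !lte_fin ltr_pM2r ?invr_gt0// ltrD2r.
case: ifPn => ab; last by rewrite mule0.
by rewrite -!EFinB -EFinM; congr (_%:E); field; rewrite gt_eqF.
Qed.

Lemma ge0_integral_affine (c h : R) (f : R -> \bar R) : (0 < c)%R ->
  measurable_fun setT f -> (forall t, 0 <= f t) ->
  c%:E * \int[leb]_t f (c * t + h)%R = \int[leb]_t f t.
Proof.
move=> c0 mf f0.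
pose nu : {measure set (measurableTypeR R) -> \bar R} :=
  mscale (NngNum (ltW c0)) (push (measurable_affine c h)).
transitivity (\int[nu]_t f t).
  by rewrite ge0_integral_mscale// ge0_integral_pushforward.
by apply: eq_measure_integral => A mA _; exact: lebesgue_measure_affine.
Qed.

Lemma ge0_integral_opp (f : R -> \bar R) :
  measurable_fun setT f -> (forall t, 0 <= f t) ->
  \int[leb]_t f (- t)%R = \int[leb]_t f t.
Proof.
move=> mf f0.
transitivity (\int[pushforward leb (-%R : _ -> measurableTypeR R)]_t f t).
  by rewrite ge0_integral_pushforward.
by apply: eq_measure_integral => //= A mA _; exact: lebesgue_measureN.
Qed.

End lebesgue_line.

Section lebesgue_space.
Local Open Scope ereal_scope.
Context {R : realType}.

Lemma ge0_integral_rVS n (f : 'rV[R]_n.+1 -> \bar R) :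
  measurable_fun setT f -> (forall x, 0 <= f x) ->
  \int[lebesgue_rV R n.+1]_x f x =
  \int[@lebesgue_measure R]_t \int[lebesgue_rV R n]_y f (rV_cons (t, y)).
Proof.
move=> mf f0; rewrite /= /lebesgue_rV_succ.
have mc := @measurable_rV_cons R n.
rewrite ge0_integral_pushforward//.
rewrite fubini_tonelli1//=.
  by apply: measurableT_comp => //; exact: measurable_rV_cons.
Qed.

Lemma measurable_rV_cons2 n (t : R) :
  measurable_fun setT (fun y : 'rV[R]_n => rV_cons (t, y)).
Proof. exact: (measurable_fun_pair2 t (@measurable_rV_cons R n)). Qed.

Lemma rV0E (x y : 'rV[R]_0) : x = y.
Proof. by apply/rowP => -[]. Qed.

Lemma measurable_rV_affine n (c : R) (h : 'rV[R]_n) :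
  measurable_fun setT (fun x : 'rV[R]_n => (c *: x + h)%R).
Proof.
apply: measurable_fun_rVP => i; under eq_fun do rewrite !mxE.
by apply: measurable_funD => //; apply: measurable_funM => //; exact: measurable_coord.
Qed.

(** Induction on the dimension by Tonelli: each coordinate contributes one factor c. *)
Lemma ge0_integral_rV_affine n (c : R) (h : 'rV[R]_n) (f : 'rV[R]_n -> \bar R) :
  (0 < c)%R -> measurable_fun setT f -> (forall x, 0 <= f x) ->
  (c ^+ n)%:E * \int[lebesgue_rV R n]_x f (c *: x + h)%R =
  \int[lebesgue_rV R n]_x f x.
Proof.
move=> c0; elim: n h f => [|n IH] h f mf f0.
  by rewrite expr0 mul1e; apply: eq_integral => x _; congr f; exact: rV0E.
have ma := @measurable_rV_affine n.+1 c h.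
rewrite !ge0_integral_rVS//; last exact: measurableT_comp mf ma.
pose g t := \int[lebesgue_rV R n]_y f (rV_cons (t, y)).
have mg : measurable_fun setT g.
  apply: (measurable_fun_fubini_tonelli_F (m2 := lebesgue_rV R n) (f \o @rV_cons R n)) => //.
    by apply: measurableT_comp => //; exact: measurable_rV_cons.
  by move=> x; exact: f0.
have g0 t : 0 <= g t by exact: integral_ge0.
rewrite -(ge0_integral_affine (h ord0 ord0) c0 mg g0) exprS EFinM -muleA; congr (_ * _).
rewrite -ge0_integralZl//; last 3 first.
- apply: (measurable_fun_fubini_tonelli_F (m2 := lebesgue_rV R n)
    (fun z => f (c *: rV_cons z + h)%R)) => //.
  apply: measurableT_comp => //.
  exact: (measurableT_comp ma (@measurable_rV_cons R n)).
- by move=> x _; exact: integral_ge0.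
- by rewrite lee_fin exprn_ge0// ltW.
apply: eq_integral => t _; rewrite /g.
rewrite -[RHS](IH (\row_j h ord0 (lift ord0 j))); last 2 first.
- exact: measurableT_comp mf (measurable_rV_cons2 _).
- by move=> y; exact: f0.
congr (_ * _); apply: eq_integral => y _; congr f.
apply/rowP => i; rewrite !mxE; case: (unliftP ord0 i) => [j|] -> /=.
  by rewrite !mxE.
by [].
Qed.

Lemma ge0_integral_rV_opp n (f : 'rV[R]_n -> \bar R) :
  measurable_fun setT f -> (forall x, 0 <= f x) ->
  \int[lebesgue_rV R n]_x f (- x)%R = \int[lebesgue_rV R n]_x f x.
Proof.
elim: n f => [|n IH] f mf f0.
  by apply: eq_integral => x _; congr f; exact: rV0E.
have mo : measurable_fun setT (fun x : 'rV[R]_n.+1 => (- x)%R).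
  apply: measurable_fun_rVP => i; under eq_fun do rewrite !mxE.
  by apply: measurableT_comp => //; exact: measurable_coord.
rewrite !ge0_integral_rVS//; last exact: measurableT_comp mf mo.
pose g t := \int[lebesgue_rV R n]_y f (rV_cons (t, y)).
have mg : measurable_fun setT g.
  apply: (measurable_fun_fubini_tonelli_F (m2 := lebesgue_rV R n) (f \o @rV_cons R n)) => //.
    by apply: measurableT_comp => //; exact: measurable_rV_cons.
  by move=> x; exact: f0.
have g0 t : 0 <= g t by exact: integral_ge0.
rewrite -(ge0_integral_opp mg g0).
apply: eq_integral => t _; rewrite /g -[RHS]IH; last 2 first.
- exact: measurableT_comp mf (measurable_rV_cons2 _).
- by move=> y; exact: f0.
apply: eq_integral => y _; congr f.
apply/rowP => i; rewrite !mxE; case: (unliftP ord0 i) => [j|] _ /=; last by [].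
by rewrite mxE.
Qed.

End lebesgue_space.

(** * Integrable and square integrable real functions *)

Section integrable_tools.
Context d (T : measurableType d) (R : realType) (mu : {measure set T -> \bar R}).
Implicit Types (f g : T -> R).

Definition L1 f := mu.-integrable setT (EFin \o f).

Lemma L1_meas f : L1 f -> measurable_fun setT f.
Proof. by move=> /measurable_int/measurable_EFinP. Qed.

Lemma L1P f : measurable_fun setT f -> (\int[mu]_x `|(f x)%:E| < +oo)%E -> L1 f.
Proof. by move=> mf h; apply/integrableP; split => //; exact/measurable_EFinP. Qed.

Lemma L1_lty f : L1 f -> (\int[mu]_x `|(f x)%:E| < +oo)%E.
Proof. by move/integrableP => []. Qed.

Lemma L1_ge0P f : measurable_fun setT f -> (forall x, 0 <= f x) ->
  (\int[mu]_x (f x)%:E < +oo)%E -> L1 f.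
Proof.
move=> mf f0 h; apply: L1P => //; under eq_integral do rewrite gee0_abs ?lee_fin//.
by [].
Qed.

Lemma L1_le f g : measurable_fun setT f -> (forall x, `|f x| <= `|g x|) -> L1 g -> L1 f.
Proof.
by move=> mf fg; apply: le_integrable => //; [exact/measurable_EFinP|
   move=> x _; rewrite lee_fin].
Qed.

Lemma L1_dom f g : measurable_fun setT f -> (forall x, `|f x| <= g x) -> L1 g -> L1 f.
Proof.
move=> mf fg; apply: L1_le => // x; rewrite (le_trans (fg x))//.
by rewrite ler_norm.
Qed.

Lemma eq_L1 f g : f =1 g -> L1 f -> L1 g.
Proof. by move=> /funext ->. Qed.

Lemma L1D f g : L1 f -> L1 g -> L1 (fun x => f x + g x).
Proof. by move=> lf lg; exact: (integrableD measurableT lf lg). Qed.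

Lemma L1B f g : L1 f -> L1 g -> L1 (fun x => f x - g x).
Proof. by move=> lf lg; exact: (integrableB measurableT lf lg). Qed.

Lemma L1Z c f : L1 f -> L1 (fun x => c * f x).
Proof. by move=> lf; exact: (integrableZl measurableT c lf). Qed.

Lemma L1_norm f : L1 f -> L1 (fun x => `|f x|).
Proof. exact: integrable_norm. Qed.

Lemma L1_0 : L1 (fun=> 0).
Proof. by rewrite /L1 (_ : EFin \o _ = cst 0%E)//; exact: integrable0. Qed.

Lemma L1_sum (I : Type) (s : seq I) (F : I -> T -> R) :
  (forall i, L1 (F i)) -> L1 (fun x => \sum_(i <- s) F i x).
Proof.
move=> h; elim: s => [|i s ih].
  by under eq_fun do rewrite big_nil; exact: L1_0.
by under eq_fun do rewrite big_cons; exact: L1D.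
Qed.

Lemma RintD f g : L1 f -> L1 g ->
  \int[mu]_x (f x + g x) = \int[mu]_x f x + \int[mu]_x g x.
Proof. by move=> *; exact: RintegralD. Qed.

Lemma RintB f g : L1 f -> L1 g ->
  \int[mu]_x (f x - g x) = \int[mu]_x f x - \int[mu]_x g x.
Proof. by move=> *; exact: RintegralB. Qed.

Lemma RintZ c f : L1 f -> \int[mu]_x (c * f x) = c * \int[mu]_x f x.
Proof. by move=> *; exact: RintegralZl. Qed.

Lemma RintN f : L1 f -> \int[mu]_x (- f x) = - \int[mu]_x f x.
Proof.
move=> h; under eq_Rintegral do rewrite -mulN1r.
by rewrite RintZ// mulN1r.
Qed.

Lemma Rint0 : \int[mu]_x (0 : R) = 0.
Proof. by rewrite /Rintegral integral0. Qed.

Lemma Rint_sum (I : Type) (s : seq I) (F : I -> T -> R) :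
  (forall i, L1 (F i)) ->
  \int[mu]_x (\sum_(i <- s) F i x) = \sum_(i <- s) \int[mu]_x F i x.
Proof.
move=> h; elim: s => [|i s ih].
  by rewrite big_nil; under eq_Rintegral do rewrite big_nil; exact: Rint0.
rewrite big_cons -ih -RintD//; last exact: L1_sum.
by under eq_Rintegral do rewrite big_cons.
Qed.

Lemma Rint_le f g : L1 f -> L1 g -> (forall x, f x <= g x) ->
  \int[mu]_x f x <= \int[mu]_x g x.
Proof. by move=> *; exact: le_Rintegral. Qed.

Lemma Rint_ge0 f : (forall x, 0 <= f x) -> 0 <= \int[mu]_x f x.
Proof. by move=> h; apply: Rintegral_ge0. Qed.

Lemma Rint_norm f : L1 f -> `|\int[mu]_x f x| <= \int[mu]_x `|f x|.
Proof. by move=> h; exact: le_normr_Rintegral. Qed.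

Lemma RintE f : L1 f -> (\int[mu]_x f x)%:E = (\int[mu]_x (f x)%:E)%E.
Proof. by move=> h; rewrite /Rintegral fineK//; exact: integrable_fin_num. Qed.

Lemma eq_Rint f g : f =1 g -> \int[mu]_x f x = \int[mu]_x g x.
Proof. by move=> fg; apply: eq_Rintegral => x _; exact: fg. Qed.

Lemma ae_eq_Rint f g : measurable_fun setT f -> measurable_fun setT g ->
  {ae mu, forall x, f x = g x} -> \int[mu]_x f x = \int[mu]_x g x.
Proof.
move=> mf mg fg; rewrite /Rintegral; congr fine; apply: ae_eq_integral => //.
- exact/measurable_EFinP.
- exact/measurable_EFinP.
- by apply: filterS fg => x /= -> _.
Qed.

Lemma Rint_eq0_ae f : L1 f -> (forall x, 0 <= f x) -> \int[mu]_x f x = 0 ->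
  {ae mu, forall x, f x = 0}.
Proof.
move=> lf f0 h; have mf := L1_meas lf.
have := @ae_eq_integral_abs _ _ _ mu setT measurableT (EFin \o f) => /(_ _)[].
  exact/measurable_EFinP.
move=> H _; have : (\int[mu]_x `|(EFin \o f) x| = 0)%E.
  transitivity (\int[mu]_x (f x)%:E)%E.
    by apply: eq_integral => x _ /=; rewrite ger0_norm.
  by rewrite -RintE// h.
by move=> /H; apply: filterS => x /= /(_ I) [].
Qed.

Lemma dominated_Rint (F : nat -> T -> R) f g :
  (forall n, measurable_fun setT (F n)) -> measurable_fun setT f -> L1 g ->
  {ae mu, forall x, F ^~ x @ \oo --> f x} ->
  (forall n x, `|F n x| <= g x) ->
  \int[mu]_x F n x @[n --> \oo] --> \int[mu]_x f x.
Proof.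
move=> mF mf lg Ff Fg.
have [i1 _ i3] : [/\ mu.-integrable setT (EFin \o f),
  (fun n => \int[mu]_x (`|(F n x)%:E - (f x)%:E|))%E @ \oo --> (0%R)%:E &
  (fun n => \int[mu]_x ((F n x)%:E))%E @ \oo --> (\int[mu]_x (f x)%:E)%E].
  apply: (@dominated_convergence _ _ _ mu setT measurableT
    (fun n => EFin \o F n) (EFin \o f) (EFin \o g)) => //.
  - by move=> n; exact/measurable_EFinP.
  - exact/measurable_EFinP.
  - by apply: filterS Ff => x /= h _; apply: cvg_EFin => //; exact: nearW.
  - by apply: aeW => x n _; rewrite lee_fin.
have lF n : L1 (F n) by apply: L1_dom lg.
rewrite /Rintegral; apply: fine_cvg; rewrite fineK//.
exact: integrable_fin_num.
Qed.

Definition L2 f := measurable_fun setT f /\ L1 (fun x => f x ^+ 2).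

Lemma L2_meas f : L2 f -> measurable_fun setT f. Proof. by case. Qed.

Lemma L2_sqr f : L2 f -> L1 (fun x => f x ^+ 2). Proof. by case. Qed.

Lemma Lfun2_L2 f : f \in Lfun mu 2%:E -> L2 f.
Proof.
move=> h; split; last exact: Lfun2_integrable_sqr.
by move: h; rewrite inE => /andP[]; rewrite inE.
Qed.

Lemma L2M f g : L2 f -> L2 g -> L1 (fun x => f x * g x).
Proof.
move=> [mf lf] [mg lg]; apply: L1_dom (L1D lf lg).
  exact: measurable_funM.
move=> x; rewrite normrM -[_ ^+ 2]real_normK ?num_real// -[g x ^+ 2]real_normK ?num_real//.
have := sqr_ge0 (`|f x| - `|g x|).
have := mulr_ge0 (normr_ge0 (f x)) (normr_ge0 (g x)).
nra.
Qed.

Lemma L2D f g : L2 f -> L2 g -> L2 (fun x => f x + g x).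
Proof.
move=> lf lg; split; first exact: measurable_funD (L2_meas lf) (L2_meas lg).
under eq_fun do rewrite sqrrD; apply: L1D; last exact: (L2_sqr lg).
apply: L1D; first exact: L2_sqr.
under eq_fun do rewrite -mulr_natl.
by apply: L1Z; exact: L2M.
Qed.

Lemma L2Z c f : L2 f -> L2 (fun x => c * f x).
Proof.
move=> [mf lf]; split; first exact: measurable_funM.
by under eq_fun do rewrite exprMn; exact: L1Z.
Qed.

Lemma L2N f : L2 f -> L2 (fun x => - f x).
Proof. by move=> lf; under eq_fun do rewrite -mulN1r; exact: L2Z. Qed.

Lemma L2B f g : L2 f -> L2 g -> L2 (fun x => f x - g x).
Proof. by move=> lf lg; apply: L2D => //; exact: L2N. Qed.

Lemma L2_dom f g : measurable_fun setT f -> (forall x, `|f x| <= `|g x|) -> L2 g -> L2 f.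
Proof.
move=> mf fg [mg lg]; split => //; apply: L1_le lg; first exact: measurable_funX.
by move=> x; rewrite !normrX lerXn2r// nnegrE.
Qed.

Lemma L2_norm f : L2 f -> L2 (fun x => `|f x|).
Proof.
move=> lf; apply: (L2_dom _ _ lf); last by move=> x; rewrite normr_id.
exact: measurableT_comp (L2_meas lf).
Qed.

Lemma L2_Mbounded f g M : L2 f -> measurable_fun setT g -> (forall x, `|g x| <= M) ->
  L2 (fun x => g x * f x).
Proof.
move=> lf mg gM; apply: (L2_dom _ _ (L2Z M lf)).
  exact: measurable_funM mg (L2_meas lf).
move=> x; rewrite !normrM ler_wpM2r//.
by rewrite (le_trans (gM x))// ler_norm.
Qed.

Lemma L2_0 : L2 (fun=> 0).
Proof. by split => //; under eq_fun do rewrite expr0n; exact: L1_0. Qed.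

Lemma L2_sum (I : Type) (s : seq I) (F : I -> T -> R) :
  (forall i, L2 (F i)) -> L2 (fun x => \sum_(i <- s) F i x).
Proof.
move=> h; elim: s => [|i s ih].
  by under eq_fun do rewrite big_nil; exact: L2_0.
by under eq_fun do rewrite big_cons; exact: L2D.
Qed.

Lemma cauchy_schwarz f g : L2 f -> L2 g ->
  (\int[mu]_x (f x * g x)) ^+ 2 <= \int[mu]_x (f x ^+ 2) * \int[mu]_x (g x ^+ 2).
Proof.
move=> lf lg; set a := \int[mu]_x (f x ^+ 2); set b := \int[mu]_x (g x ^+ 2).
set c := \int[mu]_x _.
have a0 : 0 <= a by apply: Rint_ge0 => x; exact: sqr_ge0.
have b0 : 0 <= b by apply: Rint_ge0 => x; exact: sqr_ge0.
have H t : 0 <= a - 2 * t * c + t ^+ 2 * b.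
  have -> : a - 2 * t * c + t ^+ 2 * b = \int[mu]_x ((f x - t * g x) ^+ 2).
    rewrite -!RintZ; [|exact: L2_sqr|exact: L2M].
    rewrite -RintB; [|exact: L2_sqr|exact/L1Z/L2M].
    rewrite -RintD; [|apply: L1B; [exact: L2_sqr|exact/L1Z/L2M]|exact/L1Z/L2_sqr].
    by apply: eq_Rint => x; ring.
  by apply: Rint_ge0 => x; exact: sqr_ge0.
have [b_eq0|bn0] := eqVneq b 0.
  rewrite b_eq0 mulr0.
  have [->|cn0] := eqVneq c 0; first by rewrite expr0n.
  (* For b = 0 the form is affine in t, and this t gives it the value -1. *)
  have := H ((a + 1) / (2 * c)); rewrite b_eq0 mulr0 addr0.
  have -> : 2 * ((a + 1) / (2 * c)) * c = a + 1 by field.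
  lra.
have bp : 0 < b by rewrite lt_def bn0.
(* The minimiser of the quadratic form in t. *)
have := H (c / b).
have -> : a - 2 * (c / b) * c + (c / b) ^+ 2 * b = (a * b - c ^+ 2) / b by field.
by rewrite ler_pdivlMr// mul0r subr_ge0.
Qed.

Lemma Rint_sqrD f g : L2 f -> L2 g ->
  \int[mu]_x ((f x + g x) ^+ 2) <= 2 * (\int[mu]_x (f x ^+ 2) + \int[mu]_x (g x ^+ 2)).
Proof.
move=> lf lg; rewrite -RintD; [|exact: L2_sqr|exact: L2_sqr].
have h : L1 (fun x => f x ^+ 2 + g x ^+ 2) by apply: L1D; exact: L2_sqr.
rewrite -RintZ//; apply: Rint_le; [exact/L2_sqr/L2D|exact: L1Z|].
by move=> x; have := sqr_ge0 (f x - g x); nra.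
Qed.

End integrable_tools.

(** * Open sets and continuous functions are measurable *)

Section borel_rV.
Context {R : realType} (n : nat).

(** The sigma-algebra is generated by the coordinates, so an open set is exhausted by those cells of
    the grids of mesh 1/(p+1) that it contains; the cells are countable and [pickle] enumerates
    them. *)
Lemma open_measurable_rV (A : set 'rV[R]_n) : open A -> measurable A.
Proof.
move=> oA.
pose box (p : nat * 'rV[int]_n) := [set x : 'rV[R]_n | forall i,
  `[(p.2 ord0 i)%:~R / p.1.+1%:R, (p.2 ord0 i + 1)%:~R / p.1.+1%:R[%classic (x ord0 i)].
have mbox p : measurable (box p).
  by apply: (@measurable_box R n (fun i => `[_, _[%classic)) => i.
pose F m := if @unpickle (nat * 'rV[int]_n)%type m is Some p then
  if pselect (box p `<=` A) then box p else set0 else set0.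
have -> : A = \bigcup_m F m.
  apply/seteqP; split => [x Ax|x [m _]]; last first.
    rewrite /F; case: unpickle => // p; case: pselect => // h; exact: h.
  have /nbhs_ballP[e /= e0 xe] : nbhs x A by exact: open_nbhs_nbhs.
  (* The cell of mesh 1/(k+1) around x has side less than e, hence lies in the ball of radius e of
     the maximum norm. *)
  pose k := Num.truncn e^-1.
  have ke : k.+1%:R^-1 < e.
    by rewrite invf_plt ?posrE//; apply: truncnS_gt; rewrite invr_ge0 ltW.
  pose q := \row_i Num.floor (k.+1%:R * x ord0 i).
  have k0 : 0 < k.+1%:R :> R by [].
  exists (pickle (k, q)) => //; rewrite /F pickleK; case: pselect => [_ i|].
    rewrite /= mxE in_itv/= ler_pdivrMr// ltr_pdivlMr//.
    by rewrite mulrC ge_floor/= mulrC floorD1_gt.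
  case=> y yb; apply: xe; split => // i j; rewrite (ord1 i).
  move: (yb j); rewrite /= mxE in_itv/= ler_pdivrMr// ltr_pdivlMr// => /andP[y1 y2].
  have x1 : (Num.floor (k.+1%:R * x ord0 j))%:~R <= k.+1%:R * x ord0 j by exact: ge_floor.
  have x2 : k.+1%:R * x ord0 j < (Num.floor (k.+1%:R * x ord0 j) + 1)%:~R by exact: floorD1_gt.
  rewrite /ball/= (lt_trans _ ke)// -[ltRHS]div1r ltr_pdivlMr//.
  rewrite -[X in _ * X]ger0_norm// -normrM ltr_norml; rewrite intrD in y2 x2.
  by apply/andP; split; nra.
apply: bigcupT_measurable => m; rewrite /F; case: unpickle => [p|]; last exact: measurable0.
by case: pselect => ?; [exact: mbox|exact: measurable0].
Qed.

Lemma continuous_measurable_rV (f : 'rV[R]_n -> R) :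
  continuous f -> measurable_fun setT f.
Proof.
move=> cf; apply: (measurability _ (RGenOInfty.measurableE R)) => //.
move=> /= _ [_ [a ->] <-]; rewrite setTI; apply: open_measurable_rV.
by apply: open_comp; [move=> x _; exact: cf|rewrite set_itvoy; exact: open_gt].
Qed.

End borel_rV.

(** * Changes of variables for real-valued integrals *)

Section change_of_variables.
Context {R : realType} (n : nat).
Local Notation mu := (lebesgue_rV R n).
Implicit Types f : 'rV[R]_n -> R.

Section transfer.
Variables (k : R) (T : 'rV[R]_n -> 'rV[R]_n).
Hypotheses (k0 : 0 < k) (mT : measurable_fun setT T).
Hypothesis kT : forall F : 'rV[R]_n -> \bar R, measurable_fun setT F ->
  (forall x, 0 <= F x)%E -> (k%:E * \int[mu]_x F (T x) = \int[mu]_x F x)%E.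

Lemma L1_transfer f : L1 mu f -> L1 mu (fun x => f (T x)).
Proof.
move=> lf; have mf := L1_meas lf; apply: L1P; first exact: measurableT_comp mf mT.
have := L1_lty lf; rewrite -(kT (F := fun x => `|(f x)%:E|%E))//; last first.
  by apply: measurableT_comp => //; exact/measurable_EFinP.
have : (0 <= \int[mu]_x `|(f (T x))%:E|)%E by exact: integral_ge0.
case: (\int[mu]_x `|(f (T x))%:E|)%E => [r _ _| |//].
  by rewrite ltry.
by rewrite mulry gtr0_sg// mul1e.
Qed.

Lemma Rint_transfer f : L1 mu f -> k * \int[mu]_x f (T x) = \int[mu]_x f x.
Proof.
move=> lf; have mf := L1_meas lf.
have lp : L1 mu (fun x => Num.max (f x) 0).
  apply: L1_le lf => [|x]; first exact: measurable_maxr.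
  by rewrite /Num.max; case: ifPn => // _; rewrite normr0.
have lm : L1 mu (fun x => Num.max (- f x) 0).
  apply: L1_le lf => [|x].
    by apply: measurable_maxr => //; exact: measurableT_comp.
  by rewrite /Num.max; case: ifPn => // _; rewrite ?normr0// normrN.
have E x : f x = Num.max (f x) 0 - Num.max (- f x) 0.
  by rewrite /Num.max oppr_lt0; case: (ltgtP (f x) 0) => ? //; lra.
have H g : L1 mu g -> (forall x, 0 <= g x) -> k * \int[mu]_x g (T x) = \int[mu]_x g x.
  move=> lg g0; apply: EFin_inj; rewrite EFinM !RintE//; last exact: L1_transfer.
  apply: (kT (F := fun x => (g x)%:E)) => [|x]; last by rewrite lee_fin.
  by apply/measurable_EFinP; exact: L1_meas lg.
rewrite (eq_Rint _ (fun x => E (T x))) (eq_Rint _ E).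
rewrite RintB//; [|exact: (L1_transfer lp)|exact: (L1_transfer lm)].
rewrite RintB// mulrBr (H _ lp) ?(H _ lm)// => x; by rewrite le_max lexx orbT.
Qed.

Lemma L2_transfer f : L2 mu f -> L2 mu (fun x => f (T x)).
Proof.
move=> [mf lf]; split; first exact: measurableT_comp mf mT.
exact: (L1_transfer lf).
Qed.

End transfer.

Variables (c : R) (h : 'rV[R]_n).
Hypothesis c0 : 0 < c.

Let kaff (F : 'rV[R]_n -> \bar R) : measurable_fun setT F -> (forall x, 0 <= F x)%E ->
  ((c ^+ n)%:E * \int[mu]_x F (c *: x + h)%R = \int[mu]_x F x)%E.
Proof. exact: ge0_integral_rV_affine. Qed.

Let cn0 : 0 < c ^+ n. Proof. exact: exprn_gt0. Qed.

Lemma L1_affine f : L1 mu f -> L1 mu (fun x => f (c *: x + h)).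
Proof. exact: (L1_transfer cn0 (measurable_rV_affine c h) kaff). Qed.

Lemma L2_affine f : L2 mu f -> L2 mu (fun x => f (c *: x + h)).
Proof. exact: (L2_transfer cn0 (measurable_rV_affine c h) kaff). Qed.

Lemma Rint_affine f : L1 mu f ->
  c ^+ n * \int[mu]_x f (c *: x + h) = \int[mu]_x f x.
Proof. exact: (Rint_transfer cn0 (measurable_rV_affine c h) kaff). Qed.

End change_of_variables.

Section special_change_of_variables.
Context {R : realType} (n : nat).
Local Notation mu := (lebesgue_rV R n).
Implicit Types f : 'rV[R]_n -> R.

Lemma L1_scale (c : R) f : 0 < c -> L1 mu f -> L1 mu (fun x => f (c *: x)).
Proof. by move=> c0 /(L1_affine 0 c0); under eq_fun do rewrite addr0. Qed.

Lemma L2_scale (c : R) f : 0 < c -> L2 mu f -> L2 mu (fun x => f (c *: x)).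
Proof. by move=> c0 /(L2_affine 0 c0); under eq_fun do rewrite addr0. Qed.

Lemma Rint_scale (c : R) f : 0 < c -> L1 mu f ->
  c ^+ n * \int[mu]_x f (c *: x) = \int[mu]_x f x.
Proof.
move=> c0 /(Rint_affine 0 c0) <-; congr (_ * _).
by apply: eq_Rint => x; rewrite addr0.
Qed.

Lemma L1_shift h f : L1 mu f -> L1 mu (fun x => f (x + h)).
Proof.
by move=> /(L1_affine h ltr01); under eq_fun do rewrite scale1r.
Qed.

Lemma L2_shift h f : L2 mu f -> L2 mu (fun x => f (x + h)).
Proof.
by move=> /(L2_affine h ltr01); under eq_fun do rewrite scale1r.
Qed.

Lemma Rint_shift h f : L1 mu f -> \int[mu]_x f (x + h) = \int[mu]_x f x.
Proof.
move=> /(Rint_affine h ltr01) <-; rewrite expr1n mul1r.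
by apply: eq_Rint => x; rewrite scale1r.
Qed.

Lemma measurable_rV_opp : measurable_fun setT (fun x : 'rV[R]_n => - x).
Proof.
apply: measurable_fun_rVP => i; under eq_fun do rewrite !mxE.
by apply: measurableT_comp => //; exact: measurable_coord.
Qed.

Let kopp h (F : 'rV[R]_n -> \bar R) : measurable_fun setT F -> (forall x, 0 <= F x)%E ->
  (1%:E * \int[mu]_x F (h - x)%R = \int[mu]_x F x)%E.
Proof.
move=> mF F0; rewrite mul1e.
have ms : measurable_fun setT (fun x : 'rV[R]_n => (x + h)%R).
  by have := measurable_rV_affine 1 h; under eq_fun do rewrite scale1r.
rewrite -[RHS](ge0_integral_rV_affine h ltr01)//.
rewrite -[in RHS]ge0_integral_rV_opp.
- rewrite expr1n mul1e; apply: eq_integral => x _; congr F.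
  by rewrite scale1r addrC.
- by under eq_fun do rewrite scale1r; exact: measurableT_comp mF ms.
- by move=> x; exact: F0.
Qed.

Let mopp h : measurable_fun setT (fun x : 'rV[R]_n => h - x).
Proof.
have ms : measurable_fun setT (fun x : 'rV[R]_n => (x + h)%R).
  by have := measurable_rV_affine 1 h; under eq_fun do rewrite scale1r.
under eq_fun do rewrite addrC.
exact: measurableT_comp ms measurable_rV_opp.
Qed.

Lemma L1_reflect h f : L1 mu f -> L1 mu (fun x => f (h - x)).
Proof. exact: (L1_transfer ltr01 (mopp h) (kopp h)). Qed.

Lemma Rint_reflect h f : L1 mu f -> \int[mu]_x f (h - x) = \int[mu]_x f x.
Proof.
by move=> /(Rint_transfer ltr01 (mopp h) (kopp h)); rewrite mul1r.
Qed.

Definition cube (r : R) := [set x : 'rV[R]_n | forall i, `[- r, r]%classic (x ord0 i)].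

Lemma measurable_cube r : measurable (cube r).
Proof. by apply: (@measurable_box R n (fun=> `[_, _]%classic)) => i. Qed.

Lemma lebesgue_cube r : 0 <= r -> mu (cube r) = ((2 * r) ^+ n)%:E.
Proof.
move=> r0; rewrite (@lebesgue_rV_box R n (fun=> `[_, _]%classic))//.
under eq_bigr do rewrite lebesgue_measure_itv/= lte_fin.
have -> : (if - r < r then (r%:E - (- r)%:E)%E else 0%E) = (2 * r)%:E.
  case: ifPn => h; first by rewrite -EFinB; congr EFin; ring.
  by congr EFin; lra.
by rewrite prodEFin big_const_ord iter_mulr mulr1.
Qed.

(** The norm of row vectors is the maximum norm, so closed balls are boxes, whose measure is known
    as a product. *)
Lemma cubeP r (x : 'rV[R]_n) : 0 <= r -> cube r x <-> `|x| <= r.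
Proof.
move=> r0; split => [h|h i].
  rewrite /Num.norm/= mx_normrE; apply: bigmax_le => // -[i j] _ /=.
  by rewrite (ord1 i) ler_norml; have := h j; rewrite /= in_itv.
rewrite /= in_itv/= -ler_norml; apply: le_trans h.
rewrite [leRHS]/Num.norm/= mx_normrE.
exact: (le_bigmax _ (fun ij : 'I_1 * 'I_n => `|x ij.1 ij.2|) (ord0, i)).
Qed.

Lemma L1_cube_indic r : 0 <= r -> L1 mu (fun x => \1_(cube r) x : R).
Proof.
move=> r0; apply: L1_ge0P => //; first by apply: measurable_indic; exact: measurable_cube.
rewrite integral_indic ?setIT//; last exact: measurable_cube.
by rewrite (_ : (_ < _)%E = (mu (cube r) < +oo)%E) // lebesgue_cube // ltry.
Qed.

Lemma Rint_cube_indic r : 0 <= r -> \int[mu]_x (\1_(cube r) x : R) = (2 * r) ^+ n.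
Proof.
move=> r0; rewrite /Rintegral integral_indic ?setIT//; last exact: measurable_cube.
by rewrite -[RHS]/(fine ((2 * r) ^+ n)%:E) -lebesgue_cube.
Qed.

End special_change_of_variables.

(** * Smooth functions and test functions *)

Section partial_calculus.
Context {R : realType} {n : nat}.
Implicit Types (f g phi : 'rV[R]_n -> R) (i : 'I_n) (x h : 'rV[R]_n).
Local Notation e_ i := (delta_mx ord0 i : 'rV[R]_n).

Lemma partialE i f x : differentiable f x -> partial i f x = 'd f x (e_ i).
Proof. exact: deriveE. Qed.

Lemma diff_sum_partial f x h : differentiable f x ->
  'd f x h = \sum_i h ord0 i * partial i f x.
Proof.
move=> df; rewrite [in LHS](row_sum_delta h) linear_sum/=.
by apply: eq_bigr => i _; rewrite linearZ/= partialE.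
Qed.

Lemma is_derive_curve (r : R -> 'rV[R]_n) (t : R) (v : 'rV[R]_n) f :
  is_derive t 1 r v -> differentiable f (r t) ->
  is_derive t (1 : R) (f \o r) (\sum_i v ord0 i * partial i f (r t)).
Proof.
move=> dr df; have dr' : differentiable r t by apply/derivable1_diffP.
apply: DeriveDef; first by apply/derivable1_diffP; exact: differentiable_comp.
rewrite deriveE; last exact: differentiable_comp.
by rewrite diff_comp//= -(deriveE _ dr') derive_val diff_sum_partial.
Qed.

Lemma partialD i f g x : differentiable f x -> differentiable g x ->
  partial i (fun y => f y + g y) x = partial i f x + partial i g x.
Proof. by move=> df dg; rewrite /partial deriveD//; exact: diff_derivable. Qed.

Lemma partialM i f g x : differentiable f x -> differentiable g x ->
  partial i (fun y => f y * g y) x = f x * partial i g x + g x * partial i f x.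
Proof. by move=> df dg; rewrite /partial deriveM//; exact: diff_derivable. Qed.

Lemma partial_cst i (c : R) x : partial i (fun=> c) x = 0.
Proof. exact: derive_cst. Qed.

Lemma partialZ i c f x : differentiable f x ->
  partial i (fun y => c * f y) x = c * partial i f x.
Proof. by move=> df; rewrite partialM// partial_cst mulr0 addr0. Qed.

Lemma partial_coord i j x : partial i (fun y => y ord0 j) x = (i == j)%:R.
Proof.
have := derive_mx (@derivable_id _ 'rV[R]_n x (e_ i)).
rewrite derive_id => /matrixP/(_ ord0 j); rewrite !mxE eqxx/= eq_sym => ->.
by [].
Qed.

Lemma differentiable_comp1 f (g : R -> R) (dg : R) x : differentiable f x ->
  is_derive (f x) 1 g dg -> differentiable (fun y => g (f y)) x.
Proof.
move=> df dg'; apply: differentiable_comp => //.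
by apply/derivable1_diffP; exact: ex_derive.
Qed.

Lemma partial_comp1 i f (g : R -> R) (dg : R) x : differentiable f x ->
  is_derive (f x) 1 g dg -> partial i (fun y => g (f y)) x = dg * partial i f x.
Proof.
move=> df dg'; have dg1 : differentiable g (f x) by apply/derivable1_diffP.
rewrite partialE; last exact: differentiable_comp.
rewrite (diff_comp df dg1)/= partialE//.
rewrite -[X in 'd g _ X]mulr1 [LHS]linearZ/= -(deriveE _ dg1) derive_val.
by rewrite mulrC.
Qed.

(** [smooth] speaks of all iterated derivatives, so an induction over them needs a class that is
    stable under [partial]. By the Leibniz rule this one is, as soon as the derivatives of the
    generators belong to it. *)
Inductive generated (G : set ('rV[R]_n -> R)) : ('rV[R]_n -> R) -> Prop :=
| gen_in f : G f -> generated G f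
| gen_add f g : generated G f -> generated G g -> generated G (fun x => f x + g x)
| gen_mul f g : generated G f -> generated G g -> generated G (fun x => f x * g x).

Lemma generated_differentiable G f : (forall g, G g -> forall x, differentiable g x) ->
  generated G f -> forall x, differentiable f x.
Proof.
move=> dG; elim=> {f} [f /dG//|f g _ df _ dg x|f g _ df _ dg x].
- exact: differentiableD.
- exact: differentiableM.
Qed.

(* Smoothness only has to be checked on generators of a differential algebra. *)
Lemma generated_smooth G f : (forall g, G g -> forall x, differentiable g x) ->
  (forall i g, G g -> generated G (partial i g)) ->
  generated G f -> smooth f.
Proof.
move=> dG pG Gf; suff H (s : seq 'I_n) : generated G (foldr (@partial R n) f s).
  by move=> s x; exact: (generated_differentiable dG (H s)).
elim: s => //= i s; move: (foldr _ _ _) => {}f {Gf}.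
elim=> {f} [f Gf|f g Gf pf Gg pg|f g Gf pf Gg pg]; first exact: pG.
- rewrite (_ : partial i _ = fun x => partial i f x + partial i g x).
    exact: gen_add.
  apply/funext => x; apply: partialD; exact: (generated_differentiable dG).
- rewrite (_ : partial i _ = fun x => f x * partial i g x + g x * partial i f x).
    by apply: gen_add; exact: gen_mul.
  apply/funext => x; apply: partialM; exact: (generated_differentiable dG).
Qed.

Lemma smooth_partial i f : smooth f -> smooth (partial i f).
Proof. by move=> sf s x; have := sf (rcons s i) x; rewrite foldr_rcons. Qed.

Lemma smooth_diff f : smooth f -> forall x, differentiable f x.
Proof. by move=> sf; exact: (sf [::]). Qed.

Lemma smooth_continuous f : smooth f -> continuous f.
Proof. by move=> sf x; exact/differentiable_continuous/smooth_diff. Qed.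

Lemma smooth_alg f : generated (@smooth R n) f -> smooth f.
Proof.
apply: generated_smooth => [g|i g sg]; first exact: smooth_diff.
exact/gen_in/smooth_partial.
Qed.

Lemma smoothD f g : smooth f -> smooth g -> smooth (fun x => f x + g x).
Proof. by move=> sf sg; apply: smooth_alg; apply: gen_add; exact: gen_in. Qed.

Lemma smoothM f g : smooth f -> smooth g -> smooth (fun x => f x * g x).
Proof. by move=> sf sg; apply: smooth_alg; apply: gen_mul; exact: gen_in. Qed.

Lemma smooth_cst (c : R) : smooth (fun _ : 'rV[R]_n => c).
Proof.
apply: (@generated_smooth [set f | exists c : R, f = fun=> c]).
- by move=> _ [d ->] x; exact: differentiable_cst.
- move=> i _ [d ->]; apply: gen_in; exists 0; apply/funext => x.
  exact: partial_cst.
- by apply: gen_in; exists c.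
Qed.

Lemma smoothZ c f : smooth f -> smooth (fun x => c * f x).
Proof. by move=> sf; apply: smoothM => //; exact: smooth_cst. Qed.

Lemma smooth_coord j : smooth (fun x => x ord0 j).
Proof.
apply: (@generated_smooth [set f | smooth f \/ f = (fun x => x ord0 j)]).
- by move=> g [/smooth_diff h|->] x; [exact: h|exact: differentiable_coord].
- move=> i g [sf|->]; apply: gen_in; left; first exact: smooth_partial.
  rewrite (_ : partial i _ = fun=> (i == j)%:R); first exact: smooth_cst.
  by apply/funext => x; exact: partial_coord.
- by apply: gen_in; right.
Qed.

Lemma smooth_sum (I : Type) (s : seq I) (F : I -> 'rV[R]_n -> R) :
  (forall k, smooth (F k)) -> smooth (fun x => \sum_(k <- s) F k x).
Proof.
move=> sF; elim: s => [|k s ih].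
  by under eq_fun do rewrite big_nil; exact: smooth_cst.
by under eq_fun do rewrite big_cons; exact: smoothD.
Qed.

Lemma partial_sum (I : Type) (s : seq I) (F : I -> 'rV[R]_n -> R) i x :
  (forall k, smooth (F k)) ->
  partial i (fun y => \sum_(k <- s) F k y) x = \sum_(k <- s) partial i (F k) x.
Proof.
move=> sF; elim: s => [|k s ih].
  by under eq_fun do rewrite big_nil; rewrite big_nil partial_cst.
under eq_fun do rewrite big_cons; rewrite big_cons partialD ?ih//.
  exact: smooth_diff.
by apply/smooth_diff/smooth_sum.
Qed.

Lemma differentiable_affine c h f x : differentiable f (c *: x + h) ->
  differentiable (fun y => f (c *: y + h)) x.
Proof.
by move=> df; apply: (@differentiable_comp _ _ _ _ (fun y : 'rV[R]_n => c *: y + h)).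
Qed.

Lemma partial_affine i c h f x : differentiable f (c *: x + h) ->
  partial i (fun y => f (c *: y + h)) x = c * partial i f (c *: x + h).
Proof.
move=> df; rewrite partialE; last exact: differentiable_affine.
have da : differentiable (fun y : 'rV[R]_n => c *: y + h) x by [].
rewrite (diff_comp da df)/= partialE// -[RHS]linearZ/=; congr ('d f _ _).
rewrite -(deriveE _ da).
have -> : 'D_(e_ i) (fun y : 'rV[R]_n => c *: y + h) x =
   'D_(e_ i) (c \*: (@idfun 'rV[R]_n)) x + 'D_(e_ i) (cst h) x.
  by rewrite -deriveD//; exact/derivableZ/derivable_id.
by rewrite derive_cst addr0 deriveZ//= ?derive_id//; exact: derivable_id.
Qed.

Lemma smooth_affine c h f : smooth f -> smooth (fun x => f (c *: x + h)).
Proof.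
(* The factor [k] collects the powers of c that the chain rule produces. *)
move=> sf; apply: (@generated_smooth
  [set g | exists k f, smooth f /\ g = (fun x => k * f (c *: x + h))]).
- move=> _ [k [g [sg ->]]] x; apply: differentiableM => //.
  by apply: differentiable_affine; exact: smooth_diff.
- move=> i _ [k [g [sg ->]]]; apply: gen_in; exists (k * c), (partial i g).
  split; first exact: smooth_partial.
  apply/funext => x; rewrite partialZ; last first.
    by apply: differentiable_affine; exact: smooth_diff.
  by rewrite partial_affine ?mulrA//; exact: smooth_diff.
- by apply: gen_in; exists 1, f; split => //; apply/funext => x; rewrite mul1r.
Qed.

End partial_calculus.

Section test_functions.
Context {R : realType} {n : nat}.
Implicit Types (f g phi : 'rV[R]_n -> R) (i : 'I_n) (x h : 'rV[R]_n).
Local Notation mu := (lebesgue_rV R n).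

Definition vanishes_outside (r : R) phi := forall x, r < `|x| -> phi x = 0.

Lemma test_functionP phi : test_function phi <->
  smooth phi /\ exists2 r, 0 < r & vanishes_outside r phi.
Proof.
split=> [[sp cp]|[sp [r r0 h]]]; split => //.
  have [M [Mr HM]] := compact_bounded cp.
  exists (`|M| + 1); first by rewrite ltr_wpDl.
  move=> x xM; apply/eqP; apply: contraTT xM => px.
  rewrite -leNgt; apply: (HM (`|M| + 1)); last exact: subset_closure.
  by rewrite (le_lt_trans (ler_norm M))// ltrDl.
apply: bounded_closed_compact; last exact: closed_closure.
exists r; split; first exact: num_real.
move=> s rs x clx.
have cB : closed [set x : 'rV[R]_n | `|x| <= s].
  rewrite (_ : [set x | _] = (@Num.Def.normr _ _) @^-1` [set t | t <= s])//.
  by apply: closed_comp; [move=> y _; exact: norm_continuous|exact: closed_le].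
apply: cB; apply: closureS clx => y /= py; rewrite leNgt.
by apply: contra py => sy; rewrite h//; exact: lt_trans rs sy.
Qed.

Lemma test_smooth phi : test_function phi -> smooth phi.
Proof. by case/test_functionP. Qed.

Lemma vanishes_partial r i phi : vanishes_outside r phi -> vanishes_outside r (partial i phi).
Proof.
move=> h x rx; rewrite /partial -(derive_cst (0 : R) x (delta_mx ord0 i)).
apply: near_eq_derive.
have oB : open [set y : 'rV[R]_n | r < `|y|].
  rewrite (_ : [set x | _] = (@Num.Def.normr _ _) @^-1` [set t | r < t])//.
  by apply: open_comp; [move=> y _; exact: norm_continuous|exact: open_gt].
by apply: filterS (open_nbhs_nbhs (conj oB rx)) => y /= ry; rewrite h.
Qed.

Lemma test_partial i phi : test_function phi -> test_function (partial i phi).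
Proof.
move=> /test_functionP[sp [r r0 h]]; apply/test_functionP; split.
  exact: smooth_partial.
by exists r => //; exact: vanishes_partial.
Qed.

Lemma testM f phi : smooth f -> test_function phi -> test_function (fun x => f x * phi x).
Proof.
move=> sf /test_functionP[sp [r r0 h]]; apply/test_functionP; split.
  exact: smoothM.
by exists r => // x rx; rewrite h// mulr0.
Qed.

Lemma testZ c phi : test_function phi -> test_function (fun x => c * phi x).
Proof. by apply: testM; exact: smooth_cst. Qed.

Lemma testD f g : test_function f -> test_function g -> test_function (fun x => f x + g x).
Proof.
move=> /test_functionP[sf [r r0 hr]] /test_functionP[sg [s s0 hs]].
apply/test_functionP; split; first exact: smoothD.
exists (Num.max r s); first by rewrite lt_max r0.
by move=> x; rewrite gt_max => /andP[rx sx]; rewrite hr// hs// addr0.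
Qed.

Lemma test_affine c h phi : c != 0 -> test_function phi ->
  test_function (fun x => phi (c *: x + h)).
Proof.
move=> c0 /test_functionP[sp [r r0 hr]]; apply/test_functionP; split.
  exact: smooth_affine.
exists ((r + `|h|) / `|c|); first by rewrite divr_gt0 ?normr_gt0// ltr_pwDl.
move=> x; rewrite ltr_pdivrMr ?normr_gt0// => hx; apply: hr.
rewrite -(ltrD2r `|h|) (lt_le_trans hx)// mulrC -normrZ.
by rewrite -{1}(addrK h (c *: x)) ler_normB.
Qed.

Lemma test_scale c phi : c != 0 -> test_function phi ->
  test_function (fun x => phi (c *: x)).
Proof. by move=> c0 /(test_affine 0 c0); under eq_fun do rewrite addr0. Qed.

Lemma test_reflect h phi : test_function phi -> test_function (fun x => phi (h - x)).
Proof.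
have : (-1 : R) != 0 by rewrite oppr_eq0 oner_eq0.
by move=> /(test_affine h) /[apply]; under eq_fun do rewrite scaleN1r addrC.
Qed.

Lemma test_continuous phi : test_function phi -> continuous phi.
Proof. by move=> /test_smooth; exact: smooth_continuous. Qed.

Lemma test_meas phi : test_function phi -> measurable_fun setT phi.
Proof. by move=> /test_continuous; exact: continuous_measurable_rV. Qed.

Lemma closed_ball_compact (r : R) : compact [set x : 'rV[R]_n | `|x| <= r].
Proof.
apply: bounded_closed_compact.
  exists r; split; first exact: num_real.
  by move=> s rs x /= xr; exact: le_trans xr (ltW rs).
rewrite (_ : [set x | _] = (@Num.Def.normr _ _) @^-1` [set t | t <= r])//.
by apply: closed_comp; [move=> y _; exact: norm_continuous|exact: closed_le].
Qed.

Lemma test_bounded phi : test_function phi -> exists2 M, 0 <= M & forall x, `|phi x| <= M.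
Proof.
move=> tp; have /test_functionP[sp [r r0 hr]] := tp.
have [M [_ HM]] := compact_bounded (continuous_compact
  (continuous_subspaceT (test_continuous tp)) (closed_ball_compact (r := r))).
exists (`|M| + 1); first by rewrite addr_ge0.
move=> x; case: (lerP `|x| r) => xr; last by rewrite hr// normr0 addr_ge0.
apply: (HM (`|M| + 1)); last by exists x.
by rewrite (le_lt_trans (ler_norm M))// ltrDl.
Qed.

Lemma vanishing_L1 f (r M : R) : 0 <= r -> measurable_fun setT f ->
  vanishes_outside r f -> (forall x, `|f x| <= M) -> L1 mu f.
Proof.
move=> r0 mf h fM; apply: (L1_dom mf _ (L1Z M (L1_cube_indic n r0))) => x.
rewrite indicE; have [xr|xr] := lerP `|x| r.
  by rewrite mem_set ?mulr1//; exact/cubeP.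
by rewrite h// normr0 mulr_ge0// (le_trans _ (fM 0)).
Qed.

Lemma test_L1 phi : test_function phi -> L1 mu phi.
Proof.
move=> tp; have /test_functionP[sp [r r0 hr]] := tp.
have [M M0 HM] := test_bounded tp.
exact: (vanishing_L1 (ltW r0) (test_meas tp) hr HM).
Qed.

Lemma test_sqr phi : test_function phi -> test_function (fun x => phi x ^+ 2).
Proof. by move=> tp; under eq_fun do rewrite expr2; apply: testM => //; exact: test_smooth. Qed.

Lemma test_L2 phi : test_function phi -> L2 mu phi.
Proof. by move=> tp; split; [exact: test_meas|exact/test_L1/test_sqr]. Qed.

End test_functions.

(** * The flat function exp(-1/t) and smooth radial functions *)

Section flat_functions.
Context {R : realType}.
Implicit Types (t : R) (m k : nat).

(** The powers of 1/t are included because the derivative of each member is then a combination of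
    two others, and smoothness is proved for the whole family at once. *)
Definition flat m t : R := if 0 < t then t ^- m * expR (- t^-1) else 0.

Lemma flat_ge0 m t : 0 <= flat m t.
Proof.
rewrite /flat; case: ifPn => // t0.
by rewrite mulr_ge0 ?expR_ge0// invr_ge0 exprn_ge0// ltW.
Qed.

Lemma flat_out m t : t <= 0 -> flat m t = 0.
Proof. by move=> t0; rewrite /flat ltNge t0. Qed.

Lemma flat_le m k t : 0 <= t -> flat m t <= (m + k).+1`!%:R * t ^+ k.+1.
Proof.
rewrite le_eqVlt => /predU1P[<-|t0].
  by rewrite /flat ltxx expr0n mulr0.
rewrite /flat t0 expRN mulrC.
have e0 := expR_gt0 t^-1.
rewrite ler_pdivrMl// -[leLHS]div1r ler_pdivrMr ?exprn_gt0//.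
have := expR_ge1Dxn (m + k) (ltW (_ : 0 < t^-1)); rewrite invr_gt0 => /(_ t0) h.
have f0 : 0 < (m + k).+1`!%:R :> R by rewrite ltr0n fact_gt0.
have {}h : (t^-1) ^+ (m + k).+1 <= expR t^-1 * (m + k).+1`!%:R.
  by rewrite -ler_pdivrMr//; apply: le_trans h; rewrite lerDr.
rewrite -!mulrA -exprD mulrA.
apply: le_trans (ler_wpM2r (exprn_ge0 _ (ltW t0)) h).
rewrite (_ : k.+1 + m = (m + k).+1)%N; last by rewrite addSn addnC.
by rewrite -exprMn mulVf ?gt_eqF// expr1n.
Qed.

Lemma flat_le_cst m t : flat m t <= m`!%:R.
Proof.
case: (lerP t 0) => t0; first by rewrite flat_out.
case: m => [|m].
  by rewrite /flat t0 expr0 invr1 mul1r -expR0 ler_expR oppr_le0 invr_ge0 ltW.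
rewrite /flat t0 expRN mulrC ler_pdivrMl ?expR_gt0//.
have := expR_ge1Dxn m (ltW (_ : 0 < t^-1)); rewrite invr_gt0 => /(_ t0) h.
have f0 : 0 < m.+1`!%:R :> R by rewrite ltr0n fact_gt0.
rewrite -exprVn -ler_pdivrMr//; apply: le_trans h; by rewrite lerDr.
Qed.

Lemma is_derive_inv t : t != 0 -> is_derive t 1 (fun s => s^-1) (- t ^- 2).
Proof.
move=> t0; apply: DeriveDef; first by apply: derivableV.
by rewrite deriveV// derive_id scaler1.
Qed.

Lemma is_derive_flat m t :
  is_derive t 1 (flat m) (- m%:R * flat m.+1 t + flat m.+2 t).
Proof.
have [t0|t0|->] := ltrgt0P t.
- have tn0 : t != 0 by rewrite gt_eqF.
  have := is_derive_inv tn0 => h1.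
  have h2 : is_derive t 1 (fun s => expR (- s^-1)) (t ^- 2 * expR (- t^-1)).
    have h3 : is_derive t 1 (fun s => - s^-1) (t ^- 2).
      by rewrite -[X in is_derive _ _ _ X]opprK; exact: (is_deriveN h1).
    by rewrite mulrC; exact: (is_derive1_comp (is_derive_expR _) h3).
  have h4 : is_derive t 1 (fun s => (s^-1) ^+ m) (- m%:R * t ^- m.+1).
    rewrite (_ : (fun s => _) = (fun s : R => s^-1) ^+ m); last first.
      by apply/funext => s; rewrite exprfctE.
    apply: (is_derive_eq (is_deriveX m h1)).
    rewrite /GRing.scale/= -!exprVn; case: (m) => [|k] /=; first by rewrite !(mul0r, oppr0).
    by rewrite !exprSr; ring.
  apply: (@near_eq_is_derive _ _ _ (fun s : R => (s^-1) ^+ m * expR (- s^-1))).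
    near=> s; rewrite /flat.
    have -> : 0 < s by near: s; exact: lt_nbhsr.
    by rewrite exprVn.
  apply: (is_derive_eq (is_deriveM h4 h2)).
  rewrite /GRing.scale/= /flat t0 -!exprVn !exprSr; ring.
- apply: (@near_eq_is_derive _ _ _ (cst (0 : R))).
    near=> s; rewrite flat_out//; apply: ltW; near: s; exact: lt_nbhsl.
  by apply: is_derive_eq; rewrite !flat_out ?ltW// mulr0 addr0.
- rewrite !flat_out// mulr0 addr0.
  have H : (fun h : R => h^-1 *: (flat m (h *: 1 + 0) - flat m 0)) @ 0^' --> (0 : R).
    apply/cvgrPdist_le => e e0; near=> h.
    rewrite sub0r normrN (flat_out m (lexx 0)) subr0 addr0 /GRing.scale/= mulr1.
    have [h0|h0] := lerP h 0; first by rewrite flat_out// mulr0 normr0 ltW.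
    rewrite ger0_norm; last by rewrite mulr_ge0 ?flat_ge0// invr_ge0 ltW.
    rewrite ler_pdivrMl//.
    apply: le_trans (flat_le m 1 (ltW h0)) _.
    rewrite expr2 [leRHS]mulrC mulrA ler_pM2r//.
    have f0 : 0 < (m + 1).+1`!%:R :> R by rewrite ltr0n fact_gt0.
    rewrite -ler_pdivlMl//; apply: le_trans (ler_norm h) _.
    by near: h; apply: dnbhs0_le; rewrite mulr_gt0// invr_gt0.
  by apply: DeriveDef; [apply/cvg_ex; exists 0|apply/cvg_lim].
Unshelve. all: by end_near. Qed.

End flat_functions.

Section smooth_compositions.
Context {R : realType} {n : nat}.
Implicit Types (phi : 'rV[R]_n -> R) (x : 'rV[R]_n).

(** Serves both the flat functions and the real powers. Derivatives are only required at values of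
    [phi], so powers are differentiated at positive arguments only. *)
Lemma smooth_comp_family (K : Type) (g : K -> R -> R) phi :
  smooth phi ->
  (forall k, exists c1 k1 c2 k2, forall x,
     is_derive (phi x) 1 (g k) (c1 * g k1 (phi x) + c2 * g k2 (phi x))) ->
  forall k, smooth (fun x => g k (phi x)).
Proof.
move=> sp D k; apply: (@generated_smooth _ _
   [set f | smooth f \/ exists k, f = (fun x => g k (phi x))]).
- move=> ? [/smooth_diff h|[j ->]] x; first exact: h.
  have [c1 [k1 [c2 [k2 h]]]] := D j.
  by apply: differentiable_comp1 (h x); exact: smooth_diff.
- move=> i ? [sf|[j ->]]; first by apply: gen_in; left; exact: smooth_partial.
  have [c1 [k1 [c2 [k2 h]]]] := D j.
  rewrite (_ : partial i _ = fun x =>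
     (c1 * g k1 (phi x) + c2 * g k2 (phi x)) * partial i phi x).
    apply: gen_mul; last by apply: gen_in; left; exact: smooth_partial.
    by apply: gen_add; apply: gen_mul; apply: gen_in;
      [left; exact: smooth_cst|right; exists k1|left; exact: smooth_cst|right; exists k2].
  by apply/funext => x; apply: partial_comp1 (h x); exact: smooth_diff.
- by apply: gen_in; right; exists k.
Qed.

(** The squared Euclidean norm: the maximum norm that row vectors carry is not smooth. *)
Definition normsq x : R := \sum_i x ord0 i ^+ 2.

Lemma normsq_ge0 x : 0 <= normsq x.
Proof. by apply: sumr_ge0 => i _; exact: sqr_ge0. Qed.

Lemma smooth_normsq : smooth normsq.
Proof.
apply: smooth_sum => i; under eq_fun do rewrite expr2.
by apply: smoothM; exact: smooth_coord.
Qed.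

Lemma coord_le_normsq x i : x ord0 i ^+ 2 <= normsq x.
Proof.
by rewrite /normsq (bigD1 i)//= lerDl sumr_ge0// => j _; exact: sqr_ge0.
Qed.

Lemma norm_le_normsq x : `|x| ^+ 2 <= normsq x.
Proof.
have H : `|x| <= Num.sqrt (normsq x).
  apply/cubeP; first exact: sqrtr_ge0.
  move=> i; rewrite /= in_itv/= -ler_norml -sqrtr_sqr ler_wsqrtr//.
  exact: coord_le_normsq.
by rewrite -(sqr_sqrtr (normsq_ge0 x)) lerXn2r ?nnegrE ?sqrtr_ge0.
Qed.

Lemma normsq_le_norm x : normsq x <= n%:R * `|x| ^+ 2.
Proof.
have h i : x ord0 i ^+ 2 <= `|x| ^+ 2.
  rewrite -[_ ^+ 2]real_normK ?num_real// lerXn2r ?nnegrE//.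
  have /cubeP/(_ i) := lexx `|x|; rewrite normr_ge0 => /(_ isT).
  by rewrite /= in_itv/= -ler_norml.
apply: (le_trans (ler_sum _ (fun i _ => h i))).
by rewrite sumr_const card_ord mulr_natl.
Qed.

Lemma partial_normsq i x : partial i normsq x = 2 * x ord0 i.
Proof.
have sc j : smooth (fun y : 'rV[R]_n => y ord0 j) by exact: smooth_coord.
have E j : partial i (fun y : 'rV[R]_n => y ord0 j ^+ 2) x = 2 * x ord0 j * (i == j)%:R.
  under eq_fun do rewrite expr2.
  by rewrite partialM ?partial_coord; [ring|exact: smooth_diff|exact: smooth_diff].
rewrite /normsq partial_sum; last first.
  by move=> j; under eq_fun do rewrite expr2; exact: smoothM.
under eq_bigr do rewrite E.
rewrite (bigD1 i)//= eqxx mulr1 big1 ?addr0// => j ji.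
by rewrite eq_sym (negbTE ji) mulr0.
Qed.

Lemma smooth_flat m a b : smooth (fun x => flat m (a + b * normsq x)).
Proof.
apply: (@smooth_comp_family nat (@flat R) (fun x => a + b * normsq x)).
  by apply: smoothD; [exact: smooth_cst|apply: smoothZ; exact: smooth_normsq].
move=> k; exists (- k%:R), k.+1, 1, k.+2 => x.
by rewrite mul1r; exact: is_derive_flat.
Qed.

Lemma smooth_powR c : smooth (fun x => (1 + normsq x) `^ c).
Proof.
apply: (@smooth_comp_family R (fun c t => t `^ c) (fun x => 1 + normsq x)).
  by apply: smoothD; [exact: smooth_cst|exact: smooth_normsq].
move=> k; exists k, (k - 1), 0, 0 => x; rewrite mul0r addr0.
by apply: is_derive1_powR; rewrite ltr_wpDr ?normsq_ge0.
Qed.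

End smooth_compositions.

(** * A Liouville theorem for superharmonic functions in L^2 *)

Section japanese_bracket.
Context {R : realType} {n : nat}.
Hypothesis n4 : (n <= 4)%N.
Local Notation mu := (lebesgue_rV R n).
Implicit Types (x : 'rV[R]_n) (d : R).

Let br_pos x : 0 < 1 + normsq x. Proof. by rewrite ltr_wpDr ?normsq_ge0. Qed.

(** Decomposition into shells where |x| is comparable to e^k. On the k-th one the weight is at most
    a constant times e^(-4(1+d)k), while the cube of radius e^k has volume of order e^(nk). *)
Let shell_bound d x : 0 < d -> d <= 1 ->
  let k := (Num.truncn (ln (1 + `|x|))).+1 in
  `|x| <= expR k%:R /\
  (1 + normsq x) `^ (- (2 + 2 * d)) <= expR 12 * expR (- (4 * (1 + d))) ^+ k.
Proof.
move=> d0 d1 k; have x1 : 0 < 1 + `|x| by rewrite ltr_wpDr.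
have l0 : 0 <= ln (1 + `|x|) by rewrite ln_ge0// lerDl.
have k1 : ln (1 + `|x|) < k%:R by apply: truncnS_gt.
have k2 : k%:R - 1 <= ln (1 + `|x|).
  by rewrite /k -natr1 addrK; have /andP[] := truncn_itv l0.
split.
  rewrite (@le_trans _ _ (1 + `|x|))// ?lerDr//.
  by rewrite -{1}(lnK (_ : 1 + `|x| \in Num.pos)) ?posrE// ler_expR ltW.
rewrite /powR gt_eqF// -expRM_natr -expRD ler_expR.
(* The loss is 3: twice the rounding error 1, and 1 for ln 2. Multiplied by 2 + 2 d <= 4 it becomes
   the 12 of the statement. *)
have h : 2 * (k%:R - 1) - 1 <= ln (1 + normsq x).
  have h1 : (1 + `|x|) ^+ 2 <= 2 * (1 + normsq x).
    have := norm_le_normsq x; have := sqr_ge0 (1 - `|x|); nra.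
  have := h1; rewrite -ler_ln ?posrE ?exprn_gt0 ?mulr_gt0//.
  rewrite lnXn// lnM ?posrE// mulr2n => h2.
  have : ln (2 : R) <= 1 by have := @le_ln1Dx R 1; rewrite (_ : 1 + 1 = 2 :> R)//; apply; lra.
  lra.
have := mulr_ge0 (ltW d0) (ler0n R k); have := ler0n R k; nra.
Qed.

(** This is where n <= 4 is decisive: the k-th shell then contributes at most 16 e^12 e^(-4dk), a
    convergent geometric series. The growth like 1/d of its sum is what [weighted_bound] has to
    beat. *)
Lemma bracket_tail d : 0 < d -> d <= 4^-1 ->
  L1 mu (fun x => (1 + normsq x) `^ (- (2 + 2 * d))) /\
  \int[mu]_x ((1 + normsq x) `^ (- (2 + 2 * d))) <= (16 * expR 12) / d.
Proof.
move=> d0 d14; have d1 : d <= 1 by lra.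
set f := fun x => _.
have mf : measurable_fun setT f.
  apply: continuous_measurable_rV; apply: smooth_continuous; exact: smooth_powR.
have f0 x : 0 <= f x by exact: powR_ge0.
pose c k : R := expR 12 * expR (- (4 * (1 + d))) ^+ k.
have c0 k : 0 <= c k by rewrite mulr_ge0 ?exprn_ge0 ?expR_ge0.
pose g k x : R := c k * \1_(@cube R n (expR k%:R)) x.
have g0 k x : 0 <= g k x by rewrite mulr_ge0// indicE.
have mg k : measurable_fun setT (g k).
  by apply: measurable_funM => //; apply: measurable_indic; exact: measurable_cube.
have fg x : ((f x)%:E <= \sum_(0 <= k <oo) (g k x)%:E)%E.
  have [h1 h2] := shell_bound x d0 d1; move: h1 h2.
  set k := (Num.truncn _).+1 => h1 h2.
  apply: (@le_trans _ _ (g k x)%:E).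
    have cx : cube (expR k%:R) x by apply/cubeP => //; exact: expR_ge0.
    by rewrite lee_fin /g indicE mem_set ?mulr1.
  apply: le_trans (nneseries_lim_ge k.+1 _); last by move=> *; rewrite lee_fin.
  rewrite big_nat_recr//= leeDr// sume_ge0// => *; by rewrite lee_fin.
pose r : R := expR (- (4 * d)).
have r0 : 0 <= r by exact: expR_ge0.
(* From exp(-4d) <= 1/(1 + 4d) <= 1 - 2d, the last inequality being equivalent to d <= 1/4 for
   positive d. *)
have r1 : 2 * d <= 1 - r.
  have h : r <= (1 + 4 * d)^-1.
    by rewrite /r expRN lef_pV2 ?posrE ?expR_gt0 ?expR_ge1Dx//; lra.
  have : (1 + 4 * d)^-1 <= 1 - 2 * d.
    by rewrite -div1r ler_pdivrMr; nra.
  lra.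
have ig k : (\int[mu]_x (g k x)%:E <= (16 * expR 12 * r ^+ k)%:E)%E.
  have e0 : 0 <= expR k%:R :> R by exact: expR_ge0.
  rewrite /g; rewrite -RintE; last by apply: L1Z; exact: L1_cube_indic.
  rewrite RintZ; last exact: L1_cube_indic.
  rewrite Rint_cube_indic// lee_fin /c.
  have e1 : 1 <= 2 * expR k%:R :> R.
    have : expR 0 <= expR k%:R :> R by rewrite ler_expR.
    by rewrite expR0; lra.
  apply: (@le_trans _ _ (expR 12 * expR (- (4 * (1 + d))) ^+ k * (2 * expR k%:R) ^+ 4)).
    by rewrite ler_wpM2l ?c0// ler_weXn2l.
  rewrite le_eqVlt; apply/orP; left; apply/eqP.
  rewrite exprMn mulrACA [X in _ * X](_ : _ = r ^+ k); first by ring.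
  rewrite -!expRM_natr -expRD; congr expR; rewrite -/(_ ^+ 4); ring.
have S : (\int[mu]_x (f x)%:E <= ((16 * expR 12) / d)%:E)%E.
  apply: (@le_trans _ _ (\int[mu]_x (\sum_(0 <= k <oo) (g k x)%:E))%E).
    apply: ge0_le_integral => //.
    - by move=> x _; rewrite lee_fin.
    - exact/measurable_EFinP.
    - apply: ge0_emeasurable_sum => [k x _ _|k _]; first by rewrite lee_fin.
      exact/measurable_EFinP.
  rewrite integral_nneseries//; last 2 first.
    by move=> k; exact/measurable_EFinP.
    by move=> k x _; rewrite lee_fin.
  apply: lime_le.
    by apply: is_cvg_nneseries => k _ _; apply: integral_ge0 => x _; rewrite lee_fin.
  apply: nearW => m; apply: (@le_trans _ _ (\sum_(0 <= k < m) (16 * expR 12 * r ^+ k)%:E)%E).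
    exact: lee_sum.
  rewrite sumEFin lee_fin -mulr_sumr ler_wpM2l ?mulr_ge0 ?expR_ge0//.
  have -> : \sum_(0 <= k < m) r ^+ k = (1 - r ^+ m) / (1 - r).
    have := @geometric_seriesE R 1 r; rewrite lt_eqF; last lra.
    by move=> /(_ isT)/funeqP/(_ m); rewrite /series /geometric/= mul1r => <-; under [in RHS]eq_bigr do rewrite mul1r.
  have rm : 0 <= r ^+ m by exact: exprn_ge0.
  rewrite ler_pdivrMr; last lra.
  rewrite -ler_pdivrMl ?invr_gt0// invrK; nra.
have lf : L1 mu f by apply: L1_ge0P => //; exact: le_lt_trans S (ltry _).
by split => //; rewrite -lee_fin RintE.
Qed.

End japanese_bracket.

Section real_derivatives.
Context {R : realType}.
Implicit Types (f g : R -> R) (t : R).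

Lemma real_derD f g df dg t : is_derive t 1 f df -> is_derive t 1 g dg ->
  is_derive t 1 (fun s => f s + g s) (df + dg).
Proof. exact: is_deriveD. Qed.

Lemma real_derM f g df dg t : is_derive t 1 f df -> is_derive t 1 g dg ->
  is_derive t 1 (fun s => f s * g s) (f t * dg + g t * df).
Proof. exact: is_deriveM. Qed.

Lemma real_der_cst (c t : R) : is_derive t 1 (fun=> c) 0.
Proof. exact: is_derive_cst. Qed.

Lemma real_der_id t : is_derive t 1 (fun s => s) 1.
Proof. exact: is_derive_id. Qed.

Lemma real_derZ c f df t : is_derive t 1 f df -> is_derive t 1 (fun s => c * f s) (c * df).
Proof.
move=> h; apply: (is_derive_eq (real_derM (real_der_cst c t) h)).
by rewrite mulr0 addr0.
Qed.

Lemma real_der_comp f g df dg t : is_derive (g t) 1 f df -> is_derive t 1 g dg ->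
  is_derive t 1 (fun s => f (g s)) (df * dg).
Proof. exact: is_derive1_comp. Qed.

End real_derivatives.

Section laplacian.
Context {R : realType} {n : nat}.
Implicit Types (phi : 'rV[R]_n -> R) (x : 'rV[R]_n).

Definition laplacian phi x := \sum_i partial i (partial i phi) x.

Lemma laplacian_radial (g g1 g2 : R -> R) x :
  (forall t : R, 0 <= t -> is_derive t 1 g (g1 t)) ->
  (forall t : R, 0 <= t -> is_derive t 1 g1 (g2 t)) ->
  laplacian (fun x => g (normsq x)) x =
  4 * normsq x * g2 (normsq x) + 2 * n%:R * g1 (normsq x).
Proof.
move=> d1 d2.
have dn (y : 'rV[R]_n) : differentiable normsq y by apply: smooth_diff; exact: smooth_normsq.
have E i : partial i (fun x => g (normsq x)) = fun x => g1 (normsq x) * (2 * x ord0 i).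
  apply/funext => y; rewrite (partial_comp1 i (dn y) (d1 _ (normsq_ge0 _))).
  by rewrite partial_normsq.
have F i : partial i (partial i (fun x => g (normsq x))) x =
    2 * g1 (normsq x) + 4 * g2 (normsq x) * x ord0 i ^+ 2.
  have dg := d2 _ (normsq_ge0 x).
  rewrite E partialM; last 2 first.
    exact: differentiable_comp1 (dn x) dg.
    by apply: smooth_diff; apply: smoothZ; exact: smooth_coord.
  rewrite (partial_comp1 i (dn x) dg) partial_normsq partialZ; last exact: differentiable_coord.
  by rewrite partial_coord eqxx /=; ring.
rewrite /laplacian; under eq_bigr do rewrite F.
rewrite big_split/= sumr_const card_ord -mulr_natl -mulr_sumr -/(normsq x); ring.
Qed.

End laplacian.

(** Because exp(-1/2) >= 1 - 1/2. *)
Lemma expR1_le4 (R : realType) : expR 1 <= 4 :> R.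
Proof.
have h := expR_ge1Dx (- 2^-1 : R).
have E : expR (- 2^-1) ^+ 2 * expR 1 = 1 :> R.
  by rewrite -expRM_natr -expRD (_ : _ + _ = 0) ?expR0//; lra.
have h2 : 4^-1 <= expR (- 2^-1) ^+ 2 :> R by nra.
have := expR_gt0 (1 : R); nra.
Qed.

Section liouville.
Context {R : realType} {n : nat}.
Hypothesis n34 : n = 3%N \/ n = 4%N.
Local Notation mu := (lebesgue_rV R n).
Implicit Types (x : 'rV[R]_n) (t : R).

Let kappa : R := (n%:R - 2) / 2.

Let kappa_half : 2^-1 <= kappa.
Proof. by rewrite /kappa; case: n34 => ->; lra. Qed.

Let kappa_le1 : kappa <= 1.
Proof. by rewrite /kappa; case: n34 => ->; lra. Qed.

Let nE : n%:R = 2 * kappa + 2 :> R. Proof. by rewrite /kappa; field. Qed.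

(** A cut-off in t = |x|^2 that vanishes for a t >= 1; the factor e makes it tend to 1 as a tends to
    0. [X1] and [X2] are its derivatives in t, of orders a and a^2. *)
Let X0 a t : R := expR 1 * flat 0 (1 - a * t).
Let X1 a t : R := - a * (expR 1 * flat 2 (1 - a * t)).
Let X2 a t : R := a ^+ 2 * (expR 1 * (- 2 * flat 3 (1 - a * t) + flat 4 (1 - a * t))).

Let der_flat m a t : is_derive t 1 (fun s => flat m (1 - a * s))
  (- a * (- m%:R * flat m.+1 (1 - a * t) + flat m.+2 (1 - a * t))).
Proof.
apply: (is_derive_eq (@real_der_comp _ (flat m) (fun s => 1 - a * s) _ (- a) t
  (is_derive_flat _ _) _)); last by rewrite mulrC.
have -> : (fun s => 1 - a * s) = (fun s => 1 + - a * s) by apply/funext => s; ring.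
apply: (is_derive_eq (real_derD (real_der_cst 1 t) (real_derZ (- a) (real_der_id t)))).
by rewrite add0r mulr1.
Qed.

Let der_X0 a t : is_derive t 1 (X0 a) (X1 a t).
Proof.
by apply: (is_derive_eq (real_derZ _ (der_flat 0 a t))); rewrite /X1; ring.
Qed.

Let der_X1 a t : is_derive t 1 (X1 a) (X2 a t).
Proof.
by apply: (is_derive_eq (real_derZ _ (real_derZ _ (der_flat 2 a t)))); rewrite /X2; ring.
Qed.

Section weight.
Variable d : R.
Hypotheses (d0 : 0 < d) (d4 : d <= 4^-1).

(* The test functions are cut-offs of P0 (|x|^2). In the second term,
   (1 + |x|^2)^-kappa is a regularised fundamental solution of the Laplacian; the
   slowly decaying first term makes P0 nonnegative and its Laplacian is O(d). *)
Let P0 t : R := (1 + t) `^ (- d) - (1 + t) `^ (- kappa).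
Let P1 t : R := - d * (1 + t) `^ (- d - 1) + kappa * (1 + t) `^ (- kappa - 1).
Let P2 t : R := d * (d + 1) * (1 + t) `^ (- d - 2)
  - kappa * (kappa + 1) * (1 + t) `^ (- kappa - 2).

Let der_pow c t : 0 <= t -> is_derive t 1 (fun s => (1 + s) `^ c) (c * (1 + t) `^ (c - 1)).
Proof.
move=> t0; apply: (is_derive_eq (@real_der_comp _ (fun s => s `^ c) (fun s => 1 + s) _ 1 t
  (is_derive1_powR _ _) _)); last by rewrite mulr1.
  by rewrite ltr_wpDr.
by apply: (is_derive_eq (real_derD (real_der_cst 1 t) (real_der_id t))); rewrite add0r.
Qed.

Let der_P0 t : 0 <= t -> is_derive t 1 P0 (P1 t).
Proof.
move=> t0; rewrite /P0 (_ : (fun s => _) = fun s => (1 + s) `^ (- d) + -1 * (1 + s) `^ (- kappa)).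
  apply: (is_derive_eq (real_derD (der_pow _ t0) (real_derZ _ (der_pow _ t0)))).
  by rewrite /P1; ring.
by apply/funext => s; ring.
Qed.

Let der_P1 t : 0 <= t -> is_derive t 1 P1 (P2 t).
Proof.
move=> t0.
apply: (is_derive_eq (real_derD (real_derZ _ (der_pow _ t0)) (real_derZ _ (der_pow _ t0)))).
rewrite /P2 (_ : - d - 1 - 1 = - d - 2); last by ring.
by rewrite (_ : - kappa - 1 - 1 = - kappa - 2); ring.
Qed.

Let G0 a t := X0 a t * P0 t.
Let G1 a t := X0 a t * P1 t + P0 t * X1 a t.
Let G2 a t := (X0 a t * P2 t + P1 t * X1 a t) + (P0 t * X2 a t + X1 a t * P1 t).

Let der_G0 a t : 0 <= t -> is_derive t 1 (G0 a) (G1 a t).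
Proof. by move=> t0; exact: (real_derM (der_X0 a t) (der_P0 t0)). Qed.

Let der_G1 a t : 0 <= t -> is_derive t 1 (G1 a) (G2 a t).
Proof.
move=> t0; exact: (real_derD (real_derM (der_X0 a t) (der_P1 t0))
  (real_derM (der_P0 t0) (der_X1 a t))).
Qed.

(** By [laplacian_radial], the Laplacian of [P0] at |x|^2 = t; [Lcut a] is that of the cut-off
    function [G0 a]. *)
Let L t : R := 4 * t * P2 t + 2 * n%:R * P1 t.
Let Lcut a t : R := 4 * t * G2 a t + 2 * n%:R * G1 a t.

Let pow_split c t : 0 <= t -> (1 + t) `^ (c - 1) = (1 + t) * (1 + t) `^ (c - 2).
Proof.
move=> t0; have y0 : 0 < 1 + t by rewrite ltr_wpDr.
rewrite -{2}(powRr1 (ltW y0)) -powRD; last by rewrite (gt_eqF y0) implybT.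
by congr (_ `^ _); ring.
Qed.

Let pow_split2 c t : 0 <= t -> (1 + t) `^ c = (1 + t) ^+ 2 * (1 + t) `^ (c - 2).
Proof.
move=> t0; have y0 : 0 < 1 + t by rewrite ltr_wpDr.
rewrite -(powR_mulrn 2 (ltW y0)) -powRD; last by rewrite (gt_eqF y0) implybT.
by congr (_ `^ _); ring.
Qed.

Let pow_cmp t : 0 <= t -> (1 + t) `^ (- kappa - 2) <= (1 + t) `^ (- d - 2).
Proof.
move=> t0; apply: ler_powR; first by rewrite lerDl.
have h : d <= kappa by apply: (le_trans d4); apply: le_trans kappa_half; lra.
by rewrite lerD2r lerN2.
Qed.

(** Since n = 2 kappa + 2, the terms with a factor t cancel in the Laplacian of -(1+t)^-kappa and
    leave a positive multiple of (1+t)^(-kappa-2). The power -d only costs a term of order d. *)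
Let L_ge t : 0 <= t ->
  4 * kappa * (kappa + 1) * (1 + t) `^ (- kappa - 2) -
  4 * d * (kappa + 1) * (1 + t) `^ (- d - 1) <= L t.
Proof.
move=> t0; rewrite /L /P2 /P1 nE !pow_split//.
have d0' := d0; have d4' := d4; have k1 := kappa_half; have k2 := kappa_le1.
have B0 := powR_ge0 (1 + t) (- kappa - 2); have A0 := powR_ge0 (1 + t) (- d - 2).
move: ((1 + t) `^ (- kappa - 2)) ((1 + t) `^ (- d - 2)) A0 B0 => B A A0 B0.
rewrite -subr_ge0 (_ : _ - _ = 4 * d * (d + 1) * t * A); last by ring.
by rewrite !mulr_ge0//; lra.
Qed.

Let L_le t : 0 <= t -> `|L t| <= 40 * (1 + t) `^ (- d - 1).
Proof.
move=> t0; rewrite /L /P2 /P1 nE !pow_split//.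
have d0' := d0; have d4' := d4; have k1 := kappa_half; have k2 := kappa_le1.
have B0 := powR_ge0 (1 + t) (- kappa - 2); have A0 := powR_ge0 (1 + t) (- d - 2).
have BA := pow_cmp t0.
move: ((1 + t) `^ (- kappa - 2)) ((1 + t) `^ (- d - 2)) A0 B0 BA => B A A0 B0 BA; move: (kappa) k1 k2 => K k1 k2.
rewrite (_ : _ + _ = 4 * K * (K + 1) * B - 4 * d * ((K + 1) + (K - d) * t) * A); last by ring.
have p1 : 0 <= (K - d) * t by rewrite mulr_ge0//; lra.
have p2 : 0 <= d * t by rewrite mulr_ge0//; lra.
apply: (le_trans (ler_normB _ _)).
rewrite !ger0_norm; last 2 first.
- by rewrite !mulr_ge0//; lra.
- by rewrite !mulr_ge0//; lra.
have h1 : 4 * K * (K + 1) <= 8 by nra.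
have h2 : 4 * d * (K + 1 + (K - d) * t) <= 2 * (1 + t) by nra.
have h3 := ler_wpM2r B0 h1; have h4 := ler_wpM2r A0 h2.
have : 0 <= t * A by exact: mulr_ge0.
lra.
Qed.

Let Lcut_diff a t : 0 <= a -> a <= 1 -> 0 <= t ->
  Lcut a t = X0 a t * L t + 4 * t * (2 * X1 a t * P1 t + X2 a t * P0 t) + 2 * n%:R * X1 a t * P0 t.
Proof. by move=> *; rewrite /Lcut /G2 /G1 /L; ring. Qed.

Let eflat_le m (M : R) a t : m`!%:R <= M -> 0 <= expR 1 * flat m (1 - a * t) <= 4 * M.
Proof.
move=> mM; rewrite mulr_ge0 ?flat_ge0 ?expR_ge0//=.
apply: ler_pM; rewrite ?flat_ge0 ?expR_ge0 ?expR1_le4//.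
exact: le_trans (flat_le_cst _ _) mM.
Qed.

Let X0_le a t : `|X0 a t| <= 4.
Proof.
have /andP[h1 h2] := @eflat_le 0 1 a t (lexx _).
by rewrite /X0 ger0_norm//; lra.
Qed.

Let X1_le a t : 0 <= a -> `|X1 a t| <= 8 * a.
Proof.
move=> a0; have /andP[h1 h2] := @eflat_le 2 2 a t (lexx _).
by rewrite /X1 normrM normrN !ger0_norm// mulrC ler_wpM2r//; lra.
Qed.

Let X2_le a t : 0 <= a -> `|X2 a t| <= 144 * a ^+ 2.
Proof.
move=> a0; have /andP[h1 h2] := @eflat_le 3 6 a t (lexx _).
have /andP[h3 h4] := @eflat_le 4 24 a t (lexx _).
rewrite /X2 normrM ger0_norm ?sqr_ge0// mulrC ler_wpM2r ?sqr_ge0//.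
by rewrite mulrDr ler_norml; apply/andP; split; lra.
Qed.

Let P0_ge0 t : 0 <= t -> 0 <= P0 t.
Proof.
move=> t0; rewrite /P0 subr_ge0; apply: ler_powR; first by rewrite lerDl.
by rewrite lerN2; apply: (le_trans d4); apply: le_trans kappa_half; lra.
Qed.

Let P0_le t : 0 <= t -> `|P0 t| <= (1 + t) * (1 + t) `^ (- d - 1).
Proof.
move=> t0; rewrite ger0_norm ?P0_ge0// pow_split// mulrA -expr2 -pow_split2//.
by rewrite /P0 lerBlDr lerDl powR_ge0.
Qed.

Let P1_le t : 0 <= t -> `|P1 t| <= 2 * (1 + t) `^ (- d - 1).
Proof.
move=> t0; rewrite /P1 !pow_split//; have y0 : 0 <= 1 + t by rewrite addr_ge0.
have d0' := d0; have d4' := d4; have k1 := kappa_half; have k2 := kappa_le1.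
have B0 := powR_ge0 (1 + t) (- kappa - 2); have A0 := powR_ge0 (1 + t) (- d - 2).
have BA := pow_cmp t0.
move: ((1 + t) `^ (- kappa - 2)) ((1 + t) `^ (- d - 2)) A0 B0 BA => B A A0 B0 BA; move: (kappa) k1 k2 => K k1 k2.
have h1 := ler_wpM2l y0 BA; have h2 := mulr_ge0 y0 A0; have h3 := mulr_ge0 y0 B0.
by rewrite ler_norml; apply/andP; split; nra.
Qed.

(** On the support of the cut-off a (1 + t) <= 2, so every factor a from its derivatives absorbs a
    factor 1 + t. The bound is uniform in a, as dominated convergence requires; 1600 exceeds 160 +
    128 + 1152 + 128. *)
Let Lcut_le a t : 0 <= a -> a <= 1 -> 0 <= t -> `|Lcut a t| <= 1600 * (1 + t) `^ (- d - 1).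
Proof.
move=> a0 a1 t0; rewrite Lcut_diff//; have y0 : 0 <= 1 + t by rewrite addr_ge0.
have h1 : `|X0 a t * L t| <= 4 * (40 * (1 + t) `^ (- d - 1)).
  by rewrite normrM ler_pM ?X0_le ?L_le.
have Q0 := powR_ge0 (1 + t) (- d - 1); have hP0 := P0_le t0; have hP1 := P1_le t0.
have h8 : 2 * n%:R <= 8 :> R by rewrite nE; have := kappa_le1; lra.
have n0 : 0 <= 2 * n%:R :> R by rewrite mulr_ge0.
set Q := _ `^ _ in h1 Q0 hP0 hP1 *.
have [ta|ta] := lerP (a * t) 1; last first.
  have X10 : X1 a t = 0 by rewrite /X1 flat_out ?mulr0// subr_le0 ltW.
  have X20 : X2 a t = 0 by rewrite /X2 !flat_out ?(mulr0, addr0)// subr_le0 ltW.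
  rewrite X10 X20 !(mulr0, mul0r, addr0).
  by apply: le_trans h1 _; lra.
have hX1 := X1_le t a0; have hX2 := X2_le t a0.
have ay : a * (1 + t) <= 2 by lra.
have at0 : 0 <= a * t by exact: mulr_ge0.
have ay0 : 0 <= a * (1 + t) by exact: mulr_ge0.
move: (X0 a t * L t) (X1 a t) (X2 a t) (P0 t) (P1 t) h1 hX1 hX2 hP0 hP1 => z x1 x2 p0 p1 h1 hX1 hX2 hP0 hP1.
have h2 : `|4 * t * (2 * x1 * p1)| <= 128 * Q.
  rewrite !normrM !(ger0_norm t0) ger0_norm// (ger0_norm (ler0n _ 2)).
  apply: (@le_trans _ _ (4 * t * (2 * (8 * a) * (2 * Q)))).
    by rewrite ler_wpM2l ?mulr_ge0// ler_pM// ?mulr_ge0// ler_wpM2l.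
  by rewrite [leLHS](_ : _ = 128 * (a * t * Q)); [rewrite ler_wpM2l// ler_piMl|ring].
have h3 : `|4 * t * (x2 * p0)| <= 144 * (8 * Q).
  rewrite !normrM !(ger0_norm t0) ger0_norm//.
  apply: (@le_trans _ _ (4 * t * (144 * a ^+ 2 * ((1 + t) * Q)))).
    by rewrite ler_wpM2l ?mulr_ge0// ler_pM.
  rewrite [leLHS](_ : _ = 144 * (4 * (((a * t) * (a * (1 + t))) * Q))); last by ring.
  have h : (a * t) * (a * (1 + t)) <= 2 by rewrite -[leRHS]mul1r ler_pM.
  have := ler_wpM2r Q0 h; rewrite ler_pM2l//; lra.
have h4 : `|2 * n%:R * x1 * p0| <= 128 * Q.
  rewrite normrM normrM (ger0_norm n0).
  apply: (@le_trans _ _ (8 * (8 * a) * ((1 + t) * Q))).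
    by rewrite ler_pM ?mulr_ge0// ler_pM.
  rewrite [leLHS](_ : _ = 64 * (a * (1 + t) * Q)); last by ring.
  rewrite (_ : 128 = 64 * 2 :> R); last by ring.
  by rewrite -[leRHS]mulrA ler_wpM2l// ler_wpM2r.
rewrite mulrDr; apply: (le_trans (ler_normD _ _)).
have := ler_normD (z) (4 * t * (2 * x1 * p1) + 4 * t * (x2 * p0)).
have := ler_normD (4 * t * (2 * x1 * p1)) (4 * t * (x2 * p0)).
lra.
Qed.

Let a_ k : R := k.+1%:R^-1.

Let a_ge0 k : 0 <= a_ k. Proof. by rewrite /a_ invr_ge0. Qed.

Let a_le1 k : a_ k <= 1. Proof. by rewrite /a_ invf_le1// ler1n. Qed.

Let a_cvg : a_ k @[k --> \oo] --> (0 : R).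
Proof. exact: cvg_harmonic. Qed.

Let Lcut_cvg t : 0 <= t -> Lcut (a_ k) t @[k --> \oo] --> L t.
Proof.
move=> t0.
have c0 : X0 (a_ k) t @[k --> \oo] --> (1 : R).
  have cf : {for 1, continuous (@flat R 0)}.
    by apply: differentiable_continuous; apply/derivable1_diffP; apply: ex_derive; exact: is_derive_flat.
  have h : 1 - a_ k * t @[k --> \oo] --> (1 : R).
    rewrite -[X in _ --> X](subr0 1) -[X in _ --> _ - X](mul0r t).
    by apply: cvgB; [exact: cvg_cst|apply: cvgM; [exact: a_cvg|exact: cvg_cst]].
  have -> : 1 = expR 1 * flat 0 1 :> R.
    by rewrite /flat ltr01 expr0 !invr1 mul1r -expRD subrr expR0.
  apply: cvgM; first exact: cvg_cst.
  exact: (continuous_cvg _ cf h).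
have sq c (u : nat -> R) : (forall k, `|u k| <= c * a_ k) -> u k @[k --> \oo] --> (0 : R).
  move=> hu; apply/norm_cvg0P.
  apply: (@squeeze_cvgr _ _ _ _ (cst 0) (fun k => c * a_ k)).
  - by apply: nearW => k; rewrite normr_ge0 hu.
  - exact: cvg_cst.
  - by rewrite -(mulr0 c); apply: cvgM; [exact: cvg_cst|exact: a_cvg].
have c1 : X1 (a_ k) t @[k --> \oo] --> (0 : R).
  by apply: (sq 8 (fun k => X1 (a_ k) t)) => k; exact: X1_le.
have c2 : X2 (a_ k) t @[k --> \oo] --> (0 : R).
  apply: (sq 144 (fun k => X2 (a_ k) t)) => k; apply: le_trans (X2_le _ (a_ge0 k)) _.
  by rewrite ler_wpM2l// expr2 ler_piMl.
rewrite (_ : (fun k => Lcut (a_ k) t) = (fun k => X0 (a_ k) t * L t +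
    4 * t * (2 * X1 (a_ k) t * P1 t + X2 (a_ k) t * P0 t) +
    2 * n%:R * X1 (a_ k) t * P0 t)); last first.
  by apply/funext => k; exact: Lcut_diff.
rewrite [X in _ --> X](_ : L t =
  1 * L t + 4 * t * (2 * 0 * P1 t + 0 * P0 t) + 2 * n%:R * 0 * P0 t); last by ring.
have cc (c : R) : (fun=> c) @ \oo --> c by exact: cvg_cst.
exact: (cvgD (cvgD (cvgM c0 (cc (L t))) (cvgM (cc (4 * t)) (cvgD
  (cvgM (cvgM (cc 2) c1) (cc (P1 t))) (cvgM c2 (cc (P0 t))))))
  (cvgM (cvgM (cc (2 * n%:R)) c1) (cc (P0 t)))).
Qed.

Section conclusion.
Variable w : 'rV[R]_n -> R.
Hypotheses (lw : L2 mu w) (w0 : forall x, 0 <= w x).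
Hypothesis sw : forall phi, test_function phi -> (forall x, 0 <= phi x) ->
  \int[mu]_x (w x * laplacian phi x) <= 0.

Let phi k x := G0 (a_ k) (normsq x).

Let test_phi k : test_function (phi k).
Proof.
apply/test_functionP; split.
  rewrite (_ : phi k = fun x => (expR 1 * flat 0 (1 + - a_ k * normsq x)) *
      ((1 + normsq x) `^ (- d) + -1 * (1 + normsq x) `^ (- kappa))).
    apply: smoothM; first by apply: smoothZ; exact: smooth_flat.
    by apply: smoothD; [|apply: smoothZ]; exact: smooth_powR.
  by apply/funext => x; rewrite /phi /G0 /X0 /P0 !mulNr mul1r.
exists k.+1%:R => // x kx; rewrite /phi /G0 /X0 flat_out ?(mulr0, mul0r)//.
rewrite subr_le0 /a_ mulrC ler_pdivlMr// mul1r.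
apply: (@le_trans _ _ (`|x| ^+ 2)); last exact: norm_le_normsq.
rewrite expr2; apply: (@le_trans _ _ `|x|); first exact: ltW.
by rewrite ler_peMl// (le_trans _ (ltW kx))// ler1n.
Qed.

Let phi_ge0 k x : 0 <= phi k x.
Proof.
by rewrite /phi /G0 mulr_ge0 ?P0_ge0 ?normsq_ge0// /X0 mulr_ge0 ?expR_ge0 ?flat_ge0.
Qed.

Let lap_phi k x : laplacian (phi k) x = Lcut (a_ k) (normsq x).
Proof. by apply: laplacian_radial => t t0; [exact: der_G0|exact: der_G1]. Qed.

Let Q x : R := (1 + normsq x) `^ (- d - 1).

Let measQ c : measurable_fun setT (fun x : 'rV[R]_n => (1 + normsq x) `^ c).
Proof. by apply: continuous_measurable_rV; apply: smooth_continuous; exact: smooth_powR. Qed.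

Let n4 : (n <= 4)%N. Proof. by case: n34 => ->. Qed.

Let Q2 x : Q x ^+ 2 = (1 + normsq x) `^ (- (2 + 2 * d)).
Proof.
rewrite /Q -powR_mulrn ?powR_ge0// -powRrM; congr (_ `^ _); ring.
Qed.

Let L2Q : L2 mu Q.
Proof.
split; first exact: measQ.
by under eq_fun do rewrite Q2; have [] := bracket_tail n4 d0 d4.
Qed.

Let intQ2 : \int[mu]_x (Q x ^+ 2) <= (16 * expR 12) / d.
Proof. by under eq_Rintegral do rewrite Q2; have [] := bracket_tail n4 d0 d4. Qed.

(** Integrating [L_ge] against w gives I <= 2 d J, where J is the integral of w Q. By Cauchy-Schwarz
    and [bracket_tail], J^2 is at most a constant times 1/d; the factor d^2 wins and I^2 is of order
    d. *)
Lemma weighted_bound :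
  L1 mu (fun x => w x * (1 + normsq x) `^ (- kappa - 2)) /\
  (\int[mu]_x (w x * (1 + normsq x) `^ (- kappa - 2))) ^+ 2 <=
  4 * d * (16 * expR 12) * \int[mu]_x (w x ^+ 2).
Proof.
have mw := L2_meas lw.
have lwQ : L1 mu (fun x => w x * Q x) by exact: L2M.
have mL : measurable_fun setT (fun x : 'rV[R]_n => L (normsq x)).
  have mn : measurable_fun setT (@normsq R n).
    by apply: continuous_measurable_rV; apply: smooth_continuous; exact: smooth_normsq.
  have mc c c' : measurable_fun setT (fun x : 'rV[R]_n => c * (1 + normsq x) `^ c').
    by apply: measurable_funM => //; exact: measQ.
  rewrite /L /P2 /P1; apply: measurable_funD; apply: measurable_funM => //.
  - exact: measurable_funM.
  - by apply: measurable_funB; exact: mc.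
  - by apply: measurable_funD; exact: mc.
have lB : L1 mu (fun x => w x * (1 + normsq x) `^ (- kappa - 2)).
  apply: L1_dom lwQ => [|x]; first exact: measurable_funM.
  rewrite ger0_norm ?mulr_ge0 ?powR_ge0// ler_wpM2l// /Q.
  apply: ler_powR; first by rewrite lerDl normsq_ge0.
  by have := kappa_half; have := d4; have := d0; move: kappa => K; lra.
have lwL : L1 mu (fun x => w x * L (normsq x)).
  apply: (L1_dom _ _ (L1Z 40 lwQ)) => [|x]; first exact: measurable_funM.
  rewrite normrM ger0_norm// mulrCA ler_wpM2l//.
  by apply: L_le; exact: normsq_ge0.
have wL : \int[mu]_x (w x * L (normsq x)) <= 0.
  have : \int[mu]_x (w x * laplacian (phi k) x) @[k --> \oo] -->
      \int[mu]_x (w x * L (normsq x)).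
    apply: (@dominated_Rint _ _ _ mu _ _ (fun x => 1600 * (w x * Q x))).
    - move=> k; apply: measurable_funM => //; apply: continuous_measurable_rV.
      apply: smooth_continuous; apply: smooth_sum => i.
      by do 2 apply: smooth_partial; exact: test_smooth.
    - exact: measurable_funM.
    - exact: L1Z.
    - apply: aeW => x; apply: cvgM; first exact: cvg_cst.
      by under eq_fun do rewrite lap_phi; apply: Lcut_cvg; exact: normsq_ge0.
    - move=> k x; rewrite lap_phi normrM ger0_norm// mulrCA ler_wpM2l//.
      by apply: Lcut_le => //; exact: normsq_ge0.
  move=> /[dup] h /cvg_lim <- //; apply: limr_le; first by apply/cvg_ex; eexists; exact: h.
  by apply: nearW => k; exact: sw.
split=> //.
set I := \int[mu]_x _; set J := \int[mu]_x (w x * Q x).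
have IJ : 4 * kappa * (kappa + 1) * I - 4 * d * (kappa + 1) * J <= 0.
  apply: le_trans wL; rewrite -!RintZ// -RintB; [|exact: L1Z|exact: L1Z].
  apply: Rint_le => //; first by apply: L1B; exact: L1Z.
  move=> x; rewrite !(mulrCA _ (w x)) -mulrBr ler_wpM2l//.
  by apply: L_ge; exact: normsq_ge0.
have I0 : 0 <= I by apply: Rint_ge0 => x; rewrite mulr_ge0 ?powR_ge0.
have J0 : 0 <= J by apply: Rint_ge0 => x; rewrite mulr_ge0 ?powR_ge0.
have IJ2 : I <= 2 * d * J.
  have k1 := kappa_half; move: (kappa) k1 IJ => K k1.
  rewrite (_ : _ - _ = 4 * (K + 1) * (K * I - d * J)); last by ring.
  by rewrite pmulr_rle0; [nra|lra].
have JQ := cauchy_schwarz lw L2Q; rewrite -/J in JQ.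
set W := \int[mu]_x (w x ^+ 2) in JQ *.
have W0 : 0 <= W by apply: Rint_ge0 => x; exact: sqr_ge0.
have JW : J ^+ 2 <= W * ((16 * expR 12) / d).
  by apply: le_trans JQ _; rewrite ler_wpM2l.
apply: (@le_trans _ _ ((2 * d * J) ^+ 2)); first by rewrite lerXn2r// nnegrE// !mulr_ge0// ltW.
rewrite exprMn; apply: (@le_trans _ _ ((2 * d) ^+ 2 * (W * ((16 * expR 12) / d)))).
  by rewrite ler_wpM2l// sqr_ge0.
by rewrite le_eqVlt; apply/orP; left; apply/eqP; field; rewrite gt_eqF.
Qed.

End conclusion.

End weight.

(** The integral bounded in [weighted_bound] does not depend on d, so d tending to 0 makes it
    vanish; its weight is positive. *)
Theorem superharmonic_L2_eq0 (w : 'rV[R]_n -> R) : L2 mu w -> (forall x, 0 <= w x) ->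
  (forall phi, test_function phi -> (forall x, 0 <= phi x) ->
    \int[mu]_x (w x * laplacian phi x) <= 0) ->
  {ae mu, forall x, w x = 0}.
Proof.
move=> lw w0 sw.
have lB : L1 mu (fun x => w x * (1 + normsq x) `^ (- kappa - 2)).
  by have [] := @weighted_bound 4^-1 _ _ w lw w0 sw; rewrite ?invr_gt0.
set I := \int[mu]_x (w x * (1 + normsq x) `^ (- kappa - 2)).
set C := 4 * (16 * expR 12) * \int[mu]_x (w x ^+ 2).
have C0 : 0 <= C.
  by rewrite /C !mulr_ge0 ?expR_ge0//; apply: Rint_ge0 => x; exact: sqr_ge0.
have H e : 0 < e -> e <= 4^-1 -> I ^+ 2 <= e * C.
  move=> e0 e4'; have [_ h] := @weighted_bound e e0 e4' w lw w0 sw.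
  by apply: le_trans h _; rewrite /C; lra.
have I0 : I = 0.
  apply/eqP; rewrite -sqrf_eq0; apply/eqP/le_anti; rewrite sqr_ge0 andbT.
  rewrite leNgt; apply/negP => I2.
  (* With this e the product e C is at most I^2 / 4, against I^2 <= e C. *)
  have [e0 e4'] : 0 < I ^+ 2 / (4 * (C + I ^+ 2)) /\ I ^+ 2 / (4 * (C + I ^+ 2)) <= 4^-1.
    by split; [rewrite divr_gt0//; lra|rewrite ler_pdivrMr; lra].
  have := H _ e0 e4'; rewrite mulrAC ler_pdivlMr; nra.
have := Rint_eq0_ae lB _ I0; set P := (X in (X -> _) -> _).
have hP : P by move=> x; rewrite mulr_ge0 ?powR_ge0.
move=> /(_ hP); apply: filterS => x /eqP; rewrite mulf_eq0 => /orP[/eqP//|].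
by rewrite gt_eqF// powR_gt0// ltr_wpDr ?normsq_ge0.
Qed.

End liouville.

(** * Density of test functions in H^1 *)

Section taylor.
Context {R : realType} {n : nat}.
Implicit Types (phi f : 'rV[R]_n -> R) (x h : 'rV[R]_n).

Lemma coord_le_norm x i : `|x ord0 i| <= `|x|.
Proof.
have /cubeP/(_ i) := lexx `|x|; rewrite normr_ge0 => /(_ isT).
by rewrite /= in_itv/= -ler_norml.
Qed.

Lemma smooth_MVT phi x h : smooth phi -> exists2 c, 0 <= c <= 1 &
  phi (x + h) - phi x = \sum_i h ord0 i * partial i phi (x + c *: h).
Proof.
move=> sp.
have dr (t : R) : is_derive t 1 (fun s : R => x + s *: h) h.
  have h1 : is_derive t 1 (fun s : R => s *: h) h.
    have dd : differentiable (fun s : R => s *: h) t by apply: ex_diff.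
    apply: DeriveDef; first exact: diff_derivable.
    by rewrite deriveE// diff_val /= scale1r.
  by rewrite -[X in is_derive _ _ _ X]add0r; exact: is_deriveD.
have dg (t : R) : is_derive t (1 : R) (fun s => phi (x + s *: h))
    (\sum_i h ord0 i * partial i phi (x + t *: h)).
  exact: (is_derive_curve (dr t) (smooth_diff sp _)).
have [|c c01 E] := @MVT_segment R (fun s => phi (x + s *: h)) _ 0 1 ler01 (fun t _ => dg t).
  apply: continuous_subspaceT => t; apply: differentiable_continuous.
  by apply/derivable1_diffP.
exists c; first by move: c01; rewrite in_itv.
by move: E; rewrite scale1r scale0r addr0 subr0 mulr1.
Qed.

Lemma test_lipschitz phi : test_function phi ->
  exists2 C, 0 <= C & forall x h, `|phi (x + h) - phi x| <= C * `|h|.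
Proof.
move=> tp.
have [M HM] : exists M : 'I_n -> R, forall i x, `|partial i phi x| <= M i.
  have /choice[M HM] : forall i, exists M, forall x, `|partial i phi x| <= M.
    by move=> i; have [M _ h] := test_bounded (test_partial i tp); exists M.
  by exists M.
have M0 i : 0 <= M i by apply: le_trans (HM i 0).
exists (\sum_i M i); first by apply: sumr_ge0 => i _.
move=> x h; have [c _ ->] := smooth_MVT x h (test_smooth tp).
rewrite mulr_suml; apply: (le_trans (ler_norm_sum _ _ _)); apply: ler_sum => i _.
by rewrite normrM mulrC ler_pM// coord_le_norm.
Qed.

(** The constant is uniform in x, so the remainder can be integrated: this differentiates
    convolutions and shows that derivatives have integral 0. *)
Lemma test_taylor phi : test_function phi ->
  exists2 C, 0 <= C & forall x h,
   `|phi (x + h) - phi x - \sum_i h ord0 i * partial i phi x| <= C * `|h| ^+ 2.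
Proof.
move=> tp.
have [M HM] : exists M : 'I_n -> R, forall i, 0 <= M i /\
    forall x h, `|partial i phi (x + h) - partial i phi x| <= M i * `|h|.
  have /choice[M HM] : forall i, exists M, 0 <= M /\
      forall x h, `|partial i phi (x + h) - partial i phi x| <= M * `|h|.
    by move=> i; have [M M0 h] := test_lipschitz (test_partial i tp); exists M.
  by exists M.
exists (\sum_i M i); first by apply: sumr_ge0 => i _; have [] := HM i.
move=> x h; have [c /andP[c0 c1] ->] := smooth_MVT x h (test_smooth tp).
rewrite -sumrB mulr_suml; apply: (le_trans (ler_norm_sum _ _ _)); apply: ler_sum => i _.
have [M0 Mi] := HM i; rewrite -mulrBr normrM expr2 mulrA mulrC.
apply: ler_pM => //; last exact: coord_le_norm.
apply: (le_trans (Mi _ _)); rewrite ler_wpM2l// normrZ ger0_norm//.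
by rewrite ler_piMl.
Qed.

(** Turns an explicit expansion into differentiability; for a convolution the expansion comes from
    that of the kernel. *)
Lemma differentiable_quadratic f x (a : 'I_n -> R) C :
  (forall h, `|f (x + h) - f x - \sum_i h ord0 i * a i| <= C * `|h| ^+ 2) ->
  differentiable f x /\ forall i, partial i f x = a i.
Proof.
move=> H.
pose L h := \sum_i h ord0 i * a i.
have Llin : linear L.
  move=> c u v; rewrite /L scaler_sumr -big_split/=; apply: eq_bigr => i _.
  by rewrite !mxE mulrDl /GRing.scale/= mulrA.
pose df : {linear 'rV[R]_n -> R} := HB.pack L (GRing.isLinear.Build R 'rV[R]_n R _ L Llin).
have cL : continuous df.
  apply: (smooth_continuous (_ : smooth L)); apply: smooth_sum => i.
  by apply: smoothM; [exact: smooth_coord|exact: smooth_cst].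
have E : f \o shift x = cst (f x) + df +o_ (0 : 'rV[R]_n) id.
  apply/eqaddoP => _/posnumP[e].
  have d0 : 0 < e%:num / (`|C| + 1) by rewrite divr_gt0// ltr_wpDl.
  near=> h.
  rewrite /= -[X in `|X|]/(f (h + x) - (f x + L h)) opprD addrA [h + x]addrC.
  apply: (le_trans (H h)); rewrite expr2 mulrA ler_wpM2r//.
  have hK : `|h| <= e%:num / (`|C| + 1).
    by near: h; exact: (nbhs0_le (V := 'rV[R]_n) d0).
  rewrite ler_pdivlMr in hK; last by rewrite ltr_wpDl.
  have := ler_norm C; have := normr_ge0 h; nra.
have dE := diff_unique cL E.
have dd : differentiable f x.
  by apply/diff_locallyP; split; [move=> y; rewrite dE; exact: cL|rewrite dE].
split => // i; rewrite partialE// dE /df/= /L (bigD1 i)//= mxE !eqxx mul1r big1 ?addr0//.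
by move=> j ji; rewrite mxE (negbTE ji) andbF mul0r.
Unshelve. all: by end_near. Qed.

End taylor.

(** * Convolution with test functions *)

Section convolution.
Context {R : realType} {n : nat}.
Local Notation mu := (lebesgue_rV R n).
Implicit Types (phi rho f g eta : 'rV[R]_n -> R) (x h : 'rV[R]_n).

Definition convolve rho f x : R := \int[mu]_y (rho (x - y) * f y).

Lemma L1_Mbounded f g M : L1 mu f -> measurable_fun setT g -> (forall x, `|g x| <= M) ->
  L1 mu (fun x => g x * f x).
Proof.
move=> lf mg gM; apply: (L1_le _ _ (L1Z M lf)).
  exact: measurable_funM mg (L1_meas lf).
move=> x; rewrite !normrM ler_wpM2r//.
by rewrite (le_trans (gM x))// ler_norm.
Qed.

Lemma test_reflect_meas phi x : test_function phi -> measurable_fun setT (fun y : 'rV[R]_n => phi (x - y)).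
Proof. by move=> tp; apply: test_meas; exact: test_reflect. Qed.

Lemma conv_L1 phi f x : test_function phi -> L1 mu f -> L1 mu (fun y => phi (x - y) * f y).
Proof.
move=> tp lf; have [M _ HM] := test_bounded tp.
by apply: (L1_Mbounded lf (M := M)) => [|y //]; exact: test_reflect_meas.
Qed.

Lemma conv_diff phi f x : test_function phi -> L1 mu f ->
  differentiable (convolve phi f) x /\ forall i, partial i (convolve phi f) x = convolve (partial i phi) f x.
Proof.
move=> tp lf; have [C C0 HC] := test_taylor tp.
have lp i y : L1 mu (fun z => partial i phi (y - z) * f z).
  by apply: conv_L1 => //; exact: test_partial.
apply: (@differentiable_quadratic _ _ _ _ _ (C * \int[mu]_y `|f y|)) => h.
rewrite /convolve -RintB; [|exact: conv_L1|exact: conv_L1].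
under eq_bigr do rewrite -RintZ//.
rewrite -Rint_sum; last by move=> i; exact: L1Z.
rewrite -RintB; [|by apply: L1B; exact: conv_L1|by apply: L1_sum => i; exact: L1Z].
have E y : phi (x + h - y) * f y - phi (x - y) * f y -
    \sum_i h ord0 i * (partial i phi (x - y) * f y) =
    (phi (x - y + h) - phi (x - y) - \sum_i h ord0 i * partial i phi (x - y)) * f y.
  rewrite [x + h - y]addrAC !mulrBl mulr_suml; congr (_ - _).
  by apply: eq_bigr => i _; rewrite mulrA.
rewrite (eq_Rint _ E).
apply: (le_trans (Rint_norm _)).
  apply: eq_L1 (fun y => E y) _.
  by apply: L1B; [apply: L1B; exact: conv_L1|apply: L1_sum => i; exact: L1Z].
rewrite mulrAC -RintZ; last exact: L1_norm.
apply: Rint_le.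
- apply: L1_norm; apply: eq_L1 (fun y => E y) _.
  by apply: L1B; [apply: L1B; exact: conv_L1|apply: L1_sum => i; exact: L1Z].
- by apply: L1Z; exact: L1_norm.
- by move=> y; rewrite normrM ler_wpM2r.
Qed.

Lemma conv_smooth phi f : test_function phi -> L1 mu f -> smooth (convolve phi f).
Proof.
move=> tp lf; apply: (@generated_smooth _ _
  [set g | exists2 p, test_function p & g = convolve p f]).
- by move=> _ [p tp' ->] x; have [] := conv_diff x tp' lf.
- move=> i _ [p tp' ->]; apply: gen_in; exists (partial i p); first exact: test_partial.
  by apply/funext => x; have [_ ->] := conv_diff x tp' lf.
- by apply: gen_in; exists phi.
Qed.

Lemma conv_vanishes phi f r s : vanishes_outside r phi -> vanishes_outside s f ->
  vanishes_outside (r + s) (convolve phi f).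
Proof.
move=> hp hf x xrs; rewrite /convolve; transitivity (\int[mu]_y (0 : R)); last by rewrite /Rintegral integral0.
apply: eq_Rint => y.
have [ys|ys] := lerP `|y| s; last by rewrite hf// mulr0.
rewrite hp ?mul0r// -(ltrD2r s) (lt_le_trans xrs)//.
by apply: le_trans (lerD (lexx _) ys); rewrite -{1}(subrK y x) ler_normD.
Qed.

Lemma conv_test phi f r s : 0 < r -> 0 <= s -> test_function phi -> L1 mu f ->
  vanishes_outside r phi -> vanishes_outside s f -> test_function (convolve phi f).
Proof.
move=> r0 s0 tp lf hp hf; apply/test_functionP; split; first exact: conv_smooth.
by exists (r + s); [rewrite ltr_wpDr|exact: conv_vanishes].
Qed.

(** The function y |-> phi (x - y) is itself a test function, and the sign from the reflection
    cancels the one in the weak derivative. *)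
Lemma conv_weak_partial i phi f g : test_function phi -> L1 mu f -> L1 mu g ->
  weak_partial i f g -> forall x, partial i (convolve phi f) x = convolve phi g x.
Proof.
move=> tp lf lg wfg x; have [_ ->] := conv_diff x tp lf.
have := wfg _ (test_reflect x tp).
have E y : partial i (fun z => phi (x - z)) y = - partial i phi (x - y).
  have : differentiable phi (-1 *: y + x) by apply: smooth_diff; exact: test_smooth.
  move=> /(partial_affine i); under eq_fun do rewrite scaleN1r addrC.
  by rewrite scaleN1r addrC mulN1r.
under eq_Rintegral do rewrite E mulrN mulrC.
rewrite RintN; last by apply: conv_L1 => //; exact: test_partial.
move=> /oppr_inj; rewrite /convolve => ->.
by apply: eq_Rint => y; rewrite mulrC.
Qed.

Lemma conv_reflect phi f x : test_function phi -> L1 mu f ->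
  convolve phi f x = \int[mu]_h (phi h * f (x - h)).
Proof.
move=> tp lf; rewrite /convolve -(Rint_reflect x); last exact: conv_L1.
by apply: eq_Rint => h; rewrite opprB addrC subrK.
Qed.

End convolution.

Section fubini_Rintegral.
Context d1 d2 (T1 : measurableType d1) (T2 : measurableType d2) (R : realType).
Variables (m1 : {sigma_finite_measure set T1 -> \bar R})
  (m2 : {sigma_finite_measure set T2 -> \bar R}).

Lemma Rint_Fubini (F : T1 * T2 -> R) : L1 (m1 \x m2)%E F ->
  (forall x, L1 m2 (fun y => F (x, y))) -> (forall y, L1 m1 (fun x => F (x, y))) ->
  \int[m1]_x \int[m2]_y F (x, y) = \int[m2]_y \int[m1]_x F (x, y).
Proof.
move=> lF l2 l1; rewrite /Rintegral; congr fine.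
transitivity (\int[m1]_x \int[m2]_y (F (x, y))%:E)%E.
  by apply: eq_integral => x _; rewrite -[LHS]/((\int[m2]_y F (x, y))%:E) RintE.
rewrite (Fubini lF); apply: eq_integral => y _.
by rewrite -[RHS]/((\int[m1]_x F (x, y))%:E) RintE.
Qed.

End fubini_Rintegral.

Lemma near_natS_ge (R : realType) (a : R) : \forall k \near \oo, a <= k.+1%:R.
Proof.
exists (Num.truncn a) => // k /= ak; apply: ltW; apply: (lt_le_trans (truncnS_gt a)).
by rewrite ler_nat.
Qed.

Section indicators.
Context d (T : measurableType d) (R : realType) (mu : {measure set T -> \bar R}).

Lemma L1_indic A (c : R) : measurable A -> mu A = c%:E -> L1 mu (fun x => \1_A x : R).
Proof.
move=> mA muA; apply: L1_ge0P => //; first exact: measurable_indic.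
by rewrite integral_indic ?setIT// muA ltry.
Qed.

Lemma Rint_indic A (c : R) : measurable A -> mu A = c%:E -> \int[mu]_x (\1_A x : R) = c.
Proof. by move=> mA muA; rewrite /Rintegral integral_indic ?setIT// muA. Qed.

End indicators.

(** * Continuity of translations in L^2 *)

Section translation_continuity.
Context {R : realType} {n : nat}.
Local Notation mu := (lebesgue_rV R n).
Local Notation V := 'rV[R]_n.
Implicit Types (f g : V -> R) (x h : V) (A B : set V).

Definition translation_continuous g := forall e, 0 < e -> exists2 d, 0 < d &
  forall h, `|h| <= d -> \int[mu]_x ((g (x - h) - g x) ^+ 2) <= e.

Lemma L2_translate h g : L2 mu g -> L2 mu (fun x => g (x - h)).
Proof. by move=> lg; exact: L2_shift. Qed.

Lemma measurable_translate h : measurable_fun setT (fun x : V => x - h).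
Proof. by have := measurable_rV_affine 1 (- h); under eq_fun do rewrite scale1r. Qed.

Lemma translation_continuousD f g : L2 mu f -> L2 mu g ->
  translation_continuous f -> translation_continuous g ->
  translation_continuous (fun x => f x + g x).
Proof.
move=> lf lg tf tg e e0; have e4 : 0 < e / 4 by rewrite divr_gt0.
have [d1 d10 h1] := tf _ e4; have [d2 d20 h2] := tg _ e4.
exists (Num.min d1 d2); first by rewrite lt_min d10.
move=> h; rewrite le_min => /andP[/h1 {}h1 /h2 {}h2].
have lF : L2 mu (fun x => f (x - h) - f x) by apply: L2B => //; exact: L2_translate.
have lG : L2 mu (fun x => g (x - h) - g x) by apply: L2B => //; exact: L2_translate.
have := Rint_sqrD lF lG; rewrite (eq_Rint _ (g := fun x => (f (x - h) + g (x - h) - (f x + g x)) ^+ 2)).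
  lra.
by move=> x; rewrite opprD addrACA.
Qed.

Lemma translation_continuousZ c f : L2 mu f -> translation_continuous f ->
  translation_continuous (fun x => c * f x).
Proof.
move=> lf tf e e0; have c0 : 0 < c ^+ 2 + 1 by rewrite ltr_wpDl ?sqr_ge0.
have [d d0 hd] := tf _ (divr_gt0 e0 c0); exists d => // h /hd {}hd.
have lF : L2 mu (fun x => f (x - h) - f x) by apply: L2B => //; exact: L2_translate.
under eq_Rintegral do rewrite -mulrBr exprMn.
rewrite RintZ; last exact: L2_sqr.
move: hd; rewrite ler_pdivlMr//; set I := \int[mu]_x _.
have : 0 <= I by apply: Rint_ge0 => x; exact: sqr_ge0.
lra.
Qed.

Lemma translation_continuous_sum (F : nat -> V -> R) m : (forall j, L2 mu (F j)) ->
  (forall j, translation_continuous (F j)) ->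
  translation_continuous (fun x => \sum_(j < m) F j x).
Proof.
move=> lF tF; elim: m => [|m ih].
  move=> e e0; exists 1 => // h _; under eq_Rintegral do rewrite !big_ord0 subrr expr0n.
  by rewrite /Rintegral integral0 ltW.
under eq_fun do rewrite big_ord_recr/=.
by apply: translation_continuousD => //; apply: L2_sum => j.
Qed.

Lemma translation_continuous_lim g : L2 mu g ->
  (forall e, 0 < e -> exists f, [/\ L2 mu f, translation_continuous f &
     \int[mu]_x ((g x - f x) ^+ 2) <= e]) ->
  translation_continuous g.
Proof.
move=> lg H e e0; have e8 : 0 < e / 16 by rewrite divr_gt0.
have [f [lf tf fg]] := H _ e8; have [d d0 hd] := tf _ e8.
exists d => // h /hd {}hd.
have lfg : L2 mu (fun x => g x - f x) by exact: L2B.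
have l1 : L2 mu (fun x => g (x - h) - f (x - h)) by apply: L2B; exact: L2_translate.
have l2 : L2 mu (fun x => f x - g x) by exact: L2B.
have l3 : L2 mu (fun x => f (x - h) - f x) by apply: L2B => //; exact: L2_translate.
have E1 : \int[mu]_x ((g (x - h) - f (x - h)) ^+ 2) = \int[mu]_x ((g x - f x) ^+ 2).
  by rewrite -[RHS](Rint_shift (- h))//; exact: L2_sqr.
have E2 : \int[mu]_x ((f x - g x) ^+ 2) = \int[mu]_x ((g x - f x) ^+ 2).
  by apply: eq_Rint => x; rewrite -sqrrN opprB.
have := Rint_sqrD l1 l2; rewrite E1 E2.
have := Rint_sqrD (L2D l1 l2) l3.
rewrite (eq_Rint _ (g := fun x => (g (x - h) - g x) ^+ 2)); first lra.
by move=> x; congr (_ ^+ 2); ring.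
Qed.

Let D A r h : R := \int[mu]_x (\1_(@cube R n r) x * `|\1_A (x - h) - \1_A x|).

(* Working with the sigma-algebra of sets whose indicator is translation
   continuous spares the approximation of measurable sets by open ones. *)
Let good A := measurable A /\ forall r e, 0 <= r -> 0 < e -> exists2 d, 0 < d &
  forall h, `|h| <= d -> D A r h <= e.

Let mcube r : measurable_fun setT (fun x : V => \1_(@cube R n r) x : R).
Proof. by apply: measurable_indic; exact: measurable_cube. Qed.

Let mind A h : measurable A -> measurable_fun setT (fun x : V => \1_A (x - h) : R).
Proof.
move=> mA; have m1 : measurable_fun setT (\1_A : V -> R) by exact: measurable_indic.
exact: (measurableT_comp m1 (measurable_translate h)).
Qed.

Let ind01 A x : 0 <= (\1_A x : R) <= 1.
Proof. by rewrite indicE; case: (_ \in _); rewrite lexx ler01. Qed.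

Let cubeL1 r f : 0 <= r -> measurable_fun setT f -> (forall x, `|f x| <= 1) ->
  L1 mu (fun x => \1_(@cube R n r) x * f x).
Proof.
move=> r0 mf f1; apply: (L1_dom _ _ (L1_cube_indic n r0)); first exact: measurable_funM.
move=> x; have /andP[h1 h2] := ind01 (cube r) x.
by rewrite normrM ger0_norm// ler_piMr.
Qed.

Let LD A r h : 0 <= r -> measurable A ->
  L1 mu (fun x => \1_(@cube R n r) x * `|\1_A (x - h) - \1_A x|).
Proof.
move=> r0 mA; apply: cubeL1 => // [|x].
  by apply: measurableT_comp => //; apply: measurable_funB; [exact: mind|exact: measurable_indic].
rewrite normr_id; have /andP[h1 h2] := ind01 A x; have /andP[h3 h4] := ind01 A (x - h).
by rewrite ler_norml; apply/andP; split; lra.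
Qed.

Let good0 : good set0.
Proof.
split => // r e r0 e0; exists 1 => // h _; rewrite /D.
under eq_Rintegral do rewrite !indic0 subrr normr0 mulr0.
by rewrite /Rintegral integral0 ltW.
Qed.

Let goodC A : good A -> good (~` A).
Proof.
move=> [mA gA]; split; first exact: measurableC.
move=> r e r0 e0; have [d d0 hd] := gA r e r0 e0; exists d => // h /hd.
rewrite /D (eq_Rint _ (g := fun x => \1_(@cube R n r) x * `|\1_(~` A) (x - h) - \1_(~` A) x|))// => x.
congr (_ * _); rewrite !indicE !in_setC.
by do 2 case: (_ \in _) => /=; rewrite ?subrr ?subr0 ?sub0r ?normrN.
Qed.

Let goodU A B : good A -> good B -> good (A `|` B).
Proof.
move=> [mA gA] [mB gB]; have mU := measurableU A B mA mB; split => //.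
move=> r e r0 e0; have e2 : 0 < e / 2 by rewrite divr_gt0.
have [d1 d10 h1] := gA r _ r0 e2; have [d2 d20 h2] := gB r _ r0 e2.
exists (Num.min d1 d2); first by rewrite lt_min d10.
move=> h; rewrite le_min => /andP[/h1 {}h1 /h2 {}h2].
apply: (@le_trans _ _ (D A r h + D B r h)); last lra.
rewrite /D -RintD; [|exact: LD|exact: LD].
apply: Rint_le; [exact: LD|by apply: L1D; exact: LD|] => x.
rewrite -mulrDr; have /andP[h3 _] := ind01 (cube r) x; apply: ler_wpM2l => //.
rewrite !indicE !in_setU.
by do 4 case: (_ \in _) => /=; rewrite ?subrr ?subr0 ?sub0r ?normrN ?normr0 ?normr1; lra.
Qed.

Let good_bigsetU (F : nat -> set V) K : (forall k, good (F k)) ->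
  good (\big[setU/set0]_(k < K) F k).
Proof.
move=> gF; elim: K => [|K ih]; first by rewrite big_ord0.
by rewrite big_ord_recr/=; exact: goodU.
Qed.

(** The union differs from a finite one, B K, by a tail T K whose measure in a fixed cube tends to
    0. The tail enters twice, translated and not; the cube of radius r + 1 contains the translates
    by |h| <= 1 of the cube of radius r. *)
Let good_bigcup (F : nat -> set V) : (forall k, good (F k)) -> good (\bigcup_k F k).
Proof.
move=> gF; set A := \bigcup_k F k.
have mA : measurable A by apply: bigcupT_measurable => k; have [] := gF k.
split => // r e r0 e0.
pose B K := \big[setU/set0]_(k < K) F k; pose T K := A `\` B K.
have mB K : measurable (B K) by have [] := good_bigsetU K gF.
have mT K : measurable (T K) by exact: measurableD.
have r1 : 0 <= r + 1 by lra.
pose m K : R := \int[mu]_x (\1_(@cube R n (r + 1)) x * \1_(T K) x).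
have m0 : m K @[K --> \oo] --> (0 : R).
  have E0 : \int[mu]_x (0 : R) = 0 by rewrite /Rintegral integral0.
  rewrite -E0; apply: (dominated_Rint (g := fun x => \1_(@cube R n (r + 1)) x)) => //.
  - by move=> K; apply: measurable_funM => //; exact: measurable_indic.
  - exact: L1_cube_indic.
  - apply: aeW => x; apply: cvg_near_cst.
    have [[k _ Fk]|nA] := pselect (A x).
      exists k.+1 => // K /= kK; rewrite (indicE _ (T K)) memNset ?mulr0// => -[_ nB]; apply: nB.
      by rewrite /B -bigcup_mkord; exists k.
    by exists 0%N => // K _; rewrite (indicE _ (T K)) memNset ?mulr0// => -[].
  - move=> K x; have /andP[h1 _] := ind01 (cube (r + 1)) x; have /andP[h2 h3] := ind01 (T K) x.
    by rewrite ger0_norm ?mulr_ge0// ler_piMr.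
have e4 : 0 < e / 4 by rewrite divr_gt0.
have [K _ /(_ _ (leqnn K)) mK] := cvgr0_norm_le m m0 _ e4.
have {}mK := le_trans (ler_norm _) mK.
have [_ /(_ r _ r0 e4)[d d0 hd]] := good_bigsetU K gF.
exists (Num.min d 1); first by rewrite lt_min d0 ltr01.
move=> h; rewrite le_min => /andP[/hd {}hd h1].
have lT : L1 mu (fun x => \1_(@cube R n (r + 1)) x * \1_(T K) x).
  apply: cubeL1 => // x.
  by have /andP[h2 h3] := ind01 (T K) x; rewrite ger0_norm.
have lTh : L1 mu (fun x => \1_(@cube R n (r + 1)) (x - h) * \1_(T K) (x - h)).
  exact: (L1_shift (- h) lT).
have mE : \int[mu]_x (\1_(@cube R n (r + 1)) (x - h) * \1_(T K) (x - h)) = m K.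
  exact: (Rint_shift (- h) lT).
apply: (@le_trans _ _ (D (B K) r h + (m K + m K))); last lra.
rewrite -{1}mE /m -RintD// /D -RintD; [|exact: LD|exact: L1D].
apply: Rint_le; [exact: LD|by apply: L1D; [exact: LD|exact: L1D]|] => x.
have E y : \1_A y = \1_(B K) y + \1_(T K) y :> R.
  rewrite !indicE /T in_setD; have : (y \in B K) ==> (y \in A).
    apply/implyP => /set_mem yB; apply/mem_set.
    by move: yB; rewrite /B -bigcup_mkord => -[k _ Fk]; exists k.
  by do 2 case: (_ \in _) => //=; rewrite ?addr0 ?add0r.
have /andP[t1 t2] := ind01 (T K) x; have /andP[t3 t4] := ind01 (T K) (x - h).
have [xr|xr] := pselect (@cube R n r x); last first.
  by rewrite (indicE _ (cube r)) memNset// !mul0r add0r addr_ge0// mulr_ge0//; have /andP[] := ind01 (cube (r + 1)) _.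
rewrite (indicE _ (cube r)) mem_set// !mul1r.
have {}xr := (cubeP x r0).1 xr.
rewrite !(indicE _ (cube (r + 1))) !mem_set/= ?mul1r.
- rewrite !E; apply: (@le_trans _ _ (`|\1_(B K) (x - h) - \1_(B K) x + (\1_(T K) (x - h) - \1_(T K) x)|)).
    by rewrite le_eqVlt; apply/orP; left; apply/eqP; congr `|_|; ring.
  apply: (le_trans (ler_normD _ _)); rewrite lerD2l.
  by rewrite ler_norml; apply/andP; split; lra.
- by apply/cubeP => //; lra.
- by apply/cubeP => //; apply: (le_trans (ler_normB _ _)); lra.
Qed.

(** Translation by h changes the indicator only in the slab |x_i - a| <= |h|, whose part in the cube
    has measure at most 2 |h| (2r)^(n-1). The constant c uses 2r + 1 >= 1 to replace the exponent n
    - 1 by n. *)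
Let good_halfspace (i : 'I_n) (a : R) : good ((fun x : V => x ord0 i) @^-1` `]a, +oo[).
Proof.
set A := _ @^-1` _; have mA : measurable A.
  by rewrite -[X in measurable X]setTI; exact: measurable_coord.
split => // r e r0 e0; pose c := 2 * (2 * r + 1) ^+ n.
have c0 : 0 < c by rewrite mulr_gt0// exprn_gt0//; lra.
exists (e / c); first by rewrite divr_gt0.
move=> h; rewrite ler_pdivlMr// => hc; set d := `|h| in hc *.
have d0 : 0 <= d by exact: normr_ge0.
pose S j : set R := if j == i then `[a - d, a + d]%classic else `[- r, r]%classic.
have mS j : measurable (S j) by rewrite /S; case: ifP.
pose Bx := [set x : V | forall j, S j (x ord0 j)].
have mBx : measurable Bx by exact: measurable_box.
have muB : mu Bx = (\prod_(j < n) (if j == i then 2 * d else 2 * r))%:E.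
  rewrite (lebesgue_rV_box mS) -prodEFin; apply: eq_bigr => j _; rewrite /S.
  by case: ifP => _; rewrite lebesgue_measure_itv/= lte_fin; case: ifPn => hh;
    rewrite -?EFinB; congr EFin; lra.
have lB : L1 mu (fun x => \1_Bx x : R) by exact: (L1_indic mBx muB).
have IB : \int[mu]_x (\1_Bx x : R) <= c * d.
  rewrite (Rint_indic mBx muB) (bigD1 i)//= eqxx /c [leRHS]mulrAC.
  rewrite ler_wpM2l ?mulr_ge0//.
  apply: (@le_trans _ _ (\prod_(j < n | j != i) (2 * r + 1))).
    by apply: ler_prod => j /negbTE ->; rewrite mulr_ge0//= lerDl.
  rewrite prodr_const; apply: ler_weXn2l; first lra.
  by rewrite -[X in (_ <= X)%N]card_ord max_card.
apply: (@le_trans _ _ (\int[mu]_x (\1_Bx x : R))); last by rewrite (le_trans IB)// mulrC.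
apply: Rint_le => //; first exact: LD.
move=> x; have /andP[b0 _] := ind01 Bx x.
have [xr|xr] := pselect (@cube R n r x); last by rewrite (indicE _ (cube r)) memNset// mul0r.
have [xi|xi] := lerP `|x ord0 i - a| d.
  rewrite [leRHS]indicE mem_set; last first.
    move=> j; rewrite /S; case: ifPn => [/eqP ->|_]; last exact: xr.
    by move: xi; rewrite /= in_itv/= ler_norml => /andP[x1 x2]; apply/andP; split; lra.
  rewrite indicE mem_set// mul1r !indicE.
  by do 2 case: (_ \in _) => /=; rewrite ?subrr ?subr0 ?sub0r ?normrN ?normr0 ?normr1.
have hi := coord_le_norm h i; rewrite -/d in hi.
rewrite (_ : \1_A (x - h) = \1_A x) ?subrr ?normr0 ?mulr0//.
rewrite !indicE; congr ((nat_of_bool _)%:R).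
move: hi xi; rewrite ler_norml ltr_normr => /andP[hi1 hi2] xi.
apply/idP/idP => /set_mem xA; apply/mem_set; move: xA; rewrite /A /= !in_itv/= !andbT !mxE => xA.
  by case/orP: xi => xi; lra.
by case/orP: xi => xi; lra.
Qed.

Let measurable_good A : measurable A -> good A.
Proof.
have sg : sigma_algebra setT good.
  split; [exact: good0|move=> B gB; rewrite setTD; exact: goodC|exact: good_bigcup].
apply: (smallest_sub sg) => B.
move: B; rewrite -bigcup_seq => B [i _ /= [Y mY <-]]; rewrite setTI.
pose G Y := good ((fun x : V => x ord0 i) @^-1` Y).
suff : @measurable _ R `<=` G by apply.
rewrite [X in X `<=` _](RGenOInfty.measurableE R : _ = <<s @RGenOInfty.G R >>); apply: smallest_sub.
  split => [|C gC|F gF].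
  - by rewrite /G preimage_set0; exact: good0.
  - by rewrite /G setTD preimage_setC; exact: goodC.
  - by rewrite /G preimage_bigcup; exact: good_bigcup.
by move=> _ [a ->]; exact: good_halfspace.
Qed.

Lemma translation_continuous_indic A r : measurable A -> 0 <= r -> A `<=` @cube R n r ->
  translation_continuous (\1_A : V -> R).
Proof.
move=> mA r0 Ar e e0; have r1 : 0 <= r + 1 by lra.
have [_ /(_ _ e r1 e0)[d d0 hd]] := measurable_good mA.
exists (Num.min d 1); first by rewrite lt_min d0 ltr01.
move=> h; rewrite le_min => /andP[/hd {}hd h1]; apply: le_trans hd.
rewrite le_eqVlt; apply/orP; left; apply/eqP; apply: eq_Rint => x.
have out y : ~ @cube R n r y -> \1_A y = 0 :> R.
  by move=> ny; rewrite indicE memNset// => /Ar.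
have [xr|xr] := pselect (@cube R n (r + 1) x).
  rewrite (indicE _ (cube _)) mem_set// mul1r !indicE.
  by do 2 case: (_ \in _) => /=; rewrite ?subrr ?subr0 ?sub0r ?normrN ?normr0 ?normr1 ?sqrrN ?expr0n ?expr1n.
rewrite (indicE _ (cube _)) memNset// mul0r !out ?subr0 ?expr0n//.
  move=> xr'; apply: xr; apply/cubeP => //.
  by have := (cubeP x r0).1 xr'; lra.
move=> /(cubeP _ r0) xh; apply: xr; apply/cubeP => //.
by rewrite -(subrK h x) (le_trans (ler_normD _ _))// lerD.
Qed.

(** Approximation by the simple functions F k: on the cube of radius k + 1, g is rounded down to a
    multiple of 1/(k+1), and large values are replaced by 0. *)
Let translation_continuous_ge0 g : L2 mu g -> (forall x, 0 <= g x) -> translation_continuous g.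
Proof.
move=> lg g0; have mg := L2_meas lg.
pose A k j := @cube R n k.+1%:R `&` (fun x => k.+1%:R * g x) @^-1` `[j%:R, j.+1%:R[.
have mA k j : measurable (A k j).
  apply: measurableI; first exact: measurable_cube.
  by rewrite -[X in measurable X]setTI; apply: measurable_funM => //; exact: measurable_itv.
(* If g x <= k + 1, the level of g x is at most (k+1)^2, so levels 0 to (k+1)^2 suffice. *)
pose M k := (k.+1 ^ 2).+1.
pose F k x := \sum_(j < M k) (j%:R / k.+1%:R) * (\1_(A k j) x : R).
have k0 k : 0 < k.+1%:R :> R by [].
have AE k j x : \1_(A k j) x = ((`[< @cube R n k.+1%:R x >]) && (Num.truncn (k.+1%:R * g x) == j))%:R :> R.
  rewrite indicE; congr (_%:R); congr nat_of_bool; apply/idP/idP.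
    move=> /set_mem[c1 /=]; rewrite in_itv/= => c2.
    by rewrite asboolT//= (truncn_def c2).
  move=> /andP[/asboolP c1 /eqP <-]; apply/mem_set; split => //=.
  by rewrite in_itv/=; apply: truncn_itv; rewrite mulr_ge0// ltW.
have FE k x : F k x = if `[< @cube R n k.+1%:R x >] && (Num.truncn (k.+1%:R * g x) < M k)%N
   then (Num.truncn (k.+1%:R * g x))%:R / k.+1%:R else 0.
  rewrite /F; under eq_bigr do rewrite AE.
  case: asboolP => cx /=; last by rewrite big1// => j _; rewrite mulr0.
  set J := Num.truncn _; case: ltnP => JM.
    rewrite (bigD1 (Ordinal JM))//= eqxx mulr1 big1 ?addr0// => j jJ.
    by rewrite (_ : (J == j) = false) ?mulr0//; apply/negbTE; move: jJ; rewrite -val_eqE/= eq_sym.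
  rewrite big1// => j _; case: eqP => [JE|_]; last by rewrite mulr0.
  by move: JM; rewrite JE leqNgt ltn_ord.
have trunc_le k x : (Num.truncn (k.+1%:R * g x))%:R / k.+1%:R <= g x.
  have kg : 0 <= k.+1%:R * g x by rewrite mulr_ge0// ltW.
  by rewrite ler_pdivrMr// [leRHS]mulrC; have /andP[] := truncn_itv kg.
have F0 k x : 0 <= F k x <= g x.
  by rewrite FE; case: ifPn => _; rewrite ?lexx ?g0// trunc_le divr_ge0.
have mF k : measurable_fun setT (F k).
  apply: measurable_sum => j; apply: measurable_funM => //; exact: measurable_indic.
have lA k j : L2 mu (\1_(A k j) : V -> R).
  split; first exact: measurable_indic.
  apply: (L1_dom _ _ (L1_cube_indic n (ltW (k0 k)))).
    by apply: measurable_funX; exact: measurable_indic.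
  move=> x; rewrite !indicE; have : (x \in A k j) ==> (x \in @cube R n k.+1%:R).
    by apply/implyP => /set_mem[c1 _]; exact/mem_set.
  by do 2 case: (_ \in _) => //=; rewrite ?expr0n ?expr1n ?normr0 ?normr1.
have lF k : L2 mu (F k) by apply: L2_sum => j; exact: L2Z.
apply: translation_continuous_lim => // e e0.
have cv : \int[mu]_x ((g x - F k x) ^+ 2) @[k --> \oo] --> (0 : R).
  have E0 : \int[mu]_x (0 : R) = 0 by rewrite /Rintegral integral0.
  rewrite -E0; apply: (dominated_Rint (g := fun x => g x ^+ 2)) => //.
  - by move=> k; apply: measurable_funX; exact: measurable_funB.
  - exact: L2_sqr.
  - apply: aeW => x.
    suff : (fun k => g x - F k x) @ \oo --> (0 : R).
      by move=> h; rewrite -[X in _ --> X](mulr0 0); exact: (cvgM h h).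
    apply/norm_cvg0P; apply: (@squeeze_cvgr _ _ _ _ (cst 0) (fun k => k.+1%:R^-1)).
    + near=> k; rewrite normr_ge0/=.
      have /andP[f0 f1] := F0 k x; rewrite ger0_norm ?subr_ge0//.
      have xk : `|x| <= k.+1%:R.
        near: k; exact: near_natS_ge.
      have gk : g x <= k.+1%:R.
        near: k; exact: near_natS_ge.
      rewrite FE asboolT/=; last exact/cubeP.
      have : 0 <= k.+1%:R * g x by rewrite mulr_ge0// ltW.
      move=> /truncn_itv; set J := Num.truncn _ => /andP[J1 J2].
      rewrite ifT; last first.
        rewrite /M ltnS -(ler_nat R) natrX (le_trans J1)// expr2.
        by rewrite ler_wpM2l// ltW.
      rewrite -[leRHS]div1r ler_pdivlMr// mulrBl divfK ?gt_eqF//.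
      by rewrite lerBlDr mulrC nat1r ltW.
    + exact: cvg_cst.
    + exact: cvg_harmonic.
  - move=> k x; have /andP[f0 f1] := F0 k x.
    rewrite ger0_norm ?sqr_ge0// lerXn2r ?nnegrE ?subr_ge0//.
    by rewrite lerBlDr lerDl.
have [K _ /(_ _ (leqnn K)) hK] := cvgr0_norm_le _ cv _ e0.
exists (F K); split => //; last exact: le_trans (ler_norm _) hK.
apply: (translation_continuous_sum (F := fun j x => (j%:R / K.+1%:R) * (\1_(A K j) x : R))).
- by move=> j; exact: L2Z.
- move=> j; apply: translation_continuousZ => //.
  by apply: (translation_continuous_indic (r := K.+1%:R)) => // x [].
Unshelve. all: by end_near. Qed.

Theorem L2_translation_continuous g : L2 mu g -> translation_continuous g.
Proof.
move=> lg; have mg := L2_meas lg.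
have lp : L2 mu (fun x => Num.max (g x) 0).
  apply: L2_dom lg => [|x]; first exact: measurable_maxr.
  by rewrite /Num.max; case: ifPn => // _; rewrite normr0.
have lm : L2 mu (fun x => Num.max (- g x) 0).
  apply: L2_dom lg => [|x].
    by apply: measurable_maxr => //; exact: measurableT_comp.
  by rewrite /Num.max; case: ifPn => // _; rewrite ?normr0// normrN.
have -> : g = fun x => Num.max (g x) 0 + -1 * Num.max (- g x) 0.
  apply/funext => x; rewrite /Num.max oppr_lt0; case: (ltgtP (g x) 0) => ? //; lra.
apply: translation_continuousD => //; first exact: L2Z.
  by apply: translation_continuous_ge0 => // x; rewrite le_max lexx orbT.
apply: translation_continuousZ => //.
by apply: translation_continuous_ge0 => // x; rewrite le_max lexx orbT.
Qed.

End translation_continuity.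

Section product_integrability.
Context d1 d2 (T1 : measurableType d1) (T2 : measurableType d2) (R : realType).
Variables (m1 : {sigma_finite_measure set T1 -> \bar R})
  (m2 : {sigma_finite_measure set T2 -> \bar R}).

Lemma L1_prod (F : T1 * T2 -> R) (G : T1 -> R) : measurable_fun setT F ->
  (forall x, L1 m2 (fun y => F (x, y))) -> L1 m1 G ->
  (forall x, \int[m2]_y `|F (x, y)| <= G x) -> L1 (m1 \x m2)%E F.
Proof.
move=> mF lF lG FG.
have mE : measurable_fun setT (EFin \o F) by exact/measurable_EFinP.
apply/(integrable12ltyP m1 m2 mE).
have [mG hG] := integrableP _ _ _ lG; apply: le_lt_trans hG.
have G0 x : 0 <= G x by apply: le_trans (FG x); exact: Rint_ge0.
apply: ge0_le_integral => //.
- by move=> x _; exact: integral_ge0.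
- have := measurable_fun_fubini_tonelli_F (m2 := m2) (abse \o (EFin \o F)).
  apply; last by move=> x; exact: abse_ge0.
  exact: measurableT_comp.
- exact: measurableT_comp.
- move=> x _; rewrite /= -(@RintE _ _ _ m2 (fun y => `|F (x, y)|)); last exact: L1_norm.
  by rewrite ger0_norm// lee_fin.
Qed.

End product_integrability.

Section density.
Context {R : realType} {n : nat}.
Local Notation mu := (lebesgue_rV R n).
Local Notation V := 'rV[R]_n.
Implicit Types (f u phi rho : V -> R) (x h : V).

Record mollifier (r : R) rho : Prop := Mollifier {
  mollifier_test : test_function rho;
  mollifier_ge0 : forall x, 0 <= rho x;
  mollifier_int : \int[mu]_x rho x = 1;
  mollifier_out : vanishes_outside r rho }.

Lemma mollifier_exists (r : R) : 0 < r -> exists rho, mollifier r rho.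
Proof.
move=> r0; pose b := r ^- 2; have b0 : 0 < b by rewrite invr_gt0 exprn_gt0.
pose p x : R := flat 0 (1 + - b * normsq x).
have pout : vanishes_outside r p.
  move=> x xr; rewrite /p flat_out// mulNr subr_le0 /b mulrC ler_pdivlMr ?exprn_gt0// mul1r.
  apply: le_trans (norm_le_normsq x); rewrite lerXn2r ?nnegrE// ltW//.
have tp : test_function p.
  by apply/test_functionP; split; [exact: smooth_flat|exists r].
have p0 x : 0 <= p x by exact: flat_ge0.
(* On the cube of radius s one has |x|^2 <= n s^2 <= r^2 / 2, so that p is at least exp(-2) there
   and its integral is positive. *)
pose s := r / (2 * n.+1%:R).
have s0 : 0 < s by rewrite divr_gt0// mulr_gt0.
have I0 : 0 < \int[mu]_x p x.
  apply: (@lt_le_trans _ _ (expR (- 2) * \int[mu]_x (\1_(@cube R n s) x : R))).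
    by rewrite Rint_cube_indic ?ltW// mulr_gt0 ?expR_gt0// exprn_gt0// mulr_gt0.
  rewrite -RintZ; last exact/L1_cube_indic/ltW.
  apply: Rint_le; [exact/L1Z/L1_cube_indic/ltW|exact: test_L1|] => x.
  rewrite indicE; case: (boolP (x \in _)) => [/set_mem/(cubeP x (ltW s0)) xs|_]; last by rewrite mulr0.
  rewrite mulr1 /p.
  have hb : b * normsq x <= 2^-1.
    rewrite /b mulrC ler_pdivrMr ?exprn_gt0//; apply: (le_trans (normsq_le_norm x)).
    apply: (@le_trans _ _ (n.+1%:R * s ^+ 2)).
      by apply: ler_pM; rewrite ?ler_nat// ?lerXn2r ?nnegrE// ltW.
    rewrite /s expr_div_n mulrA ler_pdivrMr ?exprn_gt0 ?mulr_gt0//.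
    rewrite exprMn mulrC.
    have := ler1n R n.+1; rewrite ltn0Sn; set m := n.+1%:R => m1.
    have r2 : 0 < r ^+ 2 by rewrite exprn_gt0.
    have : m <= m ^+ 2 by rewrite expr2 ler_peMl//; lra.
    nra.
  have t0 : 2^-1 <= 1 + - b * normsq x by rewrite mulNr; lra.
  rewrite /flat (lt_le_trans _ t0)// expr0 invr1 mul1r ler_expR lerN2.
  by rewrite -[leRHS]invrK lef_pV2// ?posrE ?invr_gt0//; lra.
exists (fun x => (\int[mu]_x p x)^-1 * p x); split.
- exact: testZ.
- by move=> x; rewrite mulr_ge0// invr_ge0 ltW.
- by rewrite RintZ ?mulVf ?gt_eqF//; exact: test_L1.
- by move=> x /pout ->; rewrite mulr0.
Qed.

Lemma vanishing_L2_L1 f (s : R) : 0 <= s -> vanishes_outside s f -> L2 mu f -> L1 mu f.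
Proof.
move=> s0 hf lf.
have l1 : L2 mu (fun x => \1_(@cube R n s) x : R).
  have l := L1_cube_indic n s0; split; first exact: L1_meas l.
  by apply: eq_L1 l => x; rewrite indicE; case: (_ \in _); rewrite ?expr1n ?expr0n.
apply: eq_L1 (L2M l1 lf) => x; rewrite indicE.
have [xs|xs] := lerP `|x| s; last by rewrite hf// mulr0.
by rewrite mem_set ?mul1r//; exact/cubeP.
Qed.

Lemma measurable_sub : measurable_fun setT (fun p : V * V => p.2 - p.1).
Proof.
apply: measurable_fun_rVP => i; under eq_fun do rewrite !mxE.
apply: measurable_funB.
  exact: (measurableT_comp (measurable_coord i) measurable_snd).
exact: (measurableT_comp (measurable_coord i) measurable_fst).
Qed.

(** Put eta = rho * f - f. As rho has integral 1, the squared norm Z of eta is the double integral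
    of eta(x) rho(h) (f(x-h) - f(x)). Fubini and Young's inequality in x give Z <= (Z + e) / 2,
    hence Z <= e. *)
Lemma conv_approx f (s e : R) : 0 <= s -> vanishes_outside s f -> L2 mu f -> 0 < e ->
  \forall k \near \oo, forall rho, mollifier k.+1%:R^-1 rho ->
  \int[mu]_x ((f x - convolve rho f x) ^+ 2) <= e.
Proof.
move=> s0 hf lf e0; have l1f := vanishing_L2_L1 s0 hf lf.
have [d d0 hd] := L2_translation_continuous lf e0.
near=> k => rho [tr r0 ir or].
have kd : k.+1%:R^-1 <= d.
  by rewrite -[leRHS]invrK lef_pV2 ?posrE ?invr_gt0//; near: k; exact: near_natS_ge.
have tc : test_function (convolve rho f).
  by apply: (conv_test (r := k.+1%:R^-1) (s := s)) => //; rewrite invr_gt0.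
pose eta x := convolve rho f x - f x.
have leta : L2 mu eta by apply: L2B => //; exact: test_L2.
have ltau h : L2 mu (fun x => f (x - h) - f x) by apply: L2B => //; exact: L2_translate.
pose F (p : V * V) := eta p.2 * (rho p.1 * (f (p.2 - p.1) - f p.2)).
have mf := L2_meas lf; have meta := L2_meas leta; have mr := test_meas tr.
have mF : measurable_fun setT F.
  apply: measurable_funM; first exact: (measurableT_comp meta measurable_snd).
  apply: measurable_funM; first exact: (measurableT_comp mr measurable_fst).
  apply: measurable_funB; first exact: (measurableT_comp mf measurable_sub).
  exact: (measurableT_comp mf measurable_snd).
have lF1 h : L1 mu (fun x => F (h, x)).
  rewrite /F/=; under eq_fun do rewrite mulrCA.
  by apply: L1Z; exact: L2M.
have lrf x : L1 mu (fun h => rho h * f (x - h)).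
  have := L1_reflect x (conv_L1 x tr l1f); apply: eq_L1 => h.
  by rewrite opprB addrC subrK.
have lrc x : L1 mu (fun h => rho h * f x).
  by under eq_fun do rewrite mulrC; apply: L1Z; exact: test_L1.
have lF2 x : L1 mu (fun h => F (h, x)).
  rewrite /F/=; apply: L1Z; under eq_fun do rewrite mulrBr.
  exact: L1B.
have young h : \int[mu]_x `|eta x * (f (x - h) - f x)| <=
    2^-1 * (\int[mu]_x (eta x ^+ 2) + \int[mu]_x ((f (x - h) - f x) ^+ 2)).
  have l2 : L1 mu (fun x => (f (x - h) - f x) ^+ 2) by exact: L2_sqr.
  have l2' : L1 mu (fun x => eta x ^+ 2) by exact: L2_sqr.
  rewrite -RintD// -RintZ; last exact: L1D.
  apply: Rint_le; [exact/L1_norm/L2M|exact/L1Z/L1D|] => x.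
  rewrite normrM -[X in _ * (X + _)]real_normK ?num_real// -[X in _ * (_ + X)]real_normK ?num_real//.
  by have := sqr_ge0 (`|eta x| - `|f (x - h) - f x|); nra.
set Z := \int[mu]_x (eta x ^+ 2) in young.
(* A bound for all h, not only small ones: it provides the integrability on the product that Fubini
   demands. *)
have [K K0 HK] : exists2 K, 0 <= K & forall h, \int[mu]_x `|eta x * (f (x - h) - f x)| <= K.
  have Z0 : 0 <= Z by apply: Rint_ge0 => x; exact: sqr_ge0.
  have f0 : 0 <= \int[mu]_x (f x ^+ 2) by apply: Rint_ge0 => x; exact: sqr_ge0.
  exists (2^-1 * (Z + 4 * \int[mu]_x (f x ^+ 2))); first by rewrite mulr_ge0// addr_ge0// mulr_ge0.
  move=> h; apply: (le_trans (young h)).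
  have := Rint_sqrD (L2_translate h lf) (L2N lf).
  have -> : \int[mu]_x (f (x - h) ^+ 2) = \int[mu]_x (f x ^+ 2).
    exact: (Rint_shift (- h) (L2_sqr lf)).
  rewrite [X in _ <= 2 * (_ + X)](eq_Rint _ (g := fun x => f x ^+ 2)); last by move=> x; rewrite sqrrN.
  lra.
have lF : L1 (mu \x mu)%E F.
  apply: (L1_prod (G := fun h => K * rho h)) => //; first exact/L1Z/test_L1.
  move=> h; rewrite /F/=.
  rewrite (eq_Rint _ (g := fun x => rho h * `|eta x * (f (x - h) - f x)|)); last first.
    by move=> x; rewrite mulrCA normrM ger0_norm.
  rewrite RintZ; last exact/L1_norm/L2M.
  by rewrite mulrC ler_wpM2r.
have ZE : Z = \int[mu]_x \int[mu]_h F (h, x).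
  apply: eq_Rint => x; rewrite /F/= RintZ; last first.
    by under eq_fun do rewrite mulrBr; exact: L1B.
  rewrite expr2; congr (_ * _); rewrite (eq_Rint _ (fun h => mulrBr _ _ _)) RintB//.
  rewrite -conv_reflect//; congr (_ - _).
  by rewrite (eq_Rint _ (fun h => mulrC _ _)) RintZ ?ir ?mulr1//; exact: test_L1.
have ZF : Z <= 2^-1 * (Z + e).
  rewrite {1}ZE -Rint_Fubini//.
  apply: (@le_trans _ _ (\int[mu]_h (2^-1 * (Z + e) * rho h))); last first.
    by rewrite RintZ ?ir ?mulr1//; exact: test_L1.
  apply: Rint_le.
  - have := integrable_fubini_F lF.
    by apply: eq_integrable => // h _; rewrite /= RintE.
  - by apply: L1Z; exact: test_L1.
  - move=> h; rewrite /F/= (eq_Rint _ (fun x => mulrCA _ _ _)) RintZ; last exact: L2M.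
    have [hk|hk] := lerP `|h| k.+1%:R^-1; last by rewrite or// mul0r mulr0.
    rewrite mulrC ler_wpM2r//; apply: (le_trans (ler_norm _)).
    apply: (le_trans (Rint_norm _)); first exact: L2M.
    apply: (le_trans (young h)); rewrite ler_wpM2l// lerD2l hd//.
    exact: le_trans hk kd.
rewrite (eq_Rint _ (g := fun x => eta x ^+ 2)); last by move=> x; rewrite -sqrrN opprB.
by rewrite -/Z; lra.
Unshelve. all: by end_near. Qed.

(** The gradient is carried as data: sums and dilations then have gradients given by formulas,
    whereas [wderiv] is an arbitrary choice. *)
Definition has_wgrad u (g : 'I_n -> V -> R) :=
  L2 mu u /\ forall i, L2 mu (g i) /\ weak_partial i u (g i).

Definition cutoff k x : R := expR 1 * flat 0 (1 + - k.+1%:R^-1 * normsq x).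

Lemma cutoff_test k : test_function (cutoff k).
Proof.
apply/test_functionP; split; first by apply: smoothZ; exact: smooth_flat.
exists k.+1%:R => // x kx; rewrite /cutoff flat_out ?mulr0// mulNr subr_le0.
rewrite mulrC ler_pdivlMr// mul1r.
apply: (@le_trans _ _ (`|x| ^+ 2)); last exact: norm_le_normsq.
rewrite expr2; apply: (@le_trans _ _ `|x|); first exact: ltW.
by rewrite ler_peMl// (le_trans _ (ltW kx))// ler1n.
Qed.

Lemma cutoff01 k x : 0 <= cutoff k x <= 1.
Proof.
rewrite /cutoff mulr_ge0 ?expR_ge0 ?flat_ge0//= /flat.
case: ifPn => [t0|]; last by rewrite mulr0.
rewrite expr0 invr1 mul1r -expRD -[leRHS]expR0 ler_expR subr_le0.
rewrite invf_ge1// mulNr gerDl oppr_le0 mulr_ge0 ?normsq_ge0//.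
Qed.

Lemma cutoff_cvg x : cutoff k x @[k --> \oo] --> (1 : R).
Proof.
have cf : {for 1, continuous (@flat R 0)}.
  by apply: differentiable_continuous; apply/derivable1_diffP; apply: ex_derive; exact: is_derive_flat.
have h : 1 + - k.+1%:R^-1 * normsq x @[k --> \oo] --> (1 : R).
  rewrite -[X in _ --> X](addr0 1) -[X in _ --> _ + X](mul0r (normsq x)).
  apply: cvgD; first exact: cvg_cst.
  apply: cvgM; last exact: cvg_cst.
  by rewrite -[X in _ --> X]oppr0; apply: cvgN; exact: cvg_harmonic.
have -> : 1 = expR 1 * flat 0 1 :> R.
  by rewrite /flat ltr01 expr0 !invr1 mul1r -expRD subrr expR0.
by apply: cvgM; [exact: cvg_cst|exact: (continuous_cvg _ cf h)].
Qed.

(** With a = 1/(k+1), the support satisfies a x_i^2 <= 1, so (2 a x_i)^2 <= 4 a; the remaining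
    factor e flat 2 is at most 8, and 64 * 4 = 16^2. *)
Lemma partial_cutoff_sqr k i x : partial i (cutoff k) x ^+ 2 <= 16 ^+ 2 * k.+1%:R^-1.
Proof.
set a := k.+1%:R^-1; have a0 : 0 < a by rewrite invr_gt0.
have sn : smooth (fun y : V => 1 + - a * normsq y).
  by apply: smoothD; [exact: smooth_cst|apply: smoothZ; exact: smooth_normsq].
have dn := smooth_diff sn x.
have dfl := is_derive_flat 0 (1 + - a * normsq x).
have dsq : differentiable (@normsq R n) x by apply: smooth_diff; exact: smooth_normsq.
have -> : partial i (cutoff k) x = expR 1 * (flat 2 (1 + - a * normsq x) * (- a * (2 * x ord0 i))).
  rewrite /cutoff partialZ; last by apply: smooth_diff; exact: smooth_flat.
  rewrite (partial_comp1 i dn dfl) partialD; last 2 first.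
  - exact: differentiable_cst.
  - by apply: smooth_diff; apply: smoothZ; exact: smooth_normsq.
  by rewrite partial_cst partialZ// partial_normsq oppr0 mul0r !add0r.
have xs := coord_le_normsq x i; have s0 := normsq_ge0 x.
have [t0|t0] := lerP (1 + - a * normsq x) 0.
  by rewrite flat_out// mul0r mulr0 expr0n mulr_ge0// ltW.
have as1 : a * normsq x <= 1 by move: t0; rewrite mulNr; lra.
have f2 : flat 2 (1 + - a * normsq x) <= 2 by exact: flat_le_cst.
have f0 := flat_ge0 2 (1 + - a * normsq x).
have e0 := expR_ge0 (1 : R); have e4 := @expR1_le4 R.
rewrite mulrA exprMn.
have h1 : (expR 1 * flat 2 (1 + - a * normsq x)) ^+ 2 <= 64.
  have h : expR 1 * flat 2 (1 + - a * normsq x) <= 4 * 2 by exact: ler_pM.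
  apply: (@le_trans _ _ ((4 * 2) ^+ 2)); last by lra.
  by rewrite lerXn2r ?nnegrE ?mulr_ge0.
have h2 : (- a * (2 * x ord0 i)) ^+ 2 <= 4 * a.
  rewrite (_ : _ ^+ 2 = 4 * a * (a * x ord0 i ^+ 2)); last by ring.
  rewrite ler_piMr ?mulr_ge0 ?(ltW a0)//; apply: le_trans as1.
  by rewrite ler_wpM2l// ltW.
apply: (@le_trans _ _ (64 * (4 * a))); last by lra.
by apply: ler_pM => //; exact: sqr_ge0.
Qed.

Lemma weak_partialM i u g chi : L2 mu u -> L2 mu g -> test_function chi -> weak_partial i u g ->
  weak_partial i (fun x => chi x * u x) (fun x => chi x * g x + partial i chi x * u x).
Proof.
move=> lu lg tc wu phi tp.
have sc := test_smooth tc; have sp := test_smooth tp.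
have tcp : test_function (fun x => chi x * phi x) by exact: testM.
have tpi := test_partial i tp; have tci := test_partial i tc.
have := wu _ tcp.
have E x : u x * partial i (fun x => chi x * phi x) x =
    u x * (chi x * partial i phi x) + u x * (phi x * partial i chi x).
  by rewrite partialM ?mulrDr//; exact: smooth_diff.
have l1 : L1 mu (fun x => u x * (chi x * partial i phi x)).
  by apply: L2M => //; apply: test_L2; exact: testM.
have l2 : L1 mu (fun x => u x * (phi x * partial i chi x)).
  by apply: L2M => //; apply: test_L2; exact: testM.
have l3 : L1 mu (fun x => g x * (chi x * phi x)) by apply: L2M => //; exact: test_L2.
rewrite (eq_Rint _ E) RintD// => h.
transitivity (\int[mu]_x (u x * (chi x * partial i phi x))).
  by apply: eq_Rint => x; ring.
rewrite [in RHS](eq_Rint _ (g := fun x => g x * (chi x * phi x) + u x * (phi x * partial i chi x))).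
  by rewrite RintD// opprD -h addrK.
by move=> x; ring.
Qed.

(** Cut off first, so that u and its gradient become integrable with bounded support, then mollify.
    The classical gradient of the result is the mollified weak gradient, so one approximation lemma
    serves both. *)
Theorem test_dense u g e : has_wgrad u g -> 0 < e ->
  exists phi, [/\ test_function phi, \int[mu]_x ((u x - phi x) ^+ 2) <= e &
    forall i, \int[mu]_x ((g i x - partial i phi x) ^+ 2) <= e].
Proof.
move=> [lu hg] e0.
have lg i : L2 mu (g i) by have [] := hg i.
have e8 : 0 < e / 16 by rewrite divr_gt0.
have cut f : L2 mu f ->
    \forall k \near \oo, \int[mu]_x ((f x - cutoff k x * f x) ^+ 2) <= e / 16.
  move=> lf; have mf := L2_meas lf.
  have cv : \int[mu]_x ((f x - cutoff k x * f x) ^+ 2) @[k --> \oo] --> (0 : R).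
    have E0 : \int[mu]_x (0 : R) = 0 by rewrite /Rintegral integral0.
    rewrite -E0; apply: (dominated_Rint (g := fun x => f x ^+ 2)) => //.
    - move=> k; apply: measurable_funX; apply: measurable_funB => //.
      by apply: measurable_funM => //; apply: test_meas; exact: cutoff_test.
    - exact: L2_sqr.
    - apply: aeW => x.
      have h : (fun k => f x - cutoff k x * f x) @ \oo --> (0 : R).
        rewrite -[X in _ --> X](subrr (f x)) -[X in _ --> _ - X](mul1r (f x)).
        apply: cvgB; first exact: cvg_cst.
        by apply: cvgM; [exact: cutoff_cvg|exact: cvg_cst].
      by rewrite -[X in _ --> X](mulr0 0); exact: (cvgM h h).
    - move=> k x; rewrite ger0_norm ?sqr_ge0//.
      have /andP[c0 c1] := cutoff01 k x.
      rewrite (_ : _ ^+ 2 = (1 - cutoff k x) ^+ 2 * f x ^+ 2); last by ring.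
      by rewrite ler_piMl ?sqr_ge0// expr_le1//; lra.
  apply: filterS (cvgr0_norm_le _ cv _ e8) => k; exact: le_trans (ler_norm _).
have cutd i : \forall k \near \oo, \int[mu]_x ((partial i (cutoff k) x * u x) ^+ 2) <= e / 16.
  set I := \int[mu]_x (u x ^+ 2).
  have I0 : 0 <= I by apply: Rint_ge0 => x; exact: sqr_ge0.
  near=> k.
  apply: (@le_trans _ _ (16 ^+ 2 * k.+1%:R^-1 * I)).
    rewrite -RintZ; last exact: L2_sqr.
    have tck := test_partial i (cutoff_test k).
    have [M _ HM] := test_bounded tck.
    apply: Rint_le.
    - by apply: L2_sqr; apply: (L2_Mbounded lu _ HM); exact: test_meas.
    - exact/L1Z/L2_sqr.
    - by move=> x; rewrite exprMn; apply: ler_wpM2r; [exact: sqr_ge0|exact: partial_cutoff_sqr].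
  have hk : 16 ^+ 2 * I / (e / 16) <= k.+1%:R by near: k; exact: near_natS_ge.
  by rewrite mulrAC ler_pdivrMr// [leRHS]mulrC -ler_pdivrMr.
have [k [ku kg kd]] : exists k, [/\ \int[mu]_x ((u x - cutoff k x * u x) ^+ 2) <= e / 16,
   forall i, \int[mu]_x ((g i x - cutoff k x * g i x) ^+ 2) <= e / 16 &
   forall i, \int[mu]_x ((partial i (cutoff k) x * u x) ^+ 2) <= e / 16].
  have [k _ /(_ _ (leqnn k)) [h1 [h2 h3]]] : \forall k \near \oo,
     \int[mu]_x ((u x - cutoff k x * u x) ^+ 2) <= e / 16 /\
     (forall i, \int[mu]_x ((g i x - cutoff k x * g i x) ^+ 2) <= e / 16) /\
     (forall i, \int[mu]_x ((partial i (cutoff k) x * u x) ^+ 2) <= e / 16).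
    near=> k; split; first by near: k; exact: cut.
    split; near: k; apply: filter_forall => i; first exact: cut.
    exact: cutd.
  by exists k.
have tck := cutoff_test k.
have /test_functionP[_ [s s0 hs]] := tck.
have L2cut f chi : test_function chi -> L2 mu f -> L2 mu (fun x => chi x * f x).
  move=> tchi lf; have [M _ HM] := test_bounded tchi.
  by apply: (L2_Mbounded lf _ HM); exact: test_meas.
pose psi x := cutoff k x * u x.
pose G i x := cutoff k x * g i x + partial i (cutoff k) x * u x.
have lpsi : L2 mu psi by exact: L2cut.
have lG i : L2 mu (G i).
  by apply: L2D; apply: L2cut => //; exact: test_partial.
have psi_out : vanishes_outside s psi by move=> x xs; rewrite /psi hs// mul0r.
have G_out i : vanishes_outside s (G i).
  by move=> x xs; rewrite /G hs// (vanishes_partial i hs xs); ring.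
have [m hm] : exists m, forall rho, mollifier m.+1%:R^-1 rho ->
    \int[mu]_x ((psi x - convolve rho psi x) ^+ 2) <= e / 16 /\
    forall i, \int[mu]_x ((G i x - convolve rho (G i) x) ^+ 2) <= e / 16.
  have [m _ /(_ _ (leqnn m)) [h1 h2]] : \forall m \near \oo,
      (forall rho, mollifier m.+1%:R^-1 rho ->
        \int[mu]_x ((psi x - convolve rho psi x) ^+ 2) <= e / 16) /\
      (forall i rho, mollifier m.+1%:R^-1 rho ->
        \int[mu]_x ((G i x - convolve rho (G i) x) ^+ 2) <= e / 16).
    near=> m; split.
      by near: m; exact: (conv_approx (ltW s0) psi_out lpsi e8).
    near: m; apply: filter_forall => i.
    exact: (conv_approx (ltW s0) (G_out i) (lG i) e8).
  by exists m => rho hrho; split; [exact: h1|move=> i; exact: h2].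
have m0 : 0 < m.+1%:R^-1 :> R by rewrite invr_gt0.
have [rho hrho] := mollifier_exists m0; have [h1 h2] := hm rho hrho.
have [tr _ _ ro] := hrho.
have l1psi := vanishing_L2_L1 (ltW s0) psi_out lpsi.
have l1G i := vanishing_L2_L1 (ltW s0) (G_out i) (lG i).
have tphi : test_function (convolve rho psi).
  exact: (conv_test m0 (ltW s0) tr l1psi ro psi_out).
exists (convolve rho psi); split => //.
  have := Rint_sqrD (L2B lu lpsi) (L2B lpsi (test_L2 tphi)).
  rewrite (eq_Rint _ (g := fun x => (u x - convolve rho psi x) ^+ 2)); last first.
    by move=> x; congr (_ ^+ 2); ring.
  move: ku h1; rewrite -/psi; lra.
move=> i; have pE x : partial i (convolve rho psi) x = convolve rho (G i) x.
  apply: conv_weak_partial => //.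
  by apply: weak_partialM => //; have [] := hg i.
have lcG : L2 mu (convolve rho (G i)).
  by apply: test_L2; exact: (conv_test m0 (ltW s0) tr (l1G i) ro (G_out i)).
have lgc : L2 mu (fun x => g i x - cutoff k x * g i x) by apply: L2B => //; exact: L2cut.
have luc : L2 mu (fun x => partial i (cutoff k) x * u x).
  by apply: L2cut => //; exact: test_partial.
have := Rint_sqrD lgc (L2N luc).
have E1 : \int[mu]_x ((- (partial i (cutoff k) x * u x)) ^+ 2) =
    \int[mu]_x ((partial i (cutoff k) x * u x) ^+ 2).
  by apply: eq_Rint => x; rewrite sqrrN.
rewrite E1; have := Rint_sqrD (L2B (lg i) (lG i)) (L2B (lG i) lcG).
rewrite (eq_Rint _ (g := fun x => (g i x - partial i (convolve rho psi) x) ^+ 2)); last first.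
  by move=> x; rewrite pE; congr (_ ^+ 2); ring.
rewrite [X in _ <= 2 * (X + _) -> _](eq_Rint _
  (g := fun x => (g i x - cutoff k x * g i x + - (partial i (cutoff k) x * u x)) ^+ 2)); last first.
  by move=> x; congr (_ ^+ 2); rewrite /G; ring.
have := kg i; have := kd i; have := h2 i; lra.
Unshelve. all: by end_near. Qed.

End density.

(** * Sobolev's inequality *)

Section generalised_hoelder.
Context d (T : measurableType d) (R : realType).
Variable mu : {measure set T -> \bar R}.

Lemma AGM_ord n (E : 'I_n.+1 -> R) : (forall j, 0 <= E j) ->
  \prod_j E j <= ((\sum_j E j) / n.+1%:R) ^+ n.+1.
Proof.
move=> E0; have [] := @leif_AGM R 'I_n.+1 predT E (fun i _ => E0 i).
by rewrite card_ord.
Qed.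

(* Hoelder's inequality with equal exponents, raised to the power n + 1 so that
   no fractional power appears; the proof is the arithmetic-geometric inequality
   applied to the K j divided by their integrals. *)
Lemma hoelder_prod n (K : 'I_n.+1 -> T -> R) (H : T -> R) :
  measurable_fun setT H -> (forall x, 0 <= H x) ->
  (forall j, L1 mu (K j)) -> (forall j x, 0 <= K j x) ->
  (forall x, H x ^+ n.+1 <= \prod_j K j x) ->
  L1 mu H /\ (\int[mu]_x H x) ^+ n.+1 <= \prod_j \int[mu]_x K j x.
Proof.
move=> mH H0 lK K0 HK.
have le_root x y : 0 <= x -> 0 <= y -> x ^+ n.+1 <= y ^+ n.+1 -> x <= y :> R.
  by move=> x0 y0; rewrite ler_pXn2r.
have lH : L1 mu H.
  apply: (L1_dom mH _ (L1_sum (index_enum 'I_n.+1) lK)) => x.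
  rewrite ger0_norm//; apply: le_root => //; first exact: sumr_ge0.
  apply: le_trans (HK x) _; set s := \sum_i _.
  rewrite (_ : s ^+ n.+1 = \prod_(j < n.+1) s); last by rewrite prodr_const card_ord.
  apply: ler_prod => j _; rewrite K0/= /s (bigD1 j)//= lerDl.
  exact: sumr_ge0.
split => //; pose k j := \int[mu]_x K j x.
have k0 j : 0 <= k j by exact: Rint_ge0.
(* The normalisation below divides by the k j. If one of them is 0, then H vanishes almost
   everywhere. *)
have [/existsP[j /eqP kj]|] := boolP [exists j, k j == 0].
  have Kj := Rint_eq0_ae (lK j) (K0 j) kj.
  have -> : \int[mu]_x H x = 0.
    transitivity (\int[mu]_x (0 : R)); last by rewrite /Rintegral integral0.
    apply: ae_eq_Rint => //.
    apply: filterS Kj => x Kx; apply/eqP; have /eqP : H x ^+ n.+1 == 0; last by move/eqP; rewrite expf_eq0.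
    by rewrite eq_le exprn_ge0// andbT (le_trans (HK x))// (bigD1 j)//= Kx mul0r.
  by rewrite expr0n/=; apply: prodr_ge0 => i _; exact: k0.
rewrite negb_exists => /forallP kn0.
have kp j : 0 < k j by rewrite lt_def kn0 k0.
pose P := \prod_j k j; have P0 : 0 < P by apply: prodr_gt0.
pose rho := P `^ (n.+1%:R^-1).
have rhoP : rho ^+ n.+1 = P.
  by rewrite -powR_mulrn ?powR_ge0// -powRrM mulVf ?pnatr_eq0// powRr1// ltW.
have rho0 : 0 <= rho by exact: powR_ge0.
pose S x := rho / n.+1%:R * \sum_j (k j)^-1 * K j x.
have lS : L1 mu S by apply: L1Z; apply: L1_sum => j; exact: L1Z.
have SK0 x : 0 <= \sum_j (k j)^-1 * K j x.
  by apply: sumr_ge0 => j _; rewrite mulr_ge0// invr_ge0.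
have HS x : H x <= S x.
  apply: le_root => //; first by rewrite mulr_ge0// divr_ge0.
  apply: le_trans (HK x) _; rewrite /S -mulrA [_^-1 * _]mulrC exprMn rhoP.
  rewrite (_ : \prod_j _ = P * \prod_j ((k j)^-1 * K j x)); last first.
    by rewrite -big_split/=; apply: eq_bigr => j _; rewrite mulVKf// gt_eqF.
  rewrite ler_pM2l//; apply: AGM_ord => j.
  by rewrite mulr_ge0// invr_ge0.
rewrite -[leRHS]/P -rhoP lerXn2r ?nnegrE//; first exact: Rint_ge0.
apply: le_trans (Rint_le lH lS HS) _.
rewrite RintZ; last by apply: L1_sum => j; exact: L1Z.
rewrite Rint_sum; last by move=> j; exact: L1Z.
rewrite (eq_bigr (fun=> 1)) => [|j _]; last first.
  by rewrite RintZ// mulVf// gt_eqF.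
by rewrite sumr_const card_ord divfK ?pnatr_eq0.
Qed.

End generalised_hoelder.

Section product_slices.
Variables (R : realType) (n : nat).
Local Notation muS := (lebesgue_rV R n.+1).
Local Notation mu := (lebesgue_rV R n).
Local Notation leb := (@lebesgue_measure R).
Variable F : 'rV[R]_n.+1 -> R.
Hypothesis mF : measurable_fun setT F.
Hypothesis F0 : forall x, 0 <= F x.

Let mFc : measurable_fun setT (EFin \o F \o @rV_cons R n).
Proof. by apply: measurableT_comp (@measurable_rV_cons R n); exact/measurable_EFinP. Qed.

Lemma measurable_Rint_rVS : (forall t, L1 mu (fun y => F (rV_cons (t, y)))) ->
  measurable_fun setT (fun t => \int[mu]_y F (rV_cons (t, y))).
Proof.
move=> lF; apply/measurable_EFinP.
have := @measurable_fun_fubini_tonelli_F _ _ _ _ R mu _ mFc (fun p => F0 (rV_cons p)).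
rewrite (_ : fubini_F _ _ = EFin \o (fun t => \int[mu]_y F (rV_cons (t, y))))//.
by apply/funext => t /=; rewrite /fubini_F/= -RintE.
Qed.

Lemma Rint_rVS : (forall t, L1 mu (fun y => F (rV_cons (t, y)))) ->
  (L1 leb (fun t => \int[mu]_y F (rV_cons (t, y))) <-> L1 muS F) /\
  \int[muS]_x F x = \int[leb]_t \int[mu]_y F (rV_cons (t, y)).
Proof.
move=> lF.
have e : (\int[muS]_x (F x)%:E = \int[leb]_t (\int[mu]_y F (rV_cons (t, y)))%:E)%E.
  rewrite ge0_integral_rVS//; last by exact/measurable_EFinP.
  by apply: eq_integral => t _; rewrite RintE.
have m1 := measurable_Rint_rVS lF.
split; last by rewrite /Rintegral e.
split=> h.
  by apply: L1_ge0P => //; rewrite e -RintE// ltry.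
apply: L1_ge0P => //; first by move=> t; exact: Rint_ge0.
by rewrite -e -RintE// ltry.
Qed.

Lemma Rint_rVS_swap : (forall y, L1 leb (fun t => F (rV_cons (t, y)))) -> L1 muS F ->
  L1 mu (fun y => \int[leb]_t F (rV_cons (t, y))) /\
  \int[mu]_y \int[leb]_t F (rV_cons (t, y)) = \int[muS]_x F x.
Proof.
move=> lF lF'.
have e : (\int[muS]_x (F x)%:E = \int[mu]_y (\int[leb]_t F (rV_cons (t, y)))%:E)%E.
  rewrite ge0_integral_rVS//; last by exact/measurable_EFinP.
  rewrite (@fubini_tonelli _ _ _ _ _ leb mu _ mFc (fun p => F0 (rV_cons p))).
  by apply: eq_integral => t _; rewrite RintE.
have m1 : measurable_fun setT (fun y => \int[leb]_t F (rV_cons (t, y))).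
  apply/measurable_EFinP.
  have := @measurable_fun_fubini_tonelli_G _ _ _ _ R leb _ mFc (fun p => F0 (rV_cons p)).
  rewrite (_ : fubini_G _ _ = EFin \o (fun y => \int[leb]_t F (rV_cons (t, y))))//.
  by apply/funext => y /=; rewrite /fubini_G/= -RintE.
split; last by rewrite /Rintegral e.
apply: L1_ge0P => //; first by move=> t; exact: Rint_ge0.
by rewrite -e -RintE// ltry.
Qed.

End product_slices.

(** * A Loomis-Whitney inequality for line integrals *)

Section loomis_whitney.
Variable R : realType.
Local Notation leb := (@lebesgue_measure R).

Definition upd n (x : 'rV[R]_n) (i : 'I_n) (r : R) : 'rV[R]_n :=
  \row_j if j == i then r else x ord0 j.

Lemma upd_cons0 n (y : 'rV[R]_n) t r : upd (rV_cons (t, y)) ord0 r = rV_cons (r, y).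
Proof.
apply/rowP => j; rewrite !mxE.
by have [k ->|->] := unliftP ord0 j; rewrite ?liftK ?unlift_none.
Qed.

Lemma upd_consS n (y : 'rV[R]_n) t i r :
  upd (rV_cons (t, y)) (lift ord0 i) r = rV_cons (t, upd y i r).
Proof.
apply/rowP => j; rewrite !mxE.
have [k ->|->] := unliftP ord0 j; rewrite ?liftK ?unlift_none//=.
by rewrite (inj_eq lift_inj) mxE.
Qed.

Lemma upd_rV1 (y : 'rV[R]_1) (r : R) z : upd y ord0 r = rV_cons (r, z).
Proof. by rewrite -(upd_cons0 z (y ord0 ord0)); apply/rowP => j; rewrite !mxE !ord1. Qed.

Lemma measurable_upd n (x : 'rV[R]_n) i : measurable_fun setT (upd x i).
Proof.
apply: measurable_fun_rVP => j; under eq_fun do rewrite mxE.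
by case: (j == i); [exact: measurable_id|exact: measurable_cst].
Qed.

Lemma norm_upd n (x : 'rV[R]_n) i r : `|r| <= `|upd x i r|.
Proof. by have := coord_le_norm (upd x i r) i; rewrite mxE eqxx. Qed.

(** For these functions every slice and every line is integrable, not merely almost every one, so
    the slicing arguments are free of exceptional sets. *)
Definition bounded_supp n (F : 'rV[R]_n -> R) :=
  [/\ measurable_fun setT F, forall x, 0 <= F x &
   exists r, exists2 M, 0 <= r & vanishes_outside r F /\ forall x, F x <= M].

Lemma bounded_supp_L1 n (F : 'rV[R]_n -> R) : bounded_supp F -> L1 (lebesgue_rV R n) F.
Proof.
move=> [mF F0 [r [M r0 [hr hM]]]]; apply: (vanishing_L1 r0 mF hr (M := M)) => x.
by rewrite ger0_norm.
Qed.

Lemma bounded_supp_slice n (F : 'rV[R]_n.+1 -> R) t : bounded_supp F ->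
  bounded_supp (fun y => F (rV_cons (t, y))).
Proof.
move=> [mF F0 [r [M r0 [hr hM]]]]; split => //.
  exact: measurableT_comp mF (measurable_rV_cons2 t).
exists r, M => //; split => // y ry; apply: hr; apply: lt_le_trans ry _.
apply/cubeP => // i; rewrite /= in_itv/= -ler_norml -(rV_consS (t, y)).
exact: coord_le_norm.
Qed.

Lemma bounded_supp_line n (F : 'rV[R]_n -> R) x i : bounded_supp F ->
  L1 leb (fun r => F (upd x i r)).
Proof.
move=> [mF F0 [r [M r0 [hr hM]]]].
have e : lebesgue_measure `[- r, r]%classic = (2 * r)%:E.
  rewrite lebesgue_measure_itv/= lte_fin.
  case: ifPn => h; first by rewrite -EFinB; congr EFin; ring.
  by congr EFin; lra.
have l : L1 leb (fun t => M * (\1_(`[- r, r]%classic) t : R)).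
  by apply: L1Z; exact: (L1_indic _ e).
apply: L1_dom l; first exact: measurableT_comp mF (measurable_upd x i).
move=> t; rewrite ger0_norm// indicE.
have [tr|tr] := lerP `|t| r.
  by rewrite mem_set ?mulr1//= in_itv/= -ler_norml.
rewrite hr ?mulr_ge0//; last exact: lt_le_trans tr (norm_upd _ _ _).
by apply: le_trans (hM 0).
Qed.

Definition line_int n (F : 'rV[R]_n -> R) i x := \int[leb]_r F (upd x i r).

Lemma line_int_ge0 n (F : 'rV[R]_n -> R) i x : bounded_supp F -> 0 <= line_int F i x.
Proof. by move=> [_ F0 _]; exact: Rint_ge0. Qed.

Lemma measurable_line_int n (F : 'rV[R]_n -> R) i : bounded_supp F ->
  measurable_fun setT (line_int F i).
Proof.
move=> hF; have [mF F0 _] := hF.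
have mu2 : measurable_fun setT (fun p : 'rV[R]_n * measurableTypeR R => upd p.1 i p.2).
  apply: measurable_fun_rVP => j; under eq_fun do rewrite mxE.
  case: (j == i); first exact: measurable_snd.
  exact: (measurableT_comp (measurable_coord j) measurable_fst).
have mFu : measurable_fun setT
    (fun p : 'rV[R]_n * measurableTypeR R => (F (upd p.1 i p.2))%:E).
  by apply/measurable_EFinP; exact: (measurableT_comp mF mu2).
have h := @measurable_fun_fubini_tonelli_F _ _ _ _ R leb _ mFu (fun p => F0 _).
apply/measurable_EFinP; move: h.
rewrite (_ : fubini_F _ _ = EFin \o line_int F i)//.
by apply/funext => x /=; rewrite /fubini_F/= -RintE//; exact: bounded_supp_line.
Qed.

Lemma line_int_rV1 (F : 'rV[R]_1 -> R) x : bounded_supp F ->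
  line_int F ord0 x = \int[lebesgue_rV R 1]_y F y.
Proof.
move=> [mF F0 _]; rewrite /line_int /Rintegral; congr fine.
rewrite ge0_integral_rVS//; last by exact/measurable_EFinP.
apply: eq_integral => r _ /=.
rewrite integral_dirac//= ?diracT ?mul1e; last first.
  by apply/measurable_EFinP; exact: (measurableT_comp mF (measurable_rV_cons2 r)).
by rewrite (upd_rV1 x r 0).
Qed.

Lemma Rint_first n (F : 'rV[R]_n.+1 -> R) : bounded_supp F ->
  L1 (lebesgue_rV R n) (fun y => \int[leb]_r F (rV_cons (r, y))) /\
  \int[lebesgue_rV R n]_y \int[leb]_r F (rV_cons (r, y)) = \int[lebesgue_rV R n.+1]_x F x.
Proof.
move=> hF; have [mF F0 _] := hF; apply: Rint_rVS_swap => // [y|]; last exact: bounded_supp_L1.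
by under eq_fun do rewrite -(upd_cons0 y 0); exact: bounded_supp_line.
Qed.

(** Hoelder's inequality in the first coordinate t: the exponent n + 1 is the number of functions
    whose slice integrals depend on t. *)
Lemma loomis_whitney_slices n (F : 'I_n.+2 -> 'rV[R]_n.+2 -> R) (H : 'rV[R]_n.+2 -> R) :
  (forall i, bounded_supp (F i)) -> measurable_fun setT H -> (forall x, 0 <= H x) ->
  (forall t, let h := fun y => H (rV_cons (t, y)) in
   L1 (lebesgue_rV R n.+1) h /\ (\int[lebesgue_rV R n.+1]_y h y) ^+ n.+1 <=
    (\int[lebesgue_rV R n.+2]_x F ord0 x) *
    \prod_(i < n.+1) \int[lebesgue_rV R n.+1]_y F (lift ord0 i) (rV_cons (t, y))) ->
  L1 (lebesgue_rV R n.+2) H /\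
  (\int[lebesgue_rV R n.+2]_x H x) ^+ n.+1 <= \prod_i \int[lebesgue_rV R n.+2]_x F i x.
Proof.
move=> hF mH H0 hh.
pose K (i : 'I_n.+1) t := \int[lebesgue_rV R n.+1]_y F (lift ord0 i) (rV_cons (t, y)).
have hK i : L1 leb (K i) /\ \int[lebesgue_rV R n.+2]_x F (lift ord0 i) x = \int[leb]_t K i t.
  have [mF F0 _] := hF (lift ord0 i).
  have [e1 e2] := Rint_rVS mF F0 (fun t => bounded_supp_L1 (bounded_supp_slice t (hF _))).
  by split => //; apply/e1; exact: bounded_supp_L1.
have [e1 e2] := Rint_rVS mH H0 (fun t => (hh t).1).
have m1 : measurable_fun setT (fun t => \int[lebesgue_rV R n.+1]_y H (rV_cons (t, y))).
  exact: (measurable_Rint_rVS mH H0 (fun t => (hh t).1)).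
set A := \int[lebesgue_rV R n.+2]_x F ord0 x in hh *.
have A0 : 0 <= A by apply: Rint_ge0; have [] := hF ord0.
(* The constant integral of the first function is attached to one of the n + 1 factors. *)
pose c (i : 'I_n.+1) := if i == ord0 then A else 1.
have c0 i : 0 <= c i by rewrite /c; case: ifP.
have cA : \prod_i c i = A.
  by rewrite big_ord_recl/= {1}/c eqxx big1 ?mulr1.
have K0 i t : 0 <= K i t.
  by apply: Rint_ge0 => y; have [] := hF (lift ord0 i).
have [] := @hoelder_prod _ _ _ leb n (fun i t => c i * K i t) _ m1.
- by move=> t; apply: Rint_ge0 => y; exact: H0.
- by move=> i; apply: L1Z; have [] := hK i.
- by move=> i t; exact: mulr_ge0.
- by move=> t; rewrite big_split/= cA; have [] := hh t.
move=> l1 h1; split; first exact/e1.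
rewrite e2; apply: le_trans h1 _; rewrite [leRHS]big_ord_recl.
rewrite (eq_bigr (fun i => c i * \int[leb]_t K i t)) => [|i _]; last first.
  by rewrite RintZ//; have [] := hK i.
rewrite big_split/= cA ler_wpM2l//.
by apply: ler_prod => i _; rewrite (hK i).2 lexx andbT Rint_ge0.
Qed.

Lemma prod_line_int_cons n (F : 'I_n.+1 -> 'rV[R]_n.+1 -> R) t y :
  \prod_i line_int (F i) i (rV_cons (t, y)) = (\int[leb]_r F ord0 (rV_cons (r, y))) *
    \prod_i line_int (fun z => F (lift ord0 i) (rV_cons (t, z))) i y.
Proof.
rewrite big_ord_recl /line_int; congr (_ * _).
  by apply: eq_Rint => r; rewrite upd_cons0.
by apply: eq_bigr => i _; apply: eq_Rint => r; rewrite upd_consS.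
Qed.

(** On a slice the first line integral G does not depend on t, and its integral over the slice is
    that of the first function. Hoelder's inequality splits it from the product of the other line
    integrals, which are line integrals within the slice. *)
Theorem loomis_whitney n (F : 'I_n.+2 -> 'rV[R]_n.+2 -> R) (H : 'rV[R]_n.+2 -> R) :
  (forall i, bounded_supp (F i)) -> measurable_fun setT H -> (forall x, 0 <= H x) ->
  (forall x, H x ^+ n.+1 <= \prod_i line_int (F i) i x) ->
  L1 (lebesgue_rV R n.+2) H /\
  (\int[lebesgue_rV R n.+2]_x H x) ^+ n.+1 <= \prod_i \int[lebesgue_rV R n.+2]_x F i x.
Proof.
elim: n F H => [|n IH] F H hF mH H0 HF; apply: loomis_whitney_slices => // t h.
all: have mh : measurable_fun setT h by exact: measurableT_comp mH (measurable_rV_cons2 t).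
all: have h0 y : 0 <= h y by exact: H0.
all: pose G y := \int[leb]_r F ord0 (rV_cons (r, y)).
all: have [lG eG] := Rint_first (hF ord0).
all: have G0 y : 0 <= G y by apply: Rint_ge0 => r; have [] := hF ord0.
all: pose F' i y := F (lift ord0 i) (rV_cons (t, y)).
all: have hF' i : bounded_supp (F' i) by exact: bounded_supp_slice.
all: have hG y := HF (rV_cons (t, y)); have eG' y := prod_line_int_cons F t y.
  have [|||] := @hoelder_prod _ _ _ (lebesgue_rV R 1) 0
    (fun=> fun y => (\int[lebesgue_rV R 1]_z F' ord0 z) * G y) h mh h0.
  - by move=> _; exact: L1Z.
  - by move=> _ y; rewrite mulr_ge0// Rint_ge0//; have [] := hF' ord0.
  - move=> y; apply: le_trans (hG y) _; rewrite eG' !big_ord1 (line_int_rV1 _ (hF' ord0)) mulrC lexx//.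
  by move=> l1 h1; split => //; move: h1; rewrite !big_ord1 RintZ// eG [leRHS]mulrC.
(* The induction hypothesis bounds the integral of the (n + 1)-st root of P. *)
pose P y := \prod_i line_int (F' i) i y.
have P0 y : 0 <= P y by apply: prodr_ge0 => i _; exact: line_int_ge0.
pose g y := P y `^ (n.+1%:R^-1).
have g0 y : 0 <= g y by exact: powR_ge0.
have gP y : g y ^+ n.+1 = P y.
  by rewrite -powR_mulrn// -powRrM mulVf ?pnatr_eq0// powRr1.
have mg : measurable_fun setT g.
  apply: (measurableT_comp (measurable_powR _)).
  by apply: measurable_prod => i _; exact: measurable_line_int.
have [|lg hg] := IH F' g hF' mg g0; first by move=> y; rewrite gP.
have [|||] := @hoelder_prod _ _ _ (lebesgue_rV R n.+2) n.+1
  (fun i => if i == ord0 then G else g) h mh h0.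
- by move=> i; case: ifP.
- by move=> i y; case: ifP.
- move=> y; apply: le_trans (hG y) _; rewrite eG' [leRHS]big_ord_recl/= prodr_const card_ord.
  by rewrite gP.
move=> l1 h1; split => //; apply: le_trans h1 _; rewrite [leLHS]big_ord_recl/= eG.
rewrite prodr_const card_ord; apply: ler_wpM2l => //.
by rewrite -eG Rint_ge0.
Qed.

End loomis_whitney.

Section fundamental_theorem.
Variable R : realType.
Local Notation leb := (@lebesgue_measure R).
Variables (F f : R -> R) (a b : R).
Hypothesis dF : forall t, a <= t <= b -> is_derive t 1 F (f t).
Hypothesis cf : {within `[a, b], continuous f}.

Let FTC : a < b -> (\int[leb]_(t in `[a, b]) (f t)%:E)%E = (F b - F a)%:E.
Proof.
move=> ab; rewrite EFinB; apply: continuous_FTC2 => //.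
  have cF t : a <= t <= b -> F @ t --> F t.
    move=> /dF[dt _]; apply: differentiable_continuous.
    exact/derivable1_diffP.
  split.
  - by move=> t /subset_itv_oo_cc; rewrite in_itv/= => /dF[].
  - by apply: cvg_at_right_filter; apply: cF; rewrite lexx ltW.
  - by apply: cvg_at_left_filter; apply: cF; rewrite lexx ltW.
by move=> t /subset_itv_oo_cc; rewrite in_itv/= derive1E => /dF[_ ->].
Qed.

Lemma norm_diff_le_Rint g : a <= b -> L1 leb g -> (forall t, 0 <= g t) ->
  (forall t, a <= t <= b -> `|f t| <= g t) -> `|F b - F a| <= \int[leb]_t g t.
Proof.
rewrite le_eqVlt => /orP[/eqP <- lg g0 _|ab lg g0 fg].
  by rewrite subrr normr0; exact: Rint_ge0.
have mf : measurable_fun `[a, b] (EFin \o f).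
  by apply/measurable_EFinP; exact: subspace_continuous_measurable_fun.
have mg := L1_meas lg.
rewrite -lee_fin -abse_EFin -FTC// RintE//.
have mab : measurable `[a, b]%classic by exact: measurable_itv.
apply: (le_trans (le_abse_integral leb mab mf)).
apply: (@le_trans _ _ (\int[leb]_(t in `[a, b]) (g t)%:E)%E).
  apply: ge0_le_integral => //.
  - exact: measurableT_comp.
  - by apply/measurable_EFinP; exact: measurable_funTS.
apply: ge0_subset_integral => //; first exact/measurable_EFinP.
by move=> t _; rewrite lee_fin.
Qed.

End fundamental_theorem.

Section sobolev_test.
Variables (R : realType) (n : nat).
Implicit Types (phi : 'rV[R]_n -> R).
Local Notation leb := (@lebesgue_measure R).

Lemma is_derive_upd x i (t : R) : is_derive t (1 : R) (@upd R n x i) (delta_mx ord0 i).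
Proof.
have -> : @upd R n x i = (fun s : R => (x - x ord0 i *: delta_mx ord0 i) + s *: delta_mx ord0 i).
  apply/funext => s; apply/rowP => j; rewrite !mxE eqxx/=.
  by case: eqVneq => [->|_]; rewrite /= ?mulr1 ?mulr0 ?subrr ?add0r// subr0 addr0.
have h1 : is_derive t (1 : R) (fun s : R => s *: (delta_mx ord0 i : 'rV[R]_n)) (delta_mx ord0 i).
  have dd : differentiable (fun s : R => s *: (delta_mx ord0 i : 'rV[R]_n)) t by apply: ex_diff.
  apply: DeriveDef; first exact: diff_derivable.
  by rewrite deriveE// diff_val /= scale1r.
by rewrite -[X in is_derive _ _ _ X]add0r; exact: is_deriveD.
Qed.

Lemma upd_id (x : 'rV[R]_n) i : upd x i (x ord0 i) = x.
Proof. by apply/rowP => j; rewrite mxE; case: eqVneq => [->|]. Qed.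

Lemma bounded_supp_grad phi k i : test_function phi ->
  bounded_supp (fun y => k.+1%:R * (`|phi y| ^+ k * `|partial i phi y|)).
Proof.
move=> tp; have /test_functionP[sp [s s0 hs]] := tp.
have tg := test_partial i tp.
have [M M0 hM] := test_bounded tp; have [M' M'0 hM'] := test_bounded tg.
split.
- apply: measurable_funM => //; apply: measurable_funM.
    by apply: measurable_funX; apply: measurableT_comp => //; exact: test_meas.
  by apply: measurableT_comp => //; exact: test_meas.
- by move=> y; rewrite !mulr_ge0// exprn_ge0.
- exists s, (k.+1%:R * (M ^+ k * M')); first exact: ltW.
  split=> [y sy|y]; first by rewrite (vanishes_partial i hs)// normr0 !mulr0.
  by rewrite ler_wpM2l// ler_pM ?exprn_ge0// lerXn2r ?nnegrE// .
Qed.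

(** The fundamental theorem of calculus for phi^(k+1) along the i-th line through x, from a point
    outside the support. *)
Lemma test_pow_le_line_int phi k i x : test_function phi ->
  `|phi x| ^+ k.+1 <=
    line_int (fun y => k.+1%:R * (`|phi y| ^+ k * `|partial i phi y|)) i x.
Proof.
move=> tp; have /test_functionP[sp [s s0 hs]] := tp.
set g := fun y => _.
have tg := test_partial i tp.
have hg : bounded_supp g by exact: bounded_supp_grad.
pose G t := phi (upd x i t).
have dG t : is_derive t (1 : R) G (partial i phi (upd x i t)).
  have := is_derive_curve (is_derive_upd x i t) (smooth_diff sp _).
  rewrite (bigD1 i)//= big1 ?addr0 => [|j ji]; last first.
    by rewrite mxE eqxx/= (negbTE ji) mul0r.
  by rewrite mxE !eqxx mul1r.
(* The starting point must lie below -s, where phi vanishes, and not beyond x_i. *)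
pose a : R := Num.min (- s - 1) (x ord0 i).
have ax : a <= x ord0 i by rewrite ge_min lexx orbT.
have Ga : G a = 0.
  apply: hs; apply: lt_le_trans (norm_upd _ _ _).
  have : a <= - s - 1 by rewrite ge_min lexx.
  by move=> ha; rewrite ler0_norm; lra.
have cc : continuous (fun t => k.+1%:R * (G t ^+ k * partial i phi (upd x i t))).
  have cu : continuous (@upd R n x i).
    by move=> t; apply: differentiable_continuous; apply/derivable1_diffP; have [] := is_derive_upd x i t.
  have c1 psi : test_function psi -> continuous (fun t => psi (upd x i t)).
    move=> tpsi t.
    exact: (@continuous_comp _ _ _ (@upd R n x i) psi t (cu t) (@test_continuous R n psi tpsi _)).
  move=> t; apply: cvgM; first exact: cvg_cst.
  apply: cvgM; last exact: c1.
  exact: (@continuous_comp _ _ _ G (fun y => y ^+ k) t (c1 _ tp t) (@exprn_continuous R k _)).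
have := @norm_diff_le_Rint R (fun t => G t ^+ k.+1) _ a (x ord0 i) _
  (continuous_subspaceT cc) (fun t => g (upd x i t)) ax (bounded_supp_line x i hg) _ _.
rewrite Ga expr0n/= subr0 /G upd_id normrX; apply.
- move=> t _; have := is_deriveX k.+1 (dG t); rewrite /GRing.scale/= -mulrA.
  rewrite (_ : G ^+ k.+1 = fun t => G t ^+ k.+1)//.
  by apply/funext => y; rewrite exprfctE.
- by move=> t; have [] := hg.
- by move=> t _; rewrite /g !normrM normrX normr_nat.
Qed.

End sobolev_test.

Section sobolev_inequality.
Variable R : realType.

Lemma test_normX n k (phi : 'rV[R]_n -> R) : test_function phi -> (0 < k)%N ->
  L2 (lebesgue_rV R n) (fun x => `|phi x| ^+ k).
Proof.
case: k => // k tp _.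
have [M M0 hM] := test_bounded tp.
rewrite (_ : (fun x => _) = fun x => `|phi x| ^+ k * `|phi x|); last first.
  by apply/funext => x; rewrite exprSr.
apply: (L2_Mbounded (M := M ^+ k) (L2_norm (test_L2 tp))) => [|x].
  by apply: measurable_funX; apply: measurableT_comp => //; exact: test_meas.
by rewrite normrX normr_id lerXn2r// nnegrE.
Qed.

(** The identity between h and n writes |phi|^(2h(n+1)) as n + 2 factors |phi|^(h+1), each bounded
    by a line integral. After Cauchy-Schwarz, S^(2(n+1)) <= ((h+1)^2 S E)^(n+2), from which S^(n+2)
    is cancelled. *)
Lemma sobolev_test_aux n h (phi : 'rV[R]_n.+2 -> R) : (h.+1 * n.+2 = 2 * h * n.+1)%N ->
  (0 < h)%N -> (0 < n)%N -> test_function phi ->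
  (\int[lebesgue_rV R n.+2]_x (phi x ^+ 2) ^+ h) ^+ n <=
  (h.+1%:R ^+ 2 * \sum_i \int[lebesgue_rV R n.+2]_x partial i phi x ^+ 2) ^+ n.+2.
Proof.
set mu := lebesgue_rV R n.+2; set S := \int[mu]_x _ => hn h0 n0 tp; set E := \sum_i _.
have E0 i : 0 <= \int[mu]_x partial i phi x ^+ 2 by apply: Rint_ge0 => x; exact: sqr_ge0.
have EE i : \int[mu]_x partial i phi x ^+ 2 <= E.
  by rewrite /E (bigD1 i)//= lerDl sumr_ge0.
have S0 : 0 <= S by apply: Rint_ge0 => x; rewrite exprn_ge0 ?sqr_ge0.
pose F i y := h.+1%:R * (`|phi y| ^+ h * `|partial i phi y|).
have lS := test_normX tp h0.
have SE : S = \int[mu]_x (`|phi x| ^+ h) ^+ 2.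
  by apply: eq_Rint => x; rewrite -[phi x ^+ 2]real_normK ?num_real// -!exprM mulnC.
have FE i : (\int[mu]_x F i x) ^+ 2 <= h.+1%:R ^+ 2 * (S * E).
  have lg := L2_norm (test_L2 (test_partial i tp)).
  rewrite RintZ; last exact: L2M.
  rewrite exprMn ler_wpM2l ?exprn_ge0//; apply: le_trans (cauchy_schwarz lS lg) _.
  rewrite -SE ler_wpM2l//; apply: le_trans (EE i); rewrite le_eqVlt; apply/orP; left.
  by apply/eqP; apply: eq_Rint => x; rewrite real_normK ?num_real.
have [|||_] := @loomis_whitney R n F (fun x => (phi x ^+ 2) ^+ h)
  (fun i => bounded_supp_grad h i tp).
- by do 2!apply: measurable_funX; exact: test_meas.
- by move=> x; rewrite exprn_ge0 ?sqr_ge0.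
- move=> x; rewrite (_ : _ ^+ n.+1 = \prod_(i < n.+2) `|phi x| ^+ h.+1); last first.
    rewrite prodr_const card_ord -[phi x ^+ 2]real_normK ?num_real//.
    by rewrite -!exprM hn mulnA.
  by apply: ler_prod => i _; rewrite exprn_ge0//= test_pow_le_line_int.
rewrite -/S => SF.
have : (S ^+ n.+1) ^+ 2 <= (h.+1%:R ^+ 2 * (S * E)) ^+ n.+2.
  apply: (@le_trans _ _ ((\prod_i \int[mu]_x F i x) ^+ 2)).
    by rewrite lerXn2r ?nnegrE ?exprn_ge0// (le_trans _ SF)// exprn_ge0.
  rewrite -prodrXl -[n.+2 in leRHS]card_ord -prodr_const.
  by apply: ler_prod => i _; rewrite sqr_ge0 FE.
move: (S) S0 => s; rewrite le_eqVlt => /orP[/eqP <- _|s0].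
  by rewrite expr0n eqn0Ngt n0 exprn_ge0// mulr_ge0 ?exprn_ge0// sumr_ge0.
rewrite (_ : (s ^+ n.+1) ^+ 2 = s ^+ n.+2 * s ^+ n); last first.
  by rewrite -exprM -exprD; congr (_ ^+ _); rewrite muln2 -addnn addnS.
by rewrite mulrCA exprMn ler_pM2l// exprn_gt0.
Qed.

(** 16 is (h+1)^2 for N = 3. For N = 4 the auxiliary lemma bounds the square of the integral, and
    (h+1)^2 = 9 is enlarged to 16 after taking the root. *)
Lemma sobolev_test N h (phi : 'rV[R]_N -> R) : (N = 3 /\ h = 3 \/ N = 4 /\ h = 2)%N ->
  test_function phi -> \int[lebesgue_rV R N]_x (phi x ^+ 2) ^+ h <=
  (16 * \sum_i \int[lebesgue_rV R N]_x partial i phi x ^+ 2) ^+ h.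
Proof.
set mu := lebesgue_rV R N => hN tp.
have E0 : 0 <= \sum_i \int[mu]_x partial i phi x ^+ 2.
  by apply: sumr_ge0 => i _; apply: Rint_ge0 => x; exact: sqr_ge0.
case: hN => -[N3 h3]; subst N h.
  by have := @sobolev_test_aux 1 3 phi erefl isT isT tp; rewrite /= -natrX.
have := @sobolev_test_aux 2 2 phi erefl isT isT tp.
rewrite /= -natrX -[4%N]/(2 * 2)%N exprM.
have S0 : 0 <= \int[mu]_x (phi x ^+ 2) ^+ 2 by apply: Rint_ge0 => x; exact: sqr_ge0.
rewrite ler_pXn2r ?nnegrE ?sqr_ge0// => /le_trans; apply.
by rewrite lerXn2r ?nnegrE ?mulr_ge0// ler_wpM2r// ler_nat.
Qed.

End sobolev_inequality.

Section monotone_limits.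
Context d (T : measurableType d) (R : realType).
Variable mu : {measure set T -> \bar R}.

Lemma monotone_Rint_le (F : nat -> T -> R) (f : T -> R) (C : R) :
  (forall n, L1 mu (F n)) -> (forall n x, 0 <= F n x) ->
  (forall x, {homo F^~ x : n m / (n <= m)%N >-> n <= m}) ->
  (forall x, F^~ x @ \oo --> f x) -> measurable_fun setT f ->
  (forall n, \int[mu]_x F n x <= C) -> L1 mu f /\ \int[mu]_x f x <= C.
Proof.
move=> lF F0 hF Ff mf FC.
have f0 x : 0 <= f x by apply: (cvgr_to_ge (Ff x)); near=> n; exact: F0.
have h : (\int[mu]_x (f x)%:E <= C%:E)%E.
  have cv := @cvg_monotone_convergence _ _ _ mu setT measurableT
    (fun n x => (F n x)%:E) _ _ _.
  have {}cv : (\int[mu]_x (F n x)%:E)%E @[n --> \oo] --> (\int[mu]_x (f x)%:E)%E.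
    have := cv _ _ _; rewrite (_ : (\int[mu]_x _)%E = (\int[mu]_x (f x)%:E)%E).
      apply.
      - by move=> n; apply/measurable_EFinP; exact: L1_meas (lF n).
      - by move=> n x _; rewrite lee_fin.
      - by move=> x _ n m nm; rewrite lee_fin hF.
    apply: eq_integral => x _; apply/cvg_lim => //; apply: cvg_EFin; last exact: Ff.
    by near=> n.
  rewrite -(cvg_lim _ cv)//; apply: lime_le; first by apply/cvg_ex; eexists; exact: cv.
  by near=> n; rewrite -RintE// lee_fin.
have lf : L1 mu f by apply: L1_ge0P => //; apply: le_lt_trans h (ltry _).
by split => //; rewrite -lee_fin RintE.
Unshelve. all: by end_near. Qed.

End monotone_limits.

Section sobolev_wgrad.
Variables (R : realType) (N h : nat).
(* 2 * h is the critical exponent. *)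
Hypothesis hN : (N = 3 /\ h = 3 \/ N = 4 /\ h = 2)%N.
Local Notation mu := (lebesgue_rV R N).

(** Only the difference w - p is truncated on the right: min((w-p)^2, M)^h <= M^(h-1) (w-p)^2, so
    the error is controlled by the L^2 distance while p keeps its full power. *)
Lemma min_pow_le (w p M : R) : 0 <= M ->
  Num.min (w ^+ 2) M ^+ h <= 4 ^+ h * ((p ^+ 2) ^+ h + M ^+ h.-1 * (w - p) ^+ 2).
Proof.
move=> M0; have h0 : (0 < h)%N by case: hN => -[_ ->].
set a := p ^+ 2; set b := Num.min ((w - p) ^+ 2) M.
have a0 : 0 <= a := sqr_ge0 p.
have b0 : 0 <= b by rewrite le_min sqr_ge0.
have bb : b ^+ h <= M ^+ h.-1 * (w - p) ^+ 2.
  rewrite -[in leLHS](prednK h0) exprSr ler_pM ?exprn_ge0//.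
    by rewrite lerXn2r ?nnegrE// ge_min lexx orbT.
  by rewrite ge_min lexx.
have wab : Num.min (w ^+ 2) M <= 2 * (a + b).
  rewrite /b; case: (leP ((w - p) ^+ 2) M) => hd.
    apply: (@le_trans _ _ (w ^+ 2)); first by rewrite ge_min lexx.
    have := sqr_ge0 (w - 2 * p); rewrite /a; move: (w) (p) => w' p'; nra.
  apply: (@le_trans _ _ M); first by rewrite ge_min lexx orbT.
  by rewrite mulrDr; move: a a0 => a' a0'; lra.
clearbody a b.
apply: (@le_trans _ _ ((2 * (a + b)) ^+ h)).
  by rewrite lerXn2r ?nnegrE ?le_min ?sqr_ge0// mulr_ge0// addr_ge0.
apply: (@le_trans _ _ (4 ^+ h * (a ^+ h + b ^+ h))); last first.
  by rewrite ler_wpM2l ?exprn_ge0// lerD2l.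
rewrite (_ : 4 = 2 * 2 :> R); last by ring.
rewrite exprMn [in leRHS]exprMn -mulrA ler_wpM2l ?exprn_ge0//.
case: (leP a b) => ab.
  apply: (@le_trans _ _ ((2 * b) ^+ h)).
    by rewrite lerXn2r ?nnegrE ?addr_ge0 ?mulr_ge0//; lra.
  by rewrite exprMn ler_wpM2l ?exprn_ge0// lerDr exprn_ge0.
apply: (@le_trans _ _ ((2 * a) ^+ h)).
  by rewrite lerXn2r ?nnegrE ?addr_ge0 ?mulr_ge0//; lra.
by rewrite exprMn ler_wpM2l ?exprn_ge0// lerDl exprn_ge0.
Qed.

(* Truncation makes the critical norm continuous in L^2, so that approximation by
   test functions applies before w is known to have a finite critical norm. *)
Lemma sobolev_truncated w g (M : R) : has_wgrad w g -> 0 <= M ->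
  L1 mu (fun x => Num.min (w x ^+ 2) M ^+ h) /\
  \int[mu]_x Num.min (w x ^+ 2) M ^+ h <= (128 * \sum_i \int[mu]_x g i x ^+ 2) ^+ h.
Proof.
move=> hw M0; have [lw hg] := hw; have h0 : (0 < h)%N by case: hN => -[_ ->].
have lg i : L2 mu (g i) by have [] := hg i.
have mw : measurable_fun setT (fun x => Num.min (w x ^+ 2) M ^+ h).
  apply: measurable_funX; apply: measurable_minr => //.
  by apply: measurable_funX; exact: L2_meas lw.
have l1 : L1 mu (fun x => Num.min (w x ^+ 2) M ^+ h).
  apply: (L1_dom mw _ (L1Z (M ^+ h.-1) (L2_sqr lw))) => x.
  have m0 : 0 <= Num.min (w x ^+ 2) M by rewrite le_min sqr_ge0.
  rewrite normrX ger0_norm// -[in leLHS](prednK h0) exprSr ler_pM ?exprn_ge0//.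
    by rewrite lerXn2r ?nnegrE// ge_min lexx orbT.
  by rewrite ge_min lexx.
split => //; set E := \sum_i _.
have E0 : 0 <= E by apply: sumr_ge0 => i _; apply: Rint_ge0 => x; exact: sqr_ge0.
have key (e : R) : 0 < e -> \int[mu]_x Num.min (w x ^+ 2) M ^+ h <=
    4 ^+ h * ((16 * (2 * (E + N%:R * e))) ^+ h + M ^+ h.-1 * e).
  move=> e0; have [phi [tp wp gp]] := test_dense hw e0.
  have lp := test_L2 tp.
  have lpi i := test_L2 (test_partial i tp).
  have lph : L1 mu (fun x => (phi x ^+ 2) ^+ h).
    apply: eq_L1 (L2_sqr (test_normX tp h0)) => x.
    by rewrite -[phi x ^+ 2]real_normK ?num_real// -!exprM mulnC.
  have ld : L1 mu (fun x => M ^+ h.-1 * (w x - phi x) ^+ 2).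
    by apply: L1Z; apply: L2_sqr; exact: L2B.
  apply: le_trans (Rint_le l1 (L1Z _ (L1D lph ld)) (fun x => min_pow_le _ (phi x) M0)) _.
  rewrite RintZ; last exact: L1D.
  rewrite ler_wpM2l ?exprn_ge0// RintD//.
  apply: lerD; last first.
    rewrite RintZ; last by apply: L2_sqr; exact: L2B.
    by rewrite ler_wpM2l// exprn_ge0.
  apply: le_trans (sobolev_test hN tp) _.
  have P0 : 0 <= \sum_i \int[mu]_x partial i phi x ^+ 2.
    by apply: sumr_ge0 => i _; apply: Rint_ge0 => x; exact: sqr_ge0.
  have NE0 : 0 <= E + N%:R * e by rewrite addr_ge0// mulr_ge0// ltW.
  rewrite lerXn2r ?nnegrE ?mulr_ge0// ler_wpM2l//.
  rewrite (_ : N%:R * e = \sum_(i < N) e); last by rewrite sumr_const card_ord mulr_natl.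
  rewrite -big_split mulr_sumr/=; apply: ler_sum => i _.
  apply: le_trans (_ : \int[mu]_x ((g i x + (partial i phi x - g i x)) ^+ 2) <= _).
    by rewrite le_eqVlt; apply/orP; left; apply/eqP; apply: eq_Rint => x; rewrite subrKC.
  apply: le_trans (Rint_sqrD (lg i) (L2B (lpi i) (lg i))) _.
  rewrite ler_wpM2l// lerD2l; apply: le_trans (gp i).
  by rewrite le_eqVlt; apply/orP; left; apply/eqP; apply: eq_Rint => x; rewrite -sqrrN opprB.
have c0 : (n.+1%:R^-1 : R) @[n --> \oo] --> (0 : R) by exact: cvg_harmonic.
have c1 : (16 * (2 * (E + N%:R * n.+1%:R^-1)) : R) @[n --> \oo] -->
    (16 * (2 * (E + N%:R * 0)) : R).
  apply: cvgM; first exact: cvg_cst.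
  apply: cvgM; first exact: cvg_cst.
  apply: cvgD; first exact: cvg_cst.
  by apply: cvgM => //; exact: cvg_cst.
have cv : 4 ^+ h * ((16 * (2 * (E + N%:R * n.+1%:R^-1))) ^+ h + M ^+ h.-1 * n.+1%:R^-1)
    @[n --> \oo] --> 4 ^+ h * ((16 * (2 * (E + N%:R * 0))) ^+ h + M ^+ h.-1 * 0).
  apply: cvgM; first exact: cvg_cst.
  apply: cvgD; last by apply: cvgM => //; exact: cvg_cst.
  exact: (cvg_comp _ _ c1 (@exprn_continuous R h _)).
(* 128 = 4 * 16 * 2, from [min_pow_le], [sobolev_test] and the square of a sum. *)
have -> : (128 * E) ^+ h = 4 ^+ h * ((16 * (2 * (E + N%:R * 0))) ^+ h + M ^+ h.-1 * 0).
  by rewrite !mulr0 !addr0 -exprMn; congr (_ ^+ _); ring.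
apply: (cvgr_to_ge cv); near=> n; apply: key.
by rewrite invr_gt0.
Unshelve. all: by end_near. Qed.

Theorem sobolev w g : has_wgrad w g ->
  L1 mu (fun x => (w x ^+ 2) ^+ h) /\
  \int[mu]_x (w x ^+ 2) ^+ h <= (128 * \sum_i \int[mu]_x g i x ^+ 2) ^+ h.
Proof.
move=> hw; have mw := L2_meas hw.1.
apply: (@monotone_Rint_le _ _ _ mu (fun n x => Num.min (w x ^+ 2) n.+1%:R ^+ h)).
- by move=> n; have [] := sobolev_truncated hw (ler0n R n.+1).
- by move=> n x; rewrite exprn_ge0// le_min sqr_ge0/=.
- move=> x n m nm; rewrite lerXn2r ?nnegrE ?le_min ?sqr_ge0//=.
  by rewrite ge_min lexx/= ge_min ler_nat ltnS nm orbT.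
- move=> x; apply: cvg_near_cst; near=> n; congr (_ ^+ _); apply/min_idPl.
  by near: n; exact: near_natS_ge.
- by do 2!apply: measurable_funX.
- by move=> n; have [] := sobolev_truncated hw (ler0n R n.+1).
Unshelve. all: by end_near. Qed.

End sobolev_wgrad.

(** * Potential estimates and the extended weak formulation *)

Lemma sqrX_ge0 (R : realDomainType) (x : R) k : 0 <= (x ^+ 2) ^+ k.
Proof. by rewrite exprn_ge0 ?sqr_ge0. Qed.

Lemma sqrXM_ge0 (R : realDomainType) (x y : R) k : 0 <= (x ^+ 2) ^+ k * y ^+ 2.
Proof. by rewrite mulr_ge0 ?sqrX_ge0 ?sqr_ge0. Qed.

Section potentials.
Context d (T : measurableType d) (R : realType).
Variable mu : {measure set T -> \bar R}.

Lemma hoelder_potential k (u w : T -> R) : measurable_fun setT u -> measurable_fun setT w ->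
  L1 mu (fun x => (u x ^+ 2) ^+ k.+1) -> L1 mu (fun x => (w x ^+ 2) ^+ k.+1) ->
  L1 mu (fun x => (u x ^+ 2) ^+ k * w x ^+ 2) /\
  (\int[mu]_x ((u x ^+ 2) ^+ k * w x ^+ 2)) ^+ k.+1 <=
    \int[mu]_x (w x ^+ 2) ^+ k.+1 * (\int[mu]_x (u x ^+ 2) ^+ k.+1) ^+ k.
Proof.
move=> mu' mw lu lw.
have [|||||l1 h1] := @hoelder_prod _ T R mu k
  (fun j => if j == ord0 then fun x => (w x ^+ 2) ^+ k.+1 else fun x => (u x ^+ 2) ^+ k.+1)
  (fun x => (u x ^+ 2) ^+ k * w x ^+ 2).
- by apply: measurable_funM; do !apply: measurable_funX.
- by move=> x; exact: sqrXM_ge0.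
- by move=> j; case: ifP.
- by move=> j x; case: ifP => _; exact: sqrX_ge0.
- move=> x; rewrite big_ord_recl/= prodr_const card_ord.
  by rewrite exprMn [leLHS]mulrC [X in _ * X <= _]exprAC.
split => //; apply: le_trans h1 _.
by rewrite big_ord_recl/= prodr_const card_ord.
Qed.

End potentials.

Section weak_gradient_algebra.
Variables (R : realType) (n : nat).
Local Notation mu := (lebesgue_rV R n).
Implicit Types (u v phi : 'rV[R]_n -> R).

(** By translation invariance phi(x + t e) - phi(x) has integral 0, so t I is minus the integral of
    a Taylor remainder, which is O(t^2) on a fixed cube. Hence |I| = O(t). *)
Lemma Rint_partial i phi : test_function phi -> \int[mu]_x partial i phi x = 0.
Proof.
move=> tp; have /test_functionP[sp [r r0 hr]] := tp.
have [C C0 hC] := test_taylor tp.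
set I := \int[mu]_x _; have tg := test_partial i tp.
have lg : L1 mu (partial i phi) := test_L1 tg.
have lphi := test_L1 tp.
have key (t : R) : 0 < t <= 1 -> `|I| <= t * (C * (2 * (r + 1)) ^+ n).
  move=> /andP[t0 t1]; rewrite -(ler_pM2l t0) -{1}(gtr0_norm t0) -normrM.
  pose e : 'rV[R]_n := delta_mx ord0 i.
  have ne : `|t *: e| <= t.
    apply/cubeP; first exact: ltW.
    move=> j; rewrite /= in_itv/= -ler_norml !mxE eqxx/=.
    case: eqP => _; last by rewrite mulr0 normr0 ltW.
    by rewrite mulr1 gtr0_norm.
  have sume x : \sum_j (t *: e) ord0 j * partial j phi x = t * partial i phi x.
    rewrite (bigD1 i)//= big1 ?addr0 => [|j ji]; rewrite !mxE eqxx/=.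
      by rewrite eqxx mulr1.
    by rewrite (negbTE ji) mulr0 mul0r.
  have lsh : L1 mu (fun x => phi (x + t *: e)) by exact: L1_shift.
  have -> : t * I = - \int[mu]_x (phi (x + t *: e) - phi x - t * partial i phi x).
    rewrite RintB; [|exact: L1B|exact: L1Z].
    by rewrite RintB// Rint_shift// subrr sub0r opprK RintZ.
  rewrite normrN.
  have ld : L1 mu (fun x => phi (x + t *: e) - phi x - t * partial i phi x).
    by apply: L1B; [exact: L1B|exact: L1Z].
  apply: le_trans (Rint_norm ld) _.
  have r1 : 0 <= r + 1 by lra.
  have lc := L1Z (C * t ^+ 2) (L1_cube_indic n r1).
  apply: le_trans (Rint_le (L1_norm ld) lc _) _; last first.
    rewrite RintZ; last exact: L1_cube_indic.
    rewrite Rint_cube_indic// le_eqVlt; apply/orP; left; apply/eqP; ring.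
  move=> x; rewrite indicE; have [xr|xr] := lerP `|x| (r + 1).
    rewrite mem_set; last exact/cubeP.
    rewrite mulr1 -sume; apply: le_trans (hC x _) _; rewrite ler_wpM2l//.
    by rewrite lerXn2r ?nnegrE// ltW.
  rewrite hr; last first.
    have := ler_normB (x + t *: e) (t *: e); rewrite addrK; lra.
  rewrite hr; last by lra.
  rewrite (vanishes_partial i hr); last by lra.
  rewrite mulr0 !subr0 normr0; apply: mulr_ge0; last exact: ler0n.
  by rewrite mulr_ge0// exprn_ge0// ltW.
apply/eqP; rewrite -normr_le0; apply/ler_addgt0Pr => e e0; rewrite add0r.
set K := C * _ in key; have K0 : 0 <= K by rewrite mulr_ge0// exprn_ge0//; lra.
apply: le_trans (key (Num.min 1 (e / (K + 1))) _) _.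
  by rewrite lt_min ltr01 ge_min lexx/= divr_gt0//; lra.
apply: (@le_trans _ _ (e / (K + 1) * K)).
  by rewrite ler_wpM2r// ge_min lexx orbT.
by rewrite mulrAC ler_pdivrMr; [rewrite ler_wpM2l ?(ltW e0)//|]; lra.
Qed.

Lemma has_wgrad_test phi : test_function phi -> has_wgrad phi (fun i => partial i phi).
Proof.
move=> tp; split; first exact: test_L2.
move=> i; have tg := test_partial i tp; split; first exact: test_L2.
move=> psi tpsi; have tq := test_partial i tpsi.
have tpq := testM (test_smooth tp) tpsi.
have := Rint_partial i tpq.
rewrite (eq_Rint _ (g := fun x => phi x * partial i psi x + partial i phi x * psi x)).
  rewrite RintD; [|exact: L2M (test_L2 tp) (test_L2 tq)|exact: L2M (test_L2 tg) (test_L2 tpsi)].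
  by move/eqP; rewrite addr_eq0 => /eqP.
by move=> x; rewrite partialM ?[psi x * _]mulrC//; exact/smooth_diff/test_smooth.
Qed.

Lemma has_wgradD u v g gv : has_wgrad u g -> has_wgrad v gv ->
  has_wgrad (fun x => u x + v x) (fun i x => g i x + gv i x).
Proof.
move=> [lu hu] [lv hv]; split; first exact: L2D.
move=> i; have [lg wg] := hu i; have [lgv wgv] := hv i; split; first exact: L2D.
move=> phi tp; have lp := test_L2 tp; have ldp := test_L2 (test_partial i tp).
under eq_Rintegral do rewrite mulrDl.
rewrite RintD; [|exact: L2M|exact: L2M].
under [in RHS]eq_Rintegral do rewrite mulrDl.
rewrite RintD; [|exact: L2M|exact: L2M].
by rewrite wg// wgv// opprD.
Qed.

Lemma has_wgradZ c u g : has_wgrad u g -> has_wgrad (fun x => c * u x) (fun i x => c * g i x).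
Proof.
move=> [lu hu]; split; first exact: L2Z.
move=> i; have [lg wg] := hu i; split; first exact: L2Z.
move=> phi tp; have lp := test_L2 tp; have ldp := test_L2 (test_partial i tp).
under eq_Rintegral do rewrite -mulrA.
rewrite RintZ; last exact: L2M.
under [in RHS]eq_Rintegral do rewrite -mulrA.
by rewrite RintZ ?wg ?mulrN//; exact: L2M.
Qed.

Lemma has_wgradB u v g gv : has_wgrad u g -> has_wgrad v gv ->
  has_wgrad (fun x => u x - v x) (fun i x => g i x - gv i x).
Proof.
move=> hu /(has_wgradZ (-1)) hv; have := has_wgradD hu hv.
by congr has_wgrad; [|apply/funext => i]; apply/funext => x; rewrite mulN1r.
Qed.

End weak_gradient_algebra.

Section potential_estimates.
Variables (R : realType) (m h : nat).
(* m = N - 2 and 2 * h.+1 is the critical exponent, so m * h.+1 = N. *)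
Hypothesis hm : (m = 1 /\ h = 2 \/ m = 2 /\ h = 1)%N.
Local Notation N := m.+2.
Local Notation mu := (lebesgue_rV R N).
Implicit Types (u v w : 'rV[R]_N -> R) (g G : 'I_N -> 'rV[R]_N -> R).

Definition energy g : R := \sum_i \int[mu]_x g i x ^+ 2.

Lemma energy_ge0 g : 0 <= energy g.
Proof. by apply: sumr_ge0 => i _; apply: Rint_ge0 => x; exact: sqr_ge0. Qed.

Lemma sobolev_energy w g : has_wgrad w g -> L1 mu (fun x => (w x ^+ 2) ^+ h.+1) /\
  \int[mu]_x (w x ^+ 2) ^+ h.+1 <= (128 * energy g) ^+ h.+1.
Proof.
apply: sobolev; case: hm => -[-> ->]; [by left|by right].
Qed.

Lemma potential_bound u w g (A : R) : 0 <= A -> measurable_fun setT u ->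
  L1 mu (fun x => (u x ^+ 2) ^+ h.+1) ->
  \int[mu]_x (u x ^+ 2) ^+ h.+1 <= A ^+ h.+1 -> has_wgrad w g ->
  L1 mu (fun x => (u x ^+ 2) ^+ h * w x ^+ 2) /\
  \int[mu]_x ((u x ^+ 2) ^+ h * w x ^+ 2) <= 128 * A ^+ h * energy g.
Proof.
move=> A0 mu' lu uA hw; have [lw hS] := sobolev_energy hw.
have [l1 h1] := hoelder_potential mu' (L2_meas hw.1) lu lw.
have e0 := energy_ge0 g.
split => //; rewrite -(@ler_pXn2r _ h.+1) ?nnegrE//; first last.
- by rewrite mulr_ge0// mulr_ge0// exprn_ge0.
- by apply: Rint_ge0 => x; exact: sqrXM_ge0.
apply: le_trans h1 _; rewrite mulrAC [leRHS]exprMn -exprM mulnC exprM.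
apply: ler_pM => //.
- by apply: Rint_ge0 => x; exact: sqrX_ge0.
- by rewrite exprn_ge0//; apply: Rint_ge0 => x; exact: sqrX_ge0.
- by rewrite lerXn2r ?nnegrE ?exprn_ge0//; apply: Rint_ge0 => x; exact: sqrX_ge0.
Qed.

(* u^(2h) is the sum of a bounded function supported in a cube and of a function
   of small norm in L^(N/2). *)
Lemma potential_small u (dlt : R) : measurable_fun setT u ->
  L1 mu (fun x => (u x ^+ 2) ^+ h.+1) -> 0 < dlt ->
  exists M r : R, [/\ 0 <= M, 0 <= r & forall w g, has_wgrad w g ->
    \int[mu]_x ((u x ^+ 2) ^+ h * w x ^+ 2) <=
    dlt * energy g + M * \int[mu]_x (\1_(@cube R N r) x * w x ^+ 2)].
Proof.
move=> mu' lu d0.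
have h0 : (0 < h)%N by case: hm => -[_ ->].
pose A k := cube k.+1%:R `&` [set x | u x ^+ 2 <= k.+1%:R].
have mA k : measurable (A k).
  apply: measurableI; first exact: measurable_cube.
  have mu2 : measurable_fun setT (fun x => u x ^+ 2) by exact: measurable_funX.
  by rewrite -[X in measurable X]setTI; exact: measurable_fun_le.
pose t k x := (1 - \1_(A k) x) * u x : R.
have mt k : measurable_fun setT (t k).
  by apply: measurable_funM => //; apply: measurable_funB => //; exact: measurable_indic.
have tu k x : `|t k x| <= `|u x|.
  rewrite /t indicE; case: (x \in A k) => /=; last by rewrite subr0 mul1r.
  by rewrite subrr mul0r normr0.
have tX k x : `|(t k x ^+ 2) ^+ h.+1| <= (u x ^+ 2) ^+ h.+1.
  rewrite (ger0_norm (sqrX_ge0 _ _)) lerXn2r ?nnegrE ?sqr_ge0//.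
  by rewrite -[leLHS]real_normK ?num_real// -[leRHS]real_normK ?num_real// lerXn2r ?nnegrE.
have cv : \int[mu]_x (t k x ^+ 2) ^+ h.+1 @[k --> \oo] --> \int[mu]_x (0 : R).
  apply: (dominated_Rint _ _ lu _ tX) => //.
  - by move=> k; do 2!apply: measurable_funX.
  - apply: filterE => x; apply: cvg_near_cst; near=> k.
    rewrite /t indicE mem_set ?subrr ?mul0r ?expr0n//=; split.
      by apply/cubeP => //; near: k; exact: near_natS_ge.
    by near: k; exact: near_natS_ge.
move: cv; rewrite (_ : \int[mu]_x (0 : R) = 0); last by rewrite /Rintegral integral0.
(* As a <= 1 and h >= 1, the constant 128 a^h of [potential_bound] is at most dlt. *)
pose a := Num.min 1 (dlt / 128).
have a0 : 0 < a by rewrite lt_min ltr01 divr_gt0.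
have a1 : a <= 1 by rewrite ge_min lexx.
have ad : 128 * a ^+ h <= dlt.
  apply: (@le_trans _ _ (128 * a)).
    by rewrite ler_wpM2l// -[leRHS]expr1 ler_wiXn2l// ltW.
  by rewrite mulrC -ler_pdivlMr// ge_min lexx orbT.
move=> /cvgr0_norm_le => /(_ _ (exprn_gt0 h.+1 a0))[k _ /(_ k (leqnn k))/= tk].
have {}tk : \int[mu]_x (t k x ^+ 2) ^+ h.+1 <= a ^+ h.+1 by apply: le_trans tk; exact: ler_norm.
exists (k.+1%:R ^+ h), k.+1%:R; split => // w g hw.
have lt : L1 mu (fun x => (t k x ^+ 2) ^+ h.+1).
  by apply: L1_dom (tX k) lu; do 2!apply: measurable_funX.
have [l1 h1] := potential_bound (ltW a0) (mt k) lt tk hw.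
have l2 : L1 mu (fun x => \1_(@cube R N k.+1%:R) x * w x ^+ 2).
  apply: L1_dom (L2_sqr hw.1).
    apply: measurable_funM; first by apply: measurable_indic; exact: measurable_cube.
    by apply: measurable_funX; exact: L2_meas hw.1.
  move=> x; rewrite normrM [`|w x ^+ 2|]ger0_norm ?sqr_ge0// ler_piMl ?sqr_ge0//.
  by rewrite indicE; case: (_ \in _); rewrite ?normr1 ?normr0.
have [l3 _] := hoelder_potential mu' (L2_meas hw.1) lu (sobolev_energy hw).1.
apply: (@le_trans _ _ (\int[mu]_x ((t k x ^+ 2) ^+ h * w x ^+ 2 +
   k.+1%:R ^+ h * (\1_(@cube R N k.+1%:R) x * w x ^+ 2)))).
  apply: Rint_le => //; first by apply: L1D => //; exact: L1Z.
  move=> x; rewrite /t indicE; case: (boolP (x \in A k)) => [/set_mem[xc xu]|_].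
    rewrite /= subrr mul0r expr0n/= (expr0n _ h) eqn0Ngt h0 mul0r add0r.
    rewrite indicE mem_set// mul1r ler_wpM2r ?sqr_ge0// lerXn2r ?nnegrE ?sqr_ge0//.
  rewrite /= subr0 mul1r lerDl mulr_ge0 ?exprn_ge0// mulr_ge0 ?sqr_ge0//.
rewrite RintD//; last exact: L1Z.
rewrite RintZ// lerD2r; apply: le_trans h1 _.
by rewrite ler_wpM2r// energy_ge0.
Unshelve. all: by end_near. Qed.

Lemma cvg_sqr_le (K x : R) (y : nat -> R) :
  (forall k, (x - y k) ^+ 2 <= K * k.+1%:R^-1) -> y @ \oo --> x.
Proof.
move=> h1; apply/cvgrPdist_le => e e0.
have e2 : 0 < e ^+ 2 by rewrite exprn_gt0.
near=> k.
have Kk : K / e ^+ 2 <= k.+1%:R by near: k; exact: near_natS_ge.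
have H : (x - y k) ^+ 2 <= e ^+ 2.
  apply: le_trans (h1 k) _; rewrite ler_pdivrMr//.
  by move: Kk; rewrite ler_pdivrMr// [_ * e ^+ 2]mulrC.
by rewrite -(@ler_pXn2r _ 2)// ?nnegrE ?(ltW e0)// real_normK ?num_real.
Unshelve. all: by end_near. Qed.

Lemma L2_powS u g : has_wgrad u g -> L2 mu (fun x => u x ^+ h.+1).
Proof.
move=> hu; split; first by apply: measurable_funX; exact: L2_meas hu.1.
by under eq_fun do rewrite exprAC; have [] := sobolev_energy hu.
Qed.

Lemma L2_powM u g w G : has_wgrad u g -> has_wgrad w G -> L2 mu (fun x => u x ^+ h * w x).
Proof.
move=> hu hw; have mu' := L2_meas hu.1; have mw := L2_meas hw.1; split.
  by apply: measurable_funM => //; exact: measurable_funX.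
under eq_fun do rewrite exprMn exprAC.
by have [] := hoelder_potential mu' mw (sobolev_energy hu).1 (sobolev_energy hw).1.
Qed.

(** Density of test functions. The critical term is written as u^(h+1) times u^h Z because both
    factors are in L^2, the first by Sobolev and the second by Hoelder; Cauchy-Schwarz then makes it
    continuous in Z. *)
Lemma weak_eq_extend u gu (F : 'rV[R]_N -> R) (lam c : R) :
  has_wgrad u gu -> L2 mu F ->
  (forall phi, test_function phi ->
    \sum_i \int[mu]_x (gu i x * partial i phi x) + lam * \int[mu]_x (u x * phi x) =
    c * \int[mu]_x (u x ^+ h.+1 * (u x ^+ h * phi x)) + \int[mu]_x (F x * phi x)) ->
  forall Z G, has_wgrad Z G ->
  \sum_i \int[mu]_x (gu i x * G i x) + lam * \int[mu]_x (u x * Z x) =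
    c * \int[mu]_x (u x ^+ h.+1 * (u x ^+ h * Z x)) + \int[mu]_x (F x * Z x).
Proof.
move=> hu lF eqn Z G hZ.
have k0 k : 0 < k.+1%:R^-1 :> R by rewrite invr_gt0.
have /choice[phi hphi] k := test_dense hZ (k0 k).
have tp k : test_function (phi k) by have [] := hphi k.
have wt k := has_wgrad_test (tp k).
have wd k : has_wgrad (fun x => Z x - phi k x) (fun i x => G i x - partial i (phi k) x).
  exact: has_wgradB.
have lG i : L2 mu (G i) by have [] := hZ.2 i.
have lg i : L2 mu (gu i) by have [] := hu.2 i.
have CS f w (p : nat -> 'rV[R]_N -> R) : L2 mu f -> L2 mu w -> (forall k, L2 mu (p k)) ->
    (forall k, \int[mu]_x (w x - p k x) ^+ 2 <= k.+1%:R^-1) ->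
    \int[mu]_x (f x * p k x) @[k --> \oo] --> \int[mu]_x (f x * w x).
  move=> lf lw lp hp; apply: (@cvg_sqr_le (\int[mu]_x f x ^+ 2)) => k.
  have lwp : L2 mu (fun x => w x - p k x) by exact: L2B.
  rewrite -RintB; [|exact: L2M|exact: L2M].
  under eq_Rintegral do rewrite -mulrBr.
  apply: le_trans (cauchy_schwarz lf lwp) _.
  by rewrite ler_wpM2l//; apply: Rint_ge0 => x; exact: sqr_ge0.
have c1 i : \int[mu]_x (gu i x * partial i (phi k) x) @[k --> \oo] -->
    \int[mu]_x (gu i x * G i x).
  apply: CS => // [k|k]; first by apply: test_L2; exact: test_partial.
  by have [_ _ ->] := hphi k.
have c2 f : L2 mu f -> \int[mu]_x (f x * phi k x) @[k --> \oo] --> \int[mu]_x (f x * Z x).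
  move=> lf; apply: CS => // [|k|k]; [exact: hZ.1|exact: test_L2|].
  by have [_ -> _] := hphi k.
have c3 : \int[mu]_x (u x ^+ h.+1 * (u x ^+ h * phi k x)) @[k --> \oo] -->
    \int[mu]_x (u x ^+ h.+1 * (u x ^+ h * Z x)).
  have lu := (sobolev_energy hu).1.
  pose A := 1 + \int[mu]_x (u x ^+ 2) ^+ h.+1.
  have A0 : 0 <= \int[mu]_x (u x ^+ 2) ^+ h.+1 by apply: Rint_ge0 => x; exact: sqrX_ge0.
  have A1 : 1 <= A by rewrite lerDl.
  have HA : \int[mu]_x (u x ^+ 2) ^+ h.+1 <= A ^+ h.+1.
    by apply: (@le_trans _ _ A); [rewrite lerDr|rewrite -[leLHS]expr1 ler_weXn2l].
  apply: (@cvg_sqr_le (\int[mu]_x (u x ^+ h.+1) ^+ 2 * (128 * A ^+ h * N%:R))) => k.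
  have lup := L2_powM hu (wt k); have lud := L2_powM hu (wd k).
  rewrite -RintB; [|exact: L2M (L2_powS hu) (L2_powM hu hZ)|exact: L2M (L2_powS hu) lup].
  under eq_Rintegral do rewrite -mulrBr -mulrBr.
  apply: le_trans (cauchy_schwarz (L2_powS hu) lud) _.
  rewrite -[leRHS]mulrA ler_wpM2l//; first by apply: Rint_ge0 => x; exact: sqr_ge0.
  under eq_Rintegral do rewrite exprMn exprAC.
  have [_ h1] := potential_bound (le_trans ler01 A1) (L2_meas hu.1) lu HA (wd k).
  apply: le_trans h1 _; rewrite -[leRHS]mulrA ler_wpM2l//.
    by rewrite mulr_ge0// exprn_ge0// (le_trans ler01 A1).
  rewrite (_ : N%:R * _ = \sum_(i < N) k.+1%:R^-1); last by rewrite sumr_const card_ord mulr_natl.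
  by apply: ler_sum => i _; have [_ _ ->] := hphi k.
have L : \sum_i \int[mu]_x (gu i x * partial i (phi k) x) +
    lam * \int[mu]_x (u x * phi k x) @[k --> \oo] -->
    \sum_i \int[mu]_x (gu i x * G i x) + lam * \int[mu]_x (u x * Z x).
  apply: cvgD; first by apply: cvg_big => [|i _]; [exact: add_continuous|exact: c1].
  by apply: cvgM; [exact: cvg_cst|exact: c2 hu.1].
apply: (cvg_unique _ L) => //=.
under eq_fun do rewrite eqn//.
apply: cvgD; last exact: c2.
by apply: cvgM => //; exact: cvg_cst.
Unshelve. all: by end_near. Qed.

End potential_estimates.

(** * Dilations and the Pohozaev inequality *)

Section fundamental_theorem_sqr.
Variable R : realType.
Local Notation leb := (@lebesgue_measure R).

Lemma lebesgue_itvE (a b : R) : a <= b -> lebesgue_measure `[a, b]%classic = (b - a)%:E.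
Proof.
move=> ab; rewrite lebesgue_measure_itv/= lte_fin; case: ifPn => [_|]; first by rewrite EFinB.
by rewrite -leNgt => ba; congr EFin; lra.
Qed.

(** Bounding |f| by (k + g/k)/2 under the integral and then choosing k has the effect of the
    Cauchy-Schwarz inequality. *)
Lemma sqr_diff_le_Rint (F f g : R -> R) (a b : R) : a <= b ->
  (forall t, a <= t <= b -> is_derive t 1 F (f t)) -> {within `[a, b], continuous f} ->
  L1 leb g -> (forall t, 0 <= g t) -> (forall t, a <= t <= b -> f t ^+ 2 <= g t) ->
  (F b - F a) ^+ 2 <= (b - a) * \int[leb]_t g t.
Proof.
move=> ab dF cf lg g0 fg.

have l1 : L1 leb (fun t => \1_(`[a, b]%classic) t : R).
  exact: (L1_indic _ (lebesgue_itvE ab)).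
have i1 : \int[leb]_t (\1_(`[a, b]%classic) t : R) = b - a.
  exact: (Rint_indic _ (lebesgue_itvE ab)).
set I := \int[leb]_t g t; have I0 : 0 <= I by exact: Rint_ge0.
have key (k : R) : 0 < k -> 2 * `|F b - F a| * k <= k ^+ 2 * (b - a) + I.
  move=> k0; pose g' t := 2^-1 * (k * \1_(`[a, b]%classic) t + k^-1 * g t).
  have lg' : L1 leb (fun t => k * \1_(`[a, b]%classic) t + k^-1 * g t).
    by apply: L1D; exact: L1Z.
  have := @norm_diff_le_Rint _ F f a b dF cf g' ab (L1Z _ lg') _ _.
  rewrite RintZ// RintD//; [|exact: L1Z|exact: L1Z].
  rewrite RintZ// RintZ// i1 -/I.
  have -> : 2^-1 * (k * (b - a) + k^-1 * I) = (k ^+ 2 * (b - a) + I) / (2 * k).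
    by field; rewrite gt_eqF.
  rewrite ler_pdivlMr ?mulr_gt0// mulrA [`|_| * 2]mulrC; apply.
    by move=> t; apply: mulr_ge0 => //; apply: addr_ge0; apply: mulr_ge0;
      rewrite ?invr_ge0 ?(ltW k0) ?indicE.
  move=> t tab; have tab' : t \in `[a, b]%classic by rewrite mem_set//= in_itv.
  rewrite /g' indicE tab' mulr1.
  have -> : 2^-1 * (k + k^-1 * g t) = (k ^+ 2 + g t) / (2 * k).
    by field; rewrite gt_eqF.
  rewrite ler_pdivlMr ?mulr_gt0//; have := fg t tab.
  have := sqr_ge0 (`|f t| - k); rewrite sqrrB real_normK ?num_real//.
  by rewrite -mulr_natl; lra.
move: key; rewrite -[_ ^+ 2]real_normK ?num_real//.
have := normr_ge0 (F b - F a); move: `|_| => X X0 key.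
case: (ltgtP X 0) X0 => // [X0 _|-> _]; last first.
  by rewrite expr0n/= mulr_ge0// subr_ge0.
have := ab; rewrite le_eqVlt => /orP[/eqP ba|{}ab].
  have J0 : 0 < (I + 1) / X by rewrite divr_gt0//; lra.
  have := key _ J0; rewrite ba subrr mulr0 add0r.
  have -> : 2 * X * ((I + 1) / X) = 2 * (I + 1) by field; rewrite gt_eqF.
  by clear -I0; lra.
have L0 : 0 < b - a by lra.
(* The best k. For b = a, treated above, a large k already contradicts X > 0... through 2 (I + 1) <=
   k^2 0 + I. *)
have := key (X / (b - a)) (divr_gt0 X0 L0).
have -> : 2 * X * (X / (b - a)) = 2 * (X ^+ 2 / (b - a)) by ring.
have -> : (X / (b - a)) ^+ 2 * (b - a) = X ^+ 2 / (b - a).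
  by field; rewrite gt_eqF.
move=> h; have : X ^+ 2 / (b - a) <= I by move: h; move: (X ^+ 2 / _) => ? ?; lra.
by rewrite ler_pdivrMr// mulrC.
Qed.

Lemma sqr_sum_ord n (a : 'I_n -> R) : (\sum_i a i) ^+ 2 <= 2 ^+ n * \sum_i a i ^+ 2.
Proof.
elim: n a => [|n IH] a; first by rewrite !big_ord0 expr0n/= mulr0.
rewrite !big_ord_recl; have := IH (fun i => a (lift ord0 i)).
move: (\sum_i a _) (\sum_i _ ^+ 2) (a ord0) => s t x st.
have st2 : 2 * s ^+ 2 <= 2 ^+ n.+1 * t by rewrite [2 ^+ n.+1]exprS -mulrA ler_wpM2l.
have x2 : 2 * x ^+ 2 <= 2 ^+ n.+1 * x ^+ 2.
  by rewrite ler_wpM2r ?sqr_ge0// -[leLHS]expr1 ler_weXn2l//; lra.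
by have := sqr_ge0 (x - s); move: st2 x2; move: (2 ^+ n.+1) => q; nra.
Qed.

End fundamental_theorem_sqr.

Section dilation.
Variables (R : realType) (n : nat).
Local Notation mu := (lebesgue_rV R n).
Implicit Types (f u phi : 'rV[R]_n -> R).

(* For k = N - 2 this preserves the Dirichlet and the critical norms and multiplies
   the squared L^2 norm by c^-4; the gradient is then dilated with k = N. *)
Definition dil k (c : R) f : 'rV[R]_n -> R := fun x => c ^+ k * f (c ^+ 2 *: x).

Lemma L2_dil k (c : R) f : 0 < c -> L2 mu f -> L2 mu (dil k c f).
Proof. by move=> c0 lf; apply: L2Z; apply: L2_scale => //; rewrite exprn_gt0. Qed.

Lemma Rint_dil k (c : R) f : 0 < c -> L1 mu f ->
  (c ^+ 2) ^+ n * \int[mu]_x dil k c f x = c ^+ k * \int[mu]_x f x.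
Proof.
move=> c0 lf; have c20 : 0 < c ^+ 2 by rewrite exprn_gt0.
by rewrite RintZ; [rewrite mulrCA Rint_scale|exact: L1_scale].
Qed.

Lemma dilX k l (c : R) f x : dil k c f x ^+ l = dil (k * l) c (fun y => f y ^+ l) x.
Proof. by rewrite /dil exprMn exprM. Qed.

Lemma dilM k l (c : R) f g x : dil k c f x * dil l c g x = dil (k + l) c (fun y => f y * g y) x.
Proof. by rewrite /dil exprD mulrACA. Qed.

Lemma dilK k (c : R) f x : 0 < c -> dil k c (dil k c^-1 f) x = f x.
Proof.
move=> c0; rewrite /dil scalerA mulrA -!exprMn mulVf ?mulfV ?gt_eqF//.
by rewrite !expr1n mul1r scale1r.
Qed.

Lemma dilVK k (c : R) f x : 0 < c -> dil k c^-1 (dil k c f) x = f x.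
Proof. by move=> c0; rewrite -{2}[c]invrK dilK// invr_gt0. Qed.

Lemma has_wgrad_dil k (c : R) u g : 0 < c -> has_wgrad u g ->
  has_wgrad (dil k c u) (fun i => dil k.+2 c (g i)).
Proof.
move=> c0 [lu hu]; split; first exact: L2_dil.
move=> i; have [lg wg] := hu i; split; first exact: L2_dil.
move=> phi tp; have d0 : 0 < c^-1 by rewrite invr_gt0.
have d20 : 0 < c^-1 ^+ 2 by rewrite exprn_gt0.
have c20 : 0 < c ^+ 2 by rewrite exprn_gt0.
have tpsi := test_scale (lt0r_neq0 d20) tp.
have cdx x : c^-1 ^+ 2 *: (c ^+ 2 *: x) = x :> 'rV[R]_n.
  by rewrite scalerA -exprMn mulVf ?gt_eqF// expr1n scale1r.
have pE x : partial i phi x = c ^+ 2 * partial i (fun y => phi (c^-1 ^+ 2 *: y)) (c ^+ 2 *: x).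
  have := @partial_affine R n i (c^-1 ^+ 2) 0 phi (c ^+ 2 *: x).
  rewrite addr0 cdx; under eq_fun do rewrite addr0.
  move=> ->; last exact/smooth_diff/test_smooth.
  by rewrite mulrA -exprMn mulfV ?gt_eqF// expr1n mul1r.
set psi := fun y => _ in tpsi pE.
have lp := L2M lu (test_L2 (test_partial i tpsi)).
have lgp := L2M lg (test_L2 tpsi).
transitivity (\int[mu]_x dil k.+2 c (fun y => u y * partial i psi y) x).
  by apply: eq_Rint => x; rewrite /dil pE -(addn2 k) exprD; ring.
transitivity (- \int[mu]_x dil k.+2 c (fun y => g i y * psi y) x); last first.
  by congr (- _); apply: eq_Rint => x; rewrite /dil -mulrA /psi cdx.
have cn0 : (c ^+ 2) ^+ n != 0 by rewrite gt_eqF// exprn_gt0.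
apply: (mulfI cn0); rewrite mulrN !Rint_dil//.
by rewrite (wg _ tpsi) mulrN.
Qed.

(** The adjoint of a dilation is a multiple of the inverse one: the factor is 1 for k = N, that is
    for gradients, and c^-4 for k = N - 2. This discrepancy isolates Q(z, Z). *)
Lemma dil_adjoint k (c : R) A B : 0 < c ->
  L1 mu (fun x => dil k c^-1 A x * B x) ->
  (c ^+ 2) ^+ n * \int[mu]_x (A x * dil k c B x) =
  (c ^+ 2) ^+ k * \int[mu]_x (dil k c^-1 A x * B x).
Proof.
move=> c0 lAB; have -> : (c ^+ 2) ^+ k = c ^+ (k + k) by rewrite -exprM mul2n addnn.
have -> : \int[mu]_x (A x * dil k c B x) =
    \int[mu]_x dil (k + k) c (fun y => dil k c^-1 A y * B y) x.
  by apply: eq_Rint => x; rewrite -dilM dilK.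
by rewrite Rint_dil.
Qed.

End dilation.

(** * Lipschitz dependence of the dilation on its factor, locally in L^2 *)

Section dilation_difference.
Variables (R : realType) (n k : nat).
Local Notation mu := (lebesgue_rV R n).
Local Notation leb := (@lebesgue_measure R).
Implicit Types (f u phi : 'rV[R]_n -> R).

(** The derivative of [dil k s phi x] in s at t. The factor x in front of the gradient is the reason
    why the estimates below are confined to a cube. *)
Let dil' t phi (x : 'rV[R]_n) : R := (k%:R * t ^+ k.-1) * phi (t ^+ 2 *: x) +
  t ^+ k * \sum_i (2 * t *: x) ord0 i * partial i phi (t ^+ 2 *: x).

Lemma is_derive_sqr_scale (x : 'rV[R]_n) (t : R) :
  is_derive t (1 : R) (fun s : R => s ^+ 2 *: x) (2 * t *: x).
Proof.
have d1 : differentiable (fun s : R => s *: x) (t ^+ 2) by [].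
have d2 : is_derive t (1 : R) (fun s : R => s ^+ 2) (2 * t).
  have := is_deriveX 2 (is_derive_id t (1 : R)).
  rewrite /GRing.scale/= expr1 mulr1.
  by rewrite (_ : _ ^+ 2 = fun s : R => s ^+ 2)//; apply/funext => y; rewrite exprfctE.
have d3 : differentiable (fun s : R => s ^+ 2) t by apply/derivable1_diffP; case: d2.
have d4 : differentiable (fun s : R => s ^+ 2 *: x) t.
  exact: (@differentiable_comp _ _ _ _ (fun s : R => s ^+ 2) (fun s : R => s *: x)).
apply: DeriveDef; first exact: diff_derivable.
rewrite deriveE// (_ : (fun s : R => s ^+ 2 *: x) = (fun s : R => s *: x) \o (fun s => s ^+ 2))//.
rewrite diff_comp//= -(deriveE _ d3) derive_val.
have -> : 'd (fun s : R => s *: x) (t ^+ 2) = (fun s : R => s *: x) :> (R -> _).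
  by rewrite diff_val.
by [].
Qed.

Lemma is_derive_dil phi x (t : R) : test_function phi ->
  is_derive t (1 : R) (fun s => dil k s phi x) (dil' t phi x).
Proof.
move=> tp.
have d1 := is_derive_curve (is_derive_sqr_scale x t) (smooth_diff (test_smooth tp) (t ^+ 2 *: x)).
have d2 : is_derive t (1 : R) (fun s : R => s ^+ k) (k%:R * t ^+ k.-1).
  have := is_deriveX k (is_derive_id t (1 : R)).
  rewrite /GRing.scale/= mulr1.
  by rewrite (_ : _ ^+ k = fun s : R => s ^+ k)//; apply/funext => y; rewrite exprfctE.
have := is_deriveM d2 d1.
rewrite /GRing.scale/= => dd; rewrite /dil' addrC [k%:R * _ * _]mulrC.
exact: dd.
Qed.

Lemma dil'_continuous phi x : test_function phi -> continuous (fun t => dil' t phi x).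
Proof.
move=> tp.
have c2 : continuous (fun s : R => s ^+ 2 *: x).
  move=> t; apply: differentiable_continuous; apply/derivable1_diffP.
  by have [] := is_derive_sqr_scale x t.
have c1 psi : test_function psi -> continuous (fun t : R => psi (t ^+ 2 *: x)).
  move=> tpsi t.
  exact: (@continuous_comp _ _ _ (fun s : R => s ^+ 2 *: x) psi t (c2 t) (@test_continuous R n psi tpsi _)).
move=> t; apply: cvgD.
  apply: cvgM; last exact: c1.
  by apply: cvgM; [exact: cvg_cst|exact: (@exprn_continuous R k.-1 t)].
apply: cvgM; first exact: (@exprn_continuous R k t).
apply: cvg_big => [|i _]; first exact: add_continuous.
apply: cvgM; last exact: c1 (test_partial i tp) _.
rewrite (_ : (fun t => _) = (fun t : R => 2 * t * x ord0 i)); last by apply/funext => y; rewrite mxE.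
rewrite (_ : (2 * t *: x) ord0 i = 2 * t * x ord0 i); last by rewrite mxE.
apply: cvgM; last exact: cvg_cst.
by apply: cvgM; [exact: cvg_cst|exact: cvg_id].
Qed.

Definition density phi : 'rV[R]_n -> R := fun x => phi x ^+ 2 + \sum_i partial i phi x ^+ 2.

Lemma density_ge0 phi x : 0 <= density phi x.
Proof. by rewrite addr_ge0 ?sqr_ge0// sumr_ge0// => i _; exact: sqr_ge0. Qed.

Lemma test_density phi : test_function phi -> test_function (density phi).
Proof.
move=> tp; rewrite /density; elim: (index_enum _) => [|i s IH].
  by under eq_fun do rewrite big_nil addr0; exact: test_sqr.
under eq_fun do rewrite big_cons addrCA.
by apply: testD => //; exact/test_sqr/test_partial.
Qed.

Lemma dil'_sqr_le (r : R) : 0 <= r -> exists2 C, 0 <= C &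
  forall phi x t, `|x| <= r -> 2^-1 <= t <= 2 ->
  dil' t phi x ^+ 2 <= C * density phi (t ^+ 2 *: x).
Proof.
move=> r0; pose c1 : R := 2 * (k%:R * 2 ^+ k) ^+ 2.
pose c2 : R := 2 * ((2 ^+ k) ^+ 2 * (2 ^+ n * (4 * r) ^+ 2)).
have c10 : 0 <= c1 by rewrite mulr_ge0 ?sqr_ge0.
have c20 : 0 <= c2 by rewrite mulr_ge0// mulr_ge0 ?sqr_ge0// mulr_ge0 ?sqr_ge0// exprn_ge0.
exists (c1 + c2); first exact: addr_ge0.
move=> phi x t xr /andP[t1 t2]; have t0 : 0 <= t by lra.
rewrite /dil' /density; set y := t ^+ 2 *: x.
have tk j : 0 <= t ^+ j <= 2 ^+ j.
  by rewrite exprn_ge0//= lerXn2r// nnegrE.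
set A := k%:R * t ^+ k.-1; set S := \sum_i _ * _.
have HA : A ^+ 2 <= (k%:R * 2 ^+ k) ^+ 2.
  have /andP[a1 a2] := tk k.-1.
  rewrite lerXn2r ?nnegrE ?mulr_ge0 ?exprn_ge0// ler_wpM2l//; apply: le_trans a2 _.
  by rewrite ler_weXn2l ?leq_pred//; lra.
have HS : S ^+ 2 <= 2 ^+ n * (4 * r) ^+ 2 * \sum_i partial i phi y ^+ 2.
  apply: le_trans (sqr_sum_ord _) _; rewrite -mulrA ler_wpM2l ?exprn_ge0//.
  rewrite mulr_sumr; apply: ler_sum => i _; rewrite exprMn ler_wpM2r ?sqr_ge0//.
  rewrite mxE -[leLHS]real_normK ?num_real// lerXn2r ?nnegrE//; first by rewrite mulr_ge0.
  rewrite normrM ger0_norm ?mulr_ge0// ler_pM ?mulr_ge0//; first by lra.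
  by apply: le_trans xr; exact: coord_le_norm.
have HT : (t ^+ k) ^+ 2 <= (2 ^+ k) ^+ 2.
  by have /andP[h1 h2] := tk k; rewrite lerXn2r ?nnegrE// exprn_ge0.
have := sqr_ge0 (phi y); have : 0 <= \sum_i partial i phi y ^+ 2.
  by rewrite sumr_ge0// => i _; exact: sqr_ge0.
have h1 : (A * phi y + t ^+ k * S) ^+ 2 <= 2 * (A ^+ 2 * phi y ^+ 2) + 2 * ((t ^+ k) ^+ 2 * S ^+ 2).
  by rewrite -!exprMn; have := sqr_ge0 (A * phi y - t ^+ k * S); nra.
have h2 : 2 * (A ^+ 2 * phi y ^+ 2) <= c1 * phi y ^+ 2.
  by rewrite /c1 -[leRHS]mulrA ler_wpM2l// ler_wpM2r ?sqr_ge0.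
have h3 : 2 * ((t ^+ k) ^+ 2 * S ^+ 2) <= c2 * \sum_i partial i phi y ^+ 2.
  rewrite /c2 -[leRHS]mulrA ler_wpM2l// -[leRHS]mulrA ler_pM ?sqr_ge0//.
move=> Q0 P0; apply: (le_trans h1); move: h2 h3 Q0 P0.
move: (\sum_i _ ^+ 2) (phi y ^+ 2) => q p; move: (2 * _) (2 * _) => ? ? h2 h3 q0 p0.
by clearbody c1 c2; nra.
Qed.

Lemma four_sqr_ge1 (t : R) : 2^-1 <= t -> 1 <= 4 * t ^+ 2.
Proof. by move=> t2; nra. Qed.

(** For fixed x the difference is the integral of [dil'] over [a, b], and its square gains one
    factor b - a. The other comes from Fubini; undoing the scaling by t^2 >= 1/4 costs 4^n. *)
Lemma dil_sqr_diff_le (r : R) : 0 <= r -> exists2 C, 0 <= C &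
  forall phi (a b : R), test_function phi -> 2^-1 <= a -> a <= b -> b <= 2 ->
  \int[mu]_x (\1_(@cube R n r) x * (dil k b phi x - dil k a phi x) ^+ 2) <=
  C * (b - a) ^+ 2 * \int[mu]_x density phi x.
Proof.
move=> r0; have [C C0 hC] := dil'_sqr_le r0.
exists (C * 4 ^+ n) => [|phi a b tp a2 ab b2]; first by rewrite mulr_ge0// exprn_ge0.
set P := density phi; have tP : test_function P := test_density tp.
have P0 x : 0 <= P x := density_ge0 phi x.
have lP : L1 mu P := test_L1 tP.
have IP0 : 0 <= \int[mu]_x P x by exact: Rint_ge0.
pose I := \1_(`[a, b]%classic) : R -> R.
have lI : L1 leb I by exact: (L1_indic _ (lebesgue_itvE ab)).
have iI : \int[leb]_t I t = b - a by exact: (Rint_indic _ (lebesgue_itvE ab)).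
have I0 t : 0 <= I t by rewrite /I indicE.
have It t : I t != 0 -> a <= t <= b.
  rewrite /I indicE; case: (boolP (t \in _)) => [/set_mem/=|]; first by rewrite in_itv.
  by rewrite eqxx.
pose F (p : 'rV[R]_n * measurableTypeR R) := I p.2 * P (p.2 ^+ 2 *: p.1).
have F0 p : 0 <= F p by rewrite mulr_ge0.
have mF : measurable_fun setT F.
  apply: measurable_funM; first exact: (measurableT_comp (L1_meas lI) measurable_snd).
  apply: (measurableT_comp (test_meas tP)).
  apply: measurable_fun_rVP => i; under eq_fun do rewrite mxE.
  apply: measurable_funM; first by apply: measurable_funX; exact: measurable_snd.
  exact: (measurableT_comp (measurable_coord i) measurable_fst).
have lFx t : L1 mu (fun x => F (x, t)).
  have [/eqP It0|/It/andP[at1 _]] := boolP (I t == 0).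
    by rewrite /F/=; under eq_fun do rewrite It0 mul0r; exact: L1_0.
  rewrite /F/=; apply: L1Z; apply: (@L1_scale R n) => //.
  by rewrite exprn_gt0//; lra.
have iFx t : \int[mu]_x F (x, t) <= I t * (4 ^+ n * \int[mu]_x P x).
  have [/eqP It0|/It/andP[at1 _]] := boolP (I t == 0).
    rewrite /F/=; under eq_Rintegral do rewrite It0 mul0r.
    by rewrite It0 mul0r /Rintegral integral0.
  have t0 : 0 < t by lra.
  have t20 : 0 < t ^+ 2 by rewrite exprn_gt0.
  rewrite /F/= RintZ; last exact: L1_scale.
  rewrite ler_wpM2l// -(Rint_scale t20 lP) mulrA -exprMn.
  have q0 : 0 <= \int[mu]_x P (t ^+ 2 *: x) by exact: Rint_ge0.
  have t4 := four_sqr_ge1 (le_trans a2 at1).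
  by rewrite -[leLHS]mul1r ler_wpM2r// exprn_ege1.
have [M M0 hM] := test_bounded tP.
have lFt x : L1 leb (fun t => F (x, t)).
  apply: (L1_dom _ _ (L1Z M lI)).
    apply: measurable_funM; first exact: L1_meas lI.
    apply: (measurableT_comp (test_meas tP)).
    apply: measurable_fun_rVP => i; under eq_fun do rewrite mxE.
    by apply: measurable_funM => //; apply: measurable_funX; exact: measurable_id.
  by move=> t; rewrite ger0_norm// /F/= [leLHS]mulrC ler_wpM2r//; apply: le_trans (hM _); exact: ler_norm.
have mEF : measurable_fun setT (EFin \o F) by exact/measurable_EFinP.
have lK := L1Z (4 ^+ n * \int[mu]_x P x) lI.
have mG : measurable_fun setT (fun t => \int[mu]_x F (x, t)).
  have h := @measurable_fun_fubini_tonelli_G _ _ _ _ R mu _ mEF (fun p => F0 _).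
  apply/measurable_EFinP; move: h.
  rewrite (_ : fubini_G _ _ = EFin \o (fun t => \int[mu]_x F (x, t)))//.
  by apply/funext => t /=; rewrite /fubini_G/= -RintE.
have lG : L1 leb (fun t => \int[mu]_x F (x, t)).
  apply: (L1_dom mG _ lK) => t; rewrite ger0_norm ?Rint_ge0//.
  by rewrite mulrC.
have lF : L1 (mu \x leb)%E F.
  apply/(integrable21ltyP mu leb mEF).
  rewrite (_ : (\int[leb]_y _)%E = (\int[leb]_t (\int[mu]_x F (x, t))%:E)%E).
    by rewrite -RintE// ltry.
  apply: eq_integral => t _; rewrite RintE//; apply: eq_integral => x _ /=.
  by rewrite ger0_norm.
pose J x := \int[leb]_t F (x, t).
have lJ : L1 mu J.
  have := integrable_fubini_F lF; rewrite (_ : fubini_F _ _ = EFin \o J)//.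
  by apply/funext => x; rewrite /fubini_F/= -RintE.
have iJ : \int[mu]_x J x <= (b - a) * (4 ^+ n * \int[mu]_x P x).
  rewrite /J Rint_Fubini// mulrC -iI -RintZ//; apply: Rint_le => // t.
  by rewrite mulrC.
have lc := L1_cube_indic n r0.
have ld : L2 mu (fun x => dil k b phi x - dil k a phi x).
  by apply: L2B; apply: L2_dil; [lra|exact: test_L2|lra|exact: test_L2].
apply: (@le_trans _ _ (\int[mu]_x ((b - a) * C * J x))).
  apply: Rint_le; [|exact: L1Z|].
    apply: (L1_dom _ _ (L2_sqr ld)).
      by apply: measurable_funM (L1_meas lc) (L1_meas (L2_sqr ld)).
    move=> x; rewrite normrM [`|_ ^+ 2|]ger0_norm ?sqr_ge0// ler_piMl ?sqr_ge0//.
    by rewrite indicE; case: (_ \in _); rewrite ?normr1 ?normr0.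
  move=> x; rewrite indicE; case: (boolP (x \in _)) => [/set_mem/cubeP|_]; last first.
    rewrite mul0r mulr_ge0//; first by rewrite mulr_ge0// subr_ge0.
    exact: Rint_ge0.
  move=> /(_ r0) xr; rewrite mul1r -mulrA -RintZ//.
  apply: (@sqr_diff_le_Rint R (fun t => dil k t phi x) (fun t => dil' t phi x)) => //.
  - by move=> t _; exact: is_derive_dil.
  - by apply: continuous_subspaceT; exact: dil'_continuous.
  - exact: L1Z.
  - by move=> t; rewrite mulr_ge0.
  - move=> t tab; rewrite /F/= /I indicE mem_set/= ?mul1r ?in_itv//.
    by apply: hC => //; lra.
rewrite RintZ//; set Q := \int[mu]_x P x in iJ IP0 *.
apply: (@le_trans _ _ ((b - a) * C * ((b - a) * (4 ^+ n * Q)))).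
  by rewrite ler_wpM2l// mulr_ge0// subr_ge0.
by rewrite le_eqVlt; apply/orP; left; apply/eqP; ring.
Qed.

End dilation_difference.

Section dilation_local.
Variables (R : realType) (n k : nat).
Local Notation mu := (lebesgue_rV R n).
Implicit Types (f u phi : 'rV[R]_n -> R).

Lemma dil_sqr_le (c : R) f : 2^-1 <= c -> c <= 2 -> L2 mu f ->
  \int[mu]_x dil k c f x ^+ 2 <= (4 ^+ k * 4 ^+ n) * \int[mu]_x f x ^+ 2.
Proof.
move=> c1 c2 lf; have c0 : 0 < c by lra.
have I0 : 0 <= \int[mu]_x dil k c f x ^+ 2 by apply: Rint_ge0 => x; exact: sqr_ge0.
have J0 : 0 <= \int[mu]_x f x ^+ 2 by apply: Rint_ge0 => x; exact: sqr_ge0.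
have := Rint_dil (k * 2) c0 (L2_sqr lf).
rewrite -(eq_Rint _ (fun x => dilX k 2 c f x)).
have c4 : 1 <= (4 * c ^+ 2) ^+ n by rewrite exprn_ege1// four_sqr_ge1.
have ck : c ^+ (k * 2) <= 4 ^+ k.
  rewrite mulnC exprM lerXn2r ?nnegrE ?sqr_ge0//.
  by have := lerXn2r 2 (ltW c0 : c \is Num.nneg) (ler0n R 2 : 2 \is Num.nneg) c2; lra.
move: I0 J0; move: (\int[mu]_x _) (\int[mu]_x f x ^+ 2) => I J I0 J0 e.
rewrite mulrAC; apply: (@le_trans _ _ (c ^+ (k * 2) * J * 4 ^+ n)); last first.
  by rewrite ler_wpM2r ?exprn_ge0// ler_wpM2r.
by rewrite -e mulrAC [_ * 4 ^+ n]mulrC -exprMn -[leLHS]mul1r ler_wpM2r.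
Qed.

Lemma dil_local u g (r : R) : has_wgrad u g -> 0 <= r -> exists2 C, 0 <= C &
  forall c, 2^-1 <= c -> c <= 2 ->
  \int[mu]_x (\1_(@cube R n r) x * (dil k c u x - u x) ^+ 2) <= C * (c - 1) ^+ 2.
Proof.
move=> hu r0; have [C C0 hC] := dil_sqr_diff_le n k r0.
have [lu hg] := hu; have lg i : L2 mu (g i) by have [] := hg i.
pose K : R := 4 ^+ k * 4 ^+ n; have K0 : 0 <= K by rewrite mulr_ge0 ?exprn_ge0.
pose E := \int[mu]_x u x ^+ 2 + \sum_i \int[mu]_x g i x ^+ 2.
have E0 : 0 <= E.
  by rewrite addr_ge0 ?sumr_ge0// => [|i _]; apply: Rint_ge0 => x; exact: sqr_ge0.
exists (3 * (K + C * (2 * (E + n.+1%:R)) + 1)).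
  by rewrite mulr_ge0// addr_ge0// addr_ge0// mulr_ge0// mulr_ge0// addr_ge0.
move=> c c1 c2; have c0 : 0 < c by lra.
have [->|cn1] := eqVneq c 1.
  rewrite subrr expr0n/= mulr0 /Rintegral integral0_eq// => x _.
  by rewrite /dil !expr1n scale1r mul1r subrr expr0n/= mulr0.
(* The squared error allowed in the approximation by a test function has the size of the bound to be
   proved, so the test function depends on c; only its H^1 norm must be bounded uniformly. *)
pose e := (c - 1) ^+ 2; have e0 : 0 < e by rewrite exprn_even_gt0//= subr_eq0.
have e1 : e <= 1 by rewrite /e; nra.
have [phi [tp up gp]] := test_dense hu e0.
have lp := test_L2 tp; have lpi i := test_L2 (test_partial i tp).
have iD : \int[mu]_x density phi x <= 2 * (E + n.+1%:R).
  have approx f f' : L2 mu f -> L2 mu f' -> \int[mu]_x (f x - f' x) ^+ 2 <= e ->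
      \int[mu]_x f' x ^+ 2 <= 2 * (\int[mu]_x f x ^+ 2 + 1).
    move=> lf lf' he.
    rewrite (eq_Rint _ (g := fun x => (f x + (f' x - f x)) ^+ 2)); last by move=> x; rewrite subrKC.
    apply: le_trans (Rint_sqrD lf (L2B lf' lf)) _; rewrite ler_wpM2l// lerD2l.
    apply: le_trans e1; apply: le_trans he.
    by rewrite le_eqVlt; apply/orP; left; apply/eqP; apply: eq_Rint => x; rewrite -sqrrN opprB.
  rewrite /density RintD; [|exact: L2_sqr|by apply: L1_sum => i; exact: L2_sqr].
  rewrite Rint_sum; last by move=> i; exact: L2_sqr.
  rewrite /E -[n.+1%:R]natr1 [n%:R + 1]addrC addrACA mulrDr; apply: lerD; first exact: approx.
  rewrite (_ : n%:R = \sum_(i < n) 1); last by rewrite sumr_const card_ord.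
  by rewrite -big_split mulr_sumr; apply: ler_sum => i _; apply: approx.
have lc := L1_cube_indic n r0.
have lcut f : L2 mu f -> L1 mu (fun x => \1_(@cube R n r) x * f x ^+ 2).
  move=> lf; apply: (L1_dom _ _ (L2_sqr lf)).
    by apply: measurable_funM (L1_meas lc) (L1_meas (L2_sqr lf)).
  move=> x; rewrite normrM [`|_ ^+ 2|]ger0_norm ?sqr_ge0// ler_piMl ?sqr_ge0//.
  by rewrite indicE; case: (_ \in _); rewrite ?normr1 ?normr0.
have lup : L2 mu (fun x => u x - phi x) by exact: L2B.
have ld : L2 mu (dil k c (fun x => u x - phi x)) by exact: L2_dil.
have lb : L2 mu (fun x => dil k c phi x - phi x) by apply: L2B => //; exact: L2_dil.
have lu1 : L2 mu (fun x => dil k c u x - u x) by apply: L2B => //; exact: L2_dil.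
apply: (@le_trans _ _ (\int[mu]_x (3 * (dil k c (fun x => u x - phi x) x ^+ 2 +
    \1_(@cube R n r) x * (dil k c phi x - phi x) ^+ 2 + (u x - phi x) ^+ 2)))).
  apply: Rint_le; first exact: lcut.
    by apply: L1Z; apply: L1D; [apply: L1D; [exact: L2_sqr|exact: lcut]|exact: L2_sqr].
  move=> x; rewrite (_ : dil k c (fun x => u x - phi x) x = dil k c u x - dil k c phi x); last first.
    by rewrite /dil mulrBr.
  rewrite indicE; move: (dil _ _ u x) (dil _ _ phi x) (u x) (phi x) => a b d f.
  case: (_ \in _); rewrite ?mul1r ?mul0r ?addr0; last first.
    by rewrite mulr_ge0// addr_ge0 ?sqr_ge0.
  have := sqr_ge0 ((a - b) - (b - f)); have := sqr_ge0 ((a - b) + (d - f)).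
  by have := sqr_ge0 ((b - f) + (d - f)); nra.
have l1 : L1 mu (fun x => dil k c (fun x => u x - phi x) x ^+ 2 +
    \1_(@cube R n r) x * (dil k c phi x - phi x) ^+ 2).
  by apply: L1D; [exact: L2_sqr|exact: lcut].
rewrite RintZ; last by apply: L1D => //; exact: L2_sqr.
rewrite -mulrA ler_wpM2l// RintD//; last exact: L2_sqr.
rewrite RintD; [|exact: L2_sqr|exact: lcut].
rewrite [leRHS]mulrDl [X in _ <= X + _]mulrDl mul1r; apply: lerD => //; apply: lerD.
  apply: le_trans (dil_sqr_le c1 c2 lup) _; exact: ler_wpM2l.
have lb2 : \int[mu]_x (\1_(@cube R n r) x * (dil k c phi x - phi x) ^+ 2) <=
    C * (c - 1) ^+ 2 * \int[mu]_x density phi x.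
  have d1 x : dil k 1 phi x = phi x by rewrite /dil !expr1n scale1r mul1r.
  have [c11|c11] := lerP 1 c.
    have := hC phi 1 c tp; under eq_Rintegral do rewrite d1.
    by apply => //; lra.
  have := hC phi c 1 tp; rewrite -[(1 - c) ^+ 2]sqrrN opprB.
  rewrite (eq_Rint _ (g := fun x => \1_(@cube R n r) x * (dil k c phi x - phi x) ^+ 2)).
    by apply => //; lra.
  by move=> x; rewrite d1 -[(phi x - _) ^+ 2]sqrrN opprB.
apply: le_trans lb2 _; rewrite [leLHS]mulrAC ler_wpM2r ?sqr_ge0//.
by rewrite ler_wpM2l.
Qed.

End dilation_local.

Section critical_dilation.
Variables (R : realType) (m h : nat).
Hypothesis hm : (m = 1 /\ h = 2 \/ m = 2 /\ h = 1)%N.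
Local Notation N := m.+2.
Local Notation mu := (lebesgue_rV R N).
Implicit Types (u v A B : 'rV[R]_N -> R) (g : 'I_N -> 'rV[R]_N -> R).

Let c2N (c : R) : 0 < c -> (c ^+ 2) ^+ N != 0.
Proof. by move=> c0; rewrite gt_eqF// !exprn_gt0. Qed.

Let crit : (m * h.+1 = N)%N. Proof. by case: hm => -[-> ->]. Qed.

Lemma energy_dil (c : R) g : 0 < c -> (forall i, L2 mu (g i)) ->
  energy (fun i => dil N c (g i)) = energy g.
Proof.
move=> c0 lg; apply: eq_bigr => i _; apply: (mulfI (c2N c0)).
rewrite (eq_Rint _ (fun x => dilX N 2 c (g i) x)) Rint_dil//; last exact: L2_sqr.
by rewrite -exprM [(N * 2)%N]mulnC.
Qed.

Lemma Rint_dil_pow (c : R) u : 0 < c -> L1 mu (fun x => (u x ^+ 2) ^+ h.+1) ->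
  \int[mu]_x (dil m c u x ^+ 2) ^+ h.+1 = \int[mu]_x (u x ^+ 2) ^+ h.+1.
Proof.
move=> c0 lu; apply: (mulfI (c2N c0)).
rewrite (eq_Rint _ (g := dil (m * 2 * h.+1) c (fun x => (u x ^+ 2) ^+ h.+1))); last first.
  by move=> x; rewrite dilX dilX.
by rewrite Rint_dil// -exprM; congr (_ ^+ _ * _); rewrite mulnAC crit mulnC.
Qed.

Lemma dil_grad_adjoint (c : R) A B : 0 < c -> L2 mu A -> L2 mu B ->
  \int[mu]_x (A x * dil N c B x) = \int[mu]_x (dil N c^-1 A x * B x).
Proof.
move=> c0 lA lB; apply: (mulfI (c2N c0)); rewrite dil_adjoint//.
by apply: L2M => //; apply: L2_dil => //; rewrite invr_gt0.
Qed.

Lemma dil_L2_adjoint (c : R) A B : 0 < c -> L2 mu A -> L2 mu B ->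
  c ^+ 4 * \int[mu]_x (A x * dil m c B x) = \int[mu]_x (dil m c^-1 A x * B x).
Proof.
move=> c0 lA lB; have cm0 : (c ^+ 2) ^+ m != 0 by rewrite gt_eqF// !exprn_gt0.
have lAB : L1 mu (fun x => dil m c^-1 A x * B x).
  by apply: L2M => //; apply: L2_dil => //; rewrite invr_gt0.
apply: (mulfI cm0); rewrite -(dil_adjoint c0 lAB).
by rewrite mulrA; congr (_ * _); rewrite -!exprM -exprD; congr (_ ^+ _); ring.
Qed.

(** At the critical exponent, m (h + 1) = N, the powers of c from the dilated u^(2h+1) and from the
    Jacobian cancel. *)
Lemma dil_pow_adjoint (c : R) u g : 0 < c -> has_wgrad u g ->
  let U := dil m c^-1 u in
  \int[mu]_x (u x ^+ h.+1 * (u x ^+ h * dil m c u x)) =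
  \int[mu]_x (U x ^+ h.+1 * (U x ^+ h * u x)).
Proof.
move=> c0 hu U; have d0 : 0 < c^-1 by rewrite invr_gt0.
have hU := has_wgrad_dil m d0 hu.
have lU := L2M (L2_powS hm hU) (L2_powM hm hU hu).
have hE x : dil m c^-1 (fun y => u y ^+ h.+1 * u y ^+ h) x * u x =
    c ^+ (2 * m * h) * (U x ^+ h.+1 * (U x ^+ h * u x)).
  rewrite /U /dil; move: (u (c^-1 ^+ 2 *: x)) (u x) => p b; set D := c^-1 ^+ m.
  have e : c ^+ (2 * m * h) * (D ^+ h * D ^+ h) = 1.
    rewrite -exprD addnn -mul2n -exprM mulnCA mulnA -exprMn mulfV ?gt_eqF//.
    by rewrite expr1n.
  transitivity (c ^+ (2 * m * h) * (D ^+ h * D ^+ h) * (D * (p ^+ h.+1 * p ^+ h) * b)).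
    by rewrite e mul1r.
  by rewrite !exprMn [D ^+ h.+1]exprS; ring.
apply: (mulfI (c2N c0)).
under eq_Rintegral do rewrite mulrA.
rewrite dil_adjoint//; last by under eq_fun do rewrite hE; exact: L1Z.
rewrite (eq_Rint _ hE) RintZ// mulrA; congr (_ * _).
rewrite -!exprM -exprD; congr (_ ^+ _); rewrite -mulnA -mulnDr -mulnS crit//.
Qed.

Lemma dil_potential (c : R) u g : 0 < c -> has_wgrad u g ->
  let U := dil m c^-1 u in
  \int[mu]_x ((U x ^+ 2) ^+ h * (u x - U x) ^+ 2) =
  \int[mu]_x ((u x ^+ 2) ^+ h * (dil m c u x - u x) ^+ 2).
Proof.
move=> c0 hu U; have d0 : 0 < c^-1 by rewrite invr_gt0.
have hw := has_wgradB (has_wgrad_dil m c0 hu) hu.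
have [l1 _] := hoelder_potential (L2_meas hu.1) (L2_meas hw.1)
  (sobolev_energy hm hu).1 (sobolev_energy hm hw).1.
apply: (mulfI (c2N d0)).
rewrite -[in RHS](_ : c^-1 ^+ (m * 2 * h + m * 2) = (c^-1 ^+ 2) ^+ N); last first.
  rewrite -exprM; congr (_ ^+ _).
  by rewrite -mulnSr mulnAC crit mulnC.
rewrite -(Rint_dil (m * 2 * h + m * 2) d0 l1); congr (_ * _); apply: eq_Rint => x.
rewrite -dilM -!dilX; congr (_ * (_ ^+ _)).
by rewrite [RHS]mulrBr; congr (_ - _); exact/esym/dilVK.
Qed.

(* The term with U is pulled back by the dilation, which leaves the fixed
   potential u^(2h). *)
Definition remainder_potential (U u : 'rV[R]_N -> R) : R :=
  \int[mu]_x ((u x ^+ 2) ^+ h * (u x - U x) ^+ 2) +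
  \int[mu]_x ((U x ^+ 2) ^+ h * (u x - U x) ^+ 2).

(** After [dil_potential] both summands carry the potential u^(2h), so [potential_small] provides M
    and a cube that do not depend on T; on that cube [dil_local] applies to T and to 1/T. *)
Lemma remainder_potential_le u g (dlt : R) : has_wgrad u g -> 0 < dlt ->
  exists2 M, 0 <= M & forall T : R, 1 < T -> T <= 2 ->
  remainder_potential (dil m T^-1 u) u <=
  dlt * energy (fun i x => g i x - dil N T^-1 (g i) x) + M * (T - 1) ^+ 2.
Proof.
move=> hu d0; have d20 : 0 < dlt / 2 by rewrite divr_gt0.
have [M [r [M0 r0 hM]]] := potential_small hm (L2_meas hu.1) (sobolev_energy hm hu).1 d20.
have [C C0 hC] := dil_local m hu r0.
exists (2 * (M * C)) => [|T T1 T2]; first by rewrite !mulr_ge0.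
have T0 : 0 < T by lra.
have d1 : 0 < T^-1 by rewrite invr_gt0.
have hU := has_wgrad_dil m d1 hu; have hU' := has_wgrad_dil m T0 hu.
rewrite /remainder_potential (dil_potential T0 hu).
have p1 := hM _ _ (has_wgradB hu hU); have p2 := hM _ _ (has_wgradB hU' hu).
have eE : energy (fun i x => dil N T (g i) x - g i x) =
    energy (fun i x => g i x - dil N T^-1 (g i) x).
  rewrite -(energy_dil d1); last first.
    by move=> i; have [_ /(_ i)[]] := has_wgradB hU' hu.
  congr energy; apply/funext => i; apply/funext => x.
  by rewrite [LHS]mulrBr; congr (_ - _); exact: dilVK.
rewrite eE in p2.
have T2' : 2^-1 <= T^-1 by rewrite lef_pV2 ?posrE.
have T1' : T^-1 <= 1 by rewrite invf_le1// ltW.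
have e1 : (T^-1 - 1) ^+ 2 <= (T - 1) ^+ 2.
  rewrite -[(T^-1 - 1) ^+ 2]sqrrN opprB lerXn2r ?nnegrE ?subr_ge0 ?(ltW T1)//.
  have : T * T^-1 = 1 by rewrite mulfV ?gt_eqF.
  by move: T1 T1' d1; move: T^-1 => s; nra.
have h1 : \int[mu]_x (\1_(cube r) x * (dil m T u x - u x) ^+ 2) <= C * (T - 1) ^+ 2.
  by apply: hC; lra.
have h2 : \int[mu]_x (\1_(cube r) x * (u x - dil m T^-1 u x) ^+ 2) <= C * (T - 1) ^+ 2.
  rewrite (eq_Rint _ (g := fun x => \1_(cube r) x * (dil m T^-1 u x - u x) ^+ 2)); last first.
    by move=> x; rewrite -[(u x - _) ^+ 2]sqrrN opprB.
  apply: le_trans (hC T^-1 _ _) _ => //; first by lra.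
  by rewrite ler_wpM2l.
apply: le_trans (lerD p1 p2) _.
apply: le_trans (lerD (lerD (lexx _) (ler_wpM2l M0 h2)) (lerD (lexx _) (ler_wpM2l M0 h1))) _.
by rewrite le_eqVlt; apply/orP; left; apply/eqP; field.
Qed.

(** The difference of powers supplies a second factor x - y. With x = u and y = U the left side
    integrates to 2 S - I1 - I2. *)
Lemma pow_diff_le (x y : R) : (x - y) * (x ^+ (2 * h).+1 - y ^+ (2 * h).+1) <=
  5 * (((x ^+ 2) ^+ h * (x - y) ^+ 2) + ((y ^+ 2) ^+ h * (x - y) ^+ 2)).
Proof.
case: hm => -[_ ->] /=; last first.
  have -> : (x - y) * (x ^+ 3 - y ^+ 3) = (x - y) ^+ 2 * (x ^+ 2 + x * y + y ^+ 2) by ring.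
  have -> : 5 * ((x ^+ 2) ^+ 1 * (x - y) ^+ 2 + (y ^+ 2) ^+ 1 * (x - y) ^+ 2) =
    (x - y) ^+ 2 * (5 * (x ^+ 2 + y ^+ 2)) by ring.
  by rewrite ler_wpM2l ?sqr_ge0//; have := sqr_ge0 (x - y); nra.
have -> : (x - y) * (x ^+ 5 - y ^+ 5) =
    (x - y) ^+ 2 * (x ^+ 4 + x * y * (x ^+ 2 + y ^+ 2) + (x * y) ^+ 2 + y ^+ 4) by ring.
have -> : 5 * ((x ^+ 2) ^+ 2 * (x - y) ^+ 2 + (y ^+ 2) ^+ 2 * (x - y) ^+ 2) =
  (x - y) ^+ 2 * (5 * ((x ^+ 2) ^+ 2 + (y ^+ 2) ^+ 2)) by ring.
rewrite ler_wpM2l ?sqr_ge0//.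
have xy : 2 * (x * y) <= x ^+ 2 + y ^+ 2 by have := sqr_ge0 (x - y); nra.
have -> : x ^+ 4 = (x ^+ 2) ^+ 2 by rewrite -exprM.
have -> : y ^+ 4 = (y ^+ 2) ^+ 2 by rewrite -exprM.
rewrite [(x * y) ^+ 2]exprMn; move: (sqr_ge0 x) (sqr_ge0 y) xy.
move: (x ^+ 2) (y ^+ 2) (x * y) => a b c a0 b0 xy; have := sqr_ge0 (a - b);
  have : 0 <= (a + b) * (a + b - 2 * c) by apply: mulr_ge0; lra.
by have := sqr_ge0 a; have := sqr_ge0 b; lra.
Qed.

(* The difference of powers has integral 0 when y is a dilation of x; without it
   the bound would only be linear in x - y. *)
Lemma pow_skew_diff_le (x y : R) :
  x ^+ (2 * h).+1 * y - y ^+ (2 * h).+1 * x -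
    h%:R / h.+1%:R * ((x ^+ 2) ^+ h.+1 - (y ^+ 2) ^+ h.+1) <=
  5 * (((x ^+ 2) ^+ h * (x - y) ^+ 2) + ((y ^+ 2) ^+ h * (x - y) ^+ 2)).
Proof.
(* The coefficient h/(h+1) is the one that gives the left side a double zero at x = y; the factor (x
   - y)^2 is then split off. *)
case: hm => -[_ ->] /=; last first.
  have -> : x ^+ 3 * y - y ^+ 3 * x - 1 / 2 * ((x ^+ 2) ^+ 2 - (y ^+ 2) ^+ 2) =
    (x - y) ^+ 2 * ((y ^+ 2 - x ^+ 2) / 2) by field.
  have -> : 5 * ((x ^+ 2) ^+ 1 * (x - y) ^+ 2 + (y ^+ 2) ^+ 1 * (x - y) ^+ 2) =
    (x - y) ^+ 2 * (5 * (x ^+ 2 + y ^+ 2)) by ring.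
  by rewrite ler_wpM2l ?sqr_ge0//; have := sqr_ge0 x; have := sqr_ge0 y; lra.
have -> : x ^+ 5 * y - y ^+ 5 * x - 2 / 3 * ((x ^+ 2) ^+ 3 - (y ^+ 2) ^+ 3) =
    (x - y) ^+ 2 * ((y ^+ 2 - x ^+ 2) * (2 * x ^+ 2 + x * y + 2 * y ^+ 2) / 3) by field.
have -> : 5 * ((x ^+ 2) ^+ 2 * (x - y) ^+ 2 + (y ^+ 2) ^+ 2 * (x - y) ^+ 2) =
  (x - y) ^+ 2 * (5 * ((x ^+ 2) ^+ 2 + (y ^+ 2) ^+ 2)) by ring.
rewrite ler_wpM2l ?sqr_ge0//.
have xy : 2 * (x * y) <= x ^+ 2 + y ^+ 2 by have := sqr_ge0 (x - y); nra.
have xy' : - (2 * (x * y)) <= x ^+ 2 + y ^+ 2 by have := sqr_ge0 (x + y); nra.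
move: (sqr_ge0 x) (sqr_ge0 y) xy xy'.
move: (x ^+ 2) (y ^+ 2) (x * y) => a b c a0 b0 xy xy'.
case: (leP b a) => ab.
  have : 0 <= (a - b) * (2 * a + c + 2 * b) by rewrite mulr_ge0 ?subr_ge0//; lra.
  by have := sqr_ge0 a; have := sqr_ge0 b; nra.
have : (b - a) * (2 * a + c + 2 * b) <= (b - a) * (3 * a + 3 * b).
  by rewrite ler_wpM2l ?subr_ge0 ?(ltW ab)//; lra.
by have := sqr_ge0 a; have := sqr_ge0 b; nra.
Qed.

End critical_dilation.

(** * The inequality Q(z) <= 0 *)

Section pohozaev.
Variables (R : realType) (m h : nat).
Hypothesis hm : (m = 1 /\ h = 2 \/ m = 2 /\ h = 1)%N.
Local Notation N := m.+2.
Local Notation mu := (lebesgue_rV R N).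
Implicit Types (u v U : 'rV[R]_N -> R) (g G : 'I_N -> 'rV[R]_N -> R).

Lemma nonlinear_remainders u g U G : has_wgrad u g -> has_wgrad U G ->
  \int[mu]_x (U x ^+ 2) ^+ h.+1 = \int[mu]_x (u x ^+ 2) ^+ h.+1 ->
  let S := \int[mu]_x (u x ^+ 2) ^+ h.+1 in
  let I1 := \int[mu]_x (u x ^+ h.+1 * (u x ^+ h * U x)) in
  let I2 := \int[mu]_x (U x ^+ h.+1 * (U x ^+ h * u x)) in
  is_true (2 * S - I1 - I2 <= 5 * remainder_potential h U u) /\
  is_true (I1 - I2 <= 5 * remainder_potential h U u).
Proof.
move=> hu hU eS S I1 I2.
have lu := (sobolev_energy hm hu).1; have lU := (sobolev_energy hm hU).1.
have l1 : L1 mu (fun x => u x ^+ h.+1 * (u x ^+ h * U x)).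
  exact: L2M (L2_powS hm hu) (L2_powM hm hu hU).
have l2 : L1 mu (fun x => U x ^+ h.+1 * (U x ^+ h * u x)).
  exact: L2M (L2_powS hm hU) (L2_powM hm hU hu).
have hw := has_wgradB hu hU.
have [p1 _] := hoelder_potential (L2_meas hu.1) (L2_meas hw.1) lu (sobolev_energy hm hw).1.
have [p2 _] := hoelder_potential (L2_meas hU.1) (L2_meas hw.1) lU (sobolev_energy hm hw).1.
rewrite /remainder_potential -RintD// -RintZ; last exact: L1D.
have lR := L1Z 5 (L1D p1 p2).
have pE (x y : R) : x ^+ h.+1 * (x ^+ h * y) = x ^+ (2 * h).+1 * y.
  by rewrite mulrA -exprD addSn addnn mul2n.
split.
- have -> : 2 * S - I1 - I2 = \int[mu]_x ((u x ^+ 2) ^+ h.+1 + (U x ^+ 2) ^+ h.+1 -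
    u x ^+ h.+1 * (u x ^+ h * U x) - U x ^+ h.+1 * (U x ^+ h * u x)).
    rewrite RintB//; last by apply: L1B => //; exact: L1D.
    rewrite RintB//; last exact: L1D.
    by rewrite RintD// eS -/S -/I1 -/I2; ring.
  apply: Rint_le => //; first by apply: L1B => //; apply: L1B => //; exact: L1D.
  move=> x; apply: le_trans (pow_diff_le hm (u x) (U x)); rewrite !pE.
  rewrite le_eqVlt; apply/orP; left; apply/eqP.
  by case: hm => -[_ ->] /=; ring.
- have -> : I1 - I2 = \int[mu]_x (u x ^+ h.+1 * (u x ^+ h * U x) -
      U x ^+ h.+1 * (U x ^+ h * u x) -
      h%:R / h.+1%:R * ((u x ^+ 2) ^+ h.+1 - (U x ^+ 2) ^+ h.+1)).
    rewrite RintB//; [|exact: L1B|by apply: L1Z; exact: L1B].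
    rewrite RintB// RintZ; last exact: L1B.
    by rewrite RintB// eS subrr mulr0 subr0.
  apply: Rint_le => //; first by apply: L1B; [exact: L1B|apply: L1Z; exact: L1B].
  by move=> x; rewrite !pE; exact: (pow_skew_diff_le hm).
Qed.

(* t = T^4 and s = T^-4 for the dilation factor T; Q, Qz and Qw are the values of
   the quadratic form at z = (u, v), at (z, Z) and at z - Z, where Z is the dilation
   of z; K and P are the Dirichlet forms at z and (z, Z), and D that at z - Z. *)
Lemma dilation_algebra (K P Q Qz Qw S I1 I2 D W t s e tau M k : R) :
  s * t = 1 -> 1 <= t -> 0 < s -> K + Q = S -> P + Qz = I1 -> P + s * Qz = I2 ->
  D = 2 * K - 2 * P -> Qw = (1 + t) * Q - 2 * Qz -> 0 <= Qw -> 0 <= Q ->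
  2 * S - I1 - I2 <= W -> I1 - I2 <= W -> W <= D / 2 + M * e ->
  (t + s) / 2 - 1 <= k * e -> tau <= t - s ->
  tau * Q <= (2 * k * Q + 4 * M) * e.
Proof.
move=> st t1 s0 KQ e1 e2 eD eQ Qw0 Q0 W1 W2 W3 kk tt.
have sQw : 0 <= s * Qw by rewrite mulr_ge0// ltW.
have sQ : s * Qw = (s + 1) * Q - 2 * (s * Qz) by have := mul1r Q; rewrite -{1}st eQ; lra.
(* 2 S - I1 - I2 equals D + 2 Q - (1 + s) Qz. Qz is expressed through Q and Qw, and D is bounded
   below by 2 W - 2 M e. *)
have h1 : W + Qw / 2 <= ((t + s) / 2 - 1) * Q + 2 * (M * e) by lra.
(* I1 - I2 equals (1 - s) Qz, that is (t - s) Q / 2 - (1 - s) Qw / 2. *)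
have h2 : (t - s) * Q <= 2 * (W + Qw / 2) by lra.
have h3 : tau * Q <= (t - s) * Q by rewrite ler_wpM2r.
have h4 : ((t + s) / 2 - 1) * Q <= k * e * Q by rewrite ler_wpM2r.
by nra.
Qed.

Definition grad_product g G : R := \sum_i \int[mu]_x (g i x * G i x).

Lemma energyB g G : (forall i, L2 mu (g i)) -> (forall i, L2 mu (G i)) ->
  energy (fun i x => g i x - G i x) = energy g + energy G - 2 * grad_product g G.
Proof.
move=> lg lG; rewrite /energy /grad_product mulr_sumr -big_split -sumrB/=.
apply: eq_bigr => i _; rewrite -RintZ; last exact: L2M.
rewrite -RintD; [|exact: L2_sqr|exact: L2_sqr].
rewrite -RintB; [|by apply: L1D; exact: L2_sqr|by apply: L1Z; exact: L2M].
by apply: eq_Rint => x; ring.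
Qed.

Definition solves u g (l c : R) (F : 'rV[R]_N -> R) := forall Z G, has_wgrad Z G ->
  grad_product g G + l * \int[mu]_x (u x * Z x) =
  c * \int[mu]_x (u x ^+ h.+1 * (u x ^+ h * Z x)) + \int[mu]_x (F x * Z x).

Lemma solves_self u g (l c b : R) v : has_wgrad u g -> L2 mu v ->
  solves u g l c (fun x => b * v x) ->
  energy g + l * \int[mu]_x u x ^+ 2 =
  c * \int[mu]_x (u x ^+ 2) ^+ h.+1 + b * \int[mu]_x (v x * u x).
Proof.
move=> hu lv /(_ _ _ hu); rewrite -(RintZ b (L2M lv hu.1)).
have -> : grad_product g g = energy g by apply: eq_bigr => i _; apply: eq_Rint => x; rewrite expr2.
have -> : \int[mu]_x (u x * u x) = \int[mu]_x u x ^+ 2 by apply: eq_Rint => x; rewrite expr2.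
have -> : \int[mu]_x (u x ^+ h.+1 * (u x ^+ h * u x)) = \int[mu]_x (u x ^+ 2) ^+ h.+1.
  by apply: eq_Rint => x; rewrite -exprSr -expr2 exprAC.
by move=> ->; congr (_ + _); apply: eq_Rint => x; rewrite mulrA.
Qed.

(* The second equation comes from the inverse dilation of u. *)
Lemma solves_dil u g (l c b T : R) v : 0 < T -> has_wgrad u g -> L2 mu v ->
  solves u g l c (fun x => b * v x) ->
  let U := dil m T^-1 u in let V := dil m T^-1 v in
  let P := grad_product g (fun i => dil N T^-1 (g i)) in
  [/\ P + l * \int[mu]_x (U x * u x) =
       c * \int[mu]_x (u x ^+ h.+1 * (u x ^+ h * U x)) + b * \int[mu]_x (U x * v x),
      P + T^-1 ^+ 4 * (l * \int[mu]_x (U x * u x)) =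
       c * \int[mu]_x (U x ^+ h.+1 * (U x ^+ h * u x)) +
         T^-1 ^+ 4 * (b * \int[mu]_x (V x * u x)) &
      energy (fun i x => g i x - dil N T^-1 (g i) x) = 2 * energy g - 2 * P].
Proof.
move=> T0 hu lv eqn U V P; have d0 : 0 < T^-1 by rewrite invr_gt0.
have lg i : L2 mu (g i) by have [_ /(_ i)[]] := hu.
have lgd i : L2 mu (dil N T^-1 (g i)) by exact: L2_dil.
have dT : T^-1 ^+ 4 * T ^+ 4 = 1 by rewrite -exprMn mulVf ?gt_eqF// expr1n.
have hU : has_wgrad U _ := has_wgrad_dil m d0 hu.
have hU' := has_wgrad_dil m T0 hu.
split; last by rewrite energyB// (energy_dil (m := m) d0)// -/P; ring.
  have := eqn _ _ hU; rewrite -/P => e.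
  rewrite (eq_Rint _ (fun x => mulrC (U x) (u x))) e; congr (_ + _).
  rewrite -RintZ; last by apply: L2M lv; exact: hU.1.
  by apply: eq_Rint => x; ring.
have := eqn _ _ hU'; rewrite (dil_pow_adjoint hm T0 hu) -/U.
have -> : grad_product g (fun i => dil N T (g i)) = P.
  apply: eq_bigr => i _; rewrite dil_grad_adjoint//.
  by apply: eq_Rint => x; rewrite mulrC.
have adj A : L2 mu A -> \int[mu]_x (A x * dil m T u x) =
    T^-1 ^+ 4 * \int[mu]_x (dil m T^-1 A x * u x).
  by move=> lA; rewrite -(dil_L2_adjoint T0 lA hu.1) mulrA dT mul1r.
rewrite adj; last exact: hu.1.
have -> : \int[mu]_x (b * v x * dil m T u x) = b * \int[mu]_x (v x * dil m T u x).
  rewrite -RintZ; last by apply: L2M => //; exact: hU'.1.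
  by apply: eq_Rint => x; rewrite mulrA.
by rewrite adj// -/U -/V [_ * (l * _)]mulrCA [_ * (b * _)]mulrCA.
Qed.

(** With t = T^4, (t + s)/2 - 1 = s (t - 1)^2 / 2 is of second order in T - 1, while t - s is of
    first order. On [1, 2], t - 1 <= 15 (T - 1), and 113 is 15^2 / 2 rounded up. *)
Lemma fourth_power_bounds (T s : R) : 1 < T -> T <= 2 -> s * T ^+ 4 = 1 -> 0 < s ->
  (T ^+ 4 + s) / 2 - 1 <= 113 * (T - 1) ^+ 2 /\ T - 1 <= T ^+ 4 - s.
Proof.
move=> T1 T2 sT s0.
have T41 : T <= T ^+ 4 by rewrite -[leLHS]expr1 ler_weXn2l// ltW.
have s1 : s <= 1.
  by rewrite -sT -[leLHS]mulr1 ler_wpM2l ?(ltW s0)// (le_trans _ T41)// ltW.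
split; last by lra.
have h1 : T ^+ 4 - 1 <= 15 * (T - 1).
  have -> : T ^+ 4 - 1 = (T - 1) * (T ^+ 3 + T ^+ 2 + T + 1) by ring.
  rewrite mulrC ler_wpM2r ?subr_ge0 ?(ltW T1)//.
  have t2 : T ^+ 2 <= 2 ^+ 2 by rewrite lerXn2r ?nnegrE//; lra.
  have t3 : T ^+ 3 <= 2 ^+ 3 by rewrite lerXn2r ?nnegrE//; lra.
  lra.
have h2 : (T ^+ 4 - 1) ^+ 2 <= (15 * (T - 1)) ^+ 2 by rewrite lerXn2r ?nnegrE//; lra.
have -> : (T ^+ 4 + s) / 2 - 1 = s * (T ^+ 4 - 1) ^+ 2 / 2.
  have -> : s * (T ^+ 4 - 1) ^+ 2 = (s * T ^+ 4) * T ^+ 4 - 2 * (s * T ^+ 4) + s by ring.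
  by rewrite sT; field.
have h3 : s * (T ^+ 4 - 1) ^+ 2 <= (T ^+ 4 - 1) ^+ 2.
  by rewrite -[leRHS]mul1r ler_wpM2r ?sqr_ge0.
by have := sqr_ge0 (T - 1); lra.
Qed.

(** The two equations are added, so that the coupling terms combine into the quadratic form, and
    [dilation_algebra] applies to the sums. The weight (10 c)^-1 turns 5 c R into at most half of
    the Dirichlet form plus a second-order term. *)
Lemma dilation_scalar (Ku Kv Pu Pv Du Dv x y z a a' b1 b2 Su Sv I1u I2u I1v I2v Ru Rv Mu Mv
    l1 l2 c1 c2 b T s : R) :
  let Q := l1 * x + l2 * y - 2 * b * z in
  0 < c1 -> 0 < c2 -> 1 < T -> T <= 2 -> s * T ^+ 4 = 1 -> 0 < s ->
  Ku + l1 * x = c1 * Su + b * z -> Kv + l2 * y = c2 * Sv + b * z ->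
  Pu + l1 * a = c1 * I1u + b * b1 -> Pu + s * (l1 * a) = c1 * I2u + s * (b * b2) ->
  Du = 2 * Ku - 2 * Pu ->
  2 * Su - I1u - I2u <= 5 * Ru -> I1u - I2u <= 5 * Ru ->
  Ru <= (10 * c1)^-1 * Du + Mu * (T - 1) ^+ 2 ->
  Pv + l2 * a' = c2 * I1v + b * b2 -> Pv + s * (l2 * a') = c2 * I2v + s * (b * b1) ->
  Dv = 2 * Kv - 2 * Pv ->
  2 * Sv - I1v - I2v <= 5 * Rv -> I1v - I2v <= 5 * Rv ->
  Rv <= (10 * c2)^-1 * Dv + Mv * (T - 1) ^+ 2 ->
  0 <= l1 * (x + T ^+ 4 * x - 2 * a) + l2 * (y + T ^+ 4 * y - 2 * a') -
    2 * b * (z + T ^+ 4 * z - b1 - b2) ->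
  0 <= Q -> (T - 1) * Q <= (2 * 113 * Q + 4 * (5 * (c1 * Mu) + 5 * (c2 * Mv))) * (T - 1) ^+ 2.
Proof.
move=> Q c10 c20 T1 T2 sT s0 u0 v0 u1 u2 u3 ru1 ru2 wu v1 v2 v3 rv1 rv2 wv Qw0 Q0.
have [e1 e2] := fourth_power_bounds T1 T2 sT s0.
have T41 : 1 <= T ^+ 4 by rewrite exprn_ege1// ltW.
have half c Rr Dd Mm : 0 < c -> Rr <= (10 * c)^-1 * Dd + Mm * (T - 1) ^+ 2 ->
    5 * (c * Rr) <= Dd / 2 + 5 * (c * Mm) * (T - 1) ^+ 2.
  move=> c0 hR; have := ler_wpM2l (ltW c0) hR.
  have -> : c * ((10 * c)^-1 * Dd + Mm * (T - 1) ^+ 2) = Dd / 10 + c * Mm * (T - 1) ^+ 2.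
    by field; rewrite gt_eqF.
  by move=> ?; lra.
have hu := half _ _ _ _ c10 wu; have hv := half _ _ _ _ c20 wv.
have ru1' := ler_wpM2l (ltW c10) ru1; have ru2' := ler_wpM2l (ltW c10) ru2.
have rv1' := ler_wpM2l (ltW c20) rv1; have rv2' := ler_wpM2l (ltW c20) rv2.
apply: (@dilation_algebra (Ku + Kv) (Pu + Pv) Q (l1 * a + l2 * a' - b * b1 - b * b2)
  ((1 + T ^+ 4) * Q - 2 * (l1 * a + l2 * a' - b * b1 - b * b2))
  (c1 * Su + c2 * Sv) (c1 * I1u + c2 * I1v) (c1 * I2u + c2 * I2v) (Du + Dv)
  (5 * (c1 * Ru) + 5 * (c2 * Rv)) (T ^+ 4) s) => //; clear half; rewrite ?/Q.
- by lra.
- by lra.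
- by lra.
- by lra.
- by apply: le_trans Qw0 _; rewrite le_eqVlt; apply/orP; left; apply/eqP; ring.
- by lra.
- by lra.
- by lra.
Qed.

Theorem pohozaev u gu v gv (l1 l2 c1 c2 b : R) : has_wgrad u gu -> has_wgrad v gv ->
  0 < c1 -> 0 < c2 -> (forall x y : R, 0 <= l1 * x ^+ 2 + l2 * y ^+ 2 - 2 * b * (x * y)) ->
  solves u gu l1 c1 (fun x => b * v x) -> solves v gv l2 c2 (fun x => b * u x) ->
  l1 * \int[mu]_x u x ^+ 2 + l2 * \int[mu]_x v x ^+ 2 - 2 * b * \int[mu]_x (u x * v x) <= 0.
Proof.
move=> hu hv c10 c20 pd eu ev; set Q := (X in X <= 0).
have lu := hu.1; have lv := hv.1.
have form f f' : L2 mu f -> L2 mu f' ->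
    0 <= l1 * \int[mu]_x f x ^+ 2 + l2 * \int[mu]_x f' x ^+ 2 - 2 * b * \int[mu]_x (f x * f' x).
  move=> lf lg; rewrite -(RintZ l1 (L2_sqr lf)) -(RintZ l2 (L2_sqr lg)) -(RintZ (2 * b) (L2M lf lg)).
  have q1 := L1Z l1 (L2_sqr lf); have q2 := L1Z l2 (L2_sqr lg).
  have q3 := L1Z (2 * b) (L2M lf lg).
  by rewrite -RintD// -RintB//; [exact: Rint_ge0|exact: L1D].
have Q0 : 0 <= Q by exact: form.
have d1 : 0 < (10 * c1)^-1 by rewrite invr_gt0 mulr_gt0.
have d2 : 0 < (10 * c2)^-1 by rewrite invr_gt0 mulr_gt0.
have [Mu Mu0 hMu] := remainder_potential_le hm hu d1.
have [Mv Mv0 hMv] := remainder_potential_le hm hv d2.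
pose M := 5 * (c1 * Mu) + 5 * (c2 * Mv).
have key T : 1 < T -> T <= 2 -> (T - 1) * Q <= (2 * 113 * Q + 4 * M) * (T - 1) ^+ 2.
  move=> T1 T2; have T0 : 0 < T by apply: lt_trans T1.
  have d0 : 0 < T^-1 by rewrite invr_gt0.
  have [u1 u2 u3] := solves_dil T0 hu lv eu.
  have [v1 v2 v3] := solves_dil T0 hv lu ev.
  have u0 := solves_self hu lv eu; have v0 := solves_self hv lu ev.
  set U := dil m T^-1 u in u1 u2 v1 v2; set V := dil m T^-1 v in u1 u2 v1 v2.
  have hU : has_wgrad U _ := has_wgrad_dil m d0 hu.
  have hV : has_wgrad V _ := has_wgrad_dil m d0 hv.
  have [ru1 ru2] := nonlinear_remainders hu hU (Rint_dil_pow hm d0 (sobolev_energy hm hu).1).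
  have [rv1 rv2] := nonlinear_remainders hv hV (Rint_dil_pow hm d0 (sobolev_energy hm hv).1).
  have wu := hMu T T1 T2; have wv := hMv T T1 T2.
  rewrite -/U in wu; rewrite -/V in wv.
  have swap f f' : \int[mu]_x (f x * f' x) = \int[mu]_x (f' x * f x).
    by apply: eq_Rint => x; rewrite mulrC.
  have sqr_diff f f' : L2 mu f -> L2 mu f' ->
      \int[mu]_x ((f x - f' x) ^+ 2) =
      \int[mu]_x f x ^+ 2 + \int[mu]_x f' x ^+ 2 - 2 * \int[mu]_x (f' x * f x).
    move=> lf lf'; rewrite -(RintZ 2 (L2M lf' lf)).
    rewrite -RintD; [|exact: L2_sqr|exact: L2_sqr].
    rewrite -RintB; [|by apply: L1D; exact: L2_sqr|by apply: L1Z; exact: L2M].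
    by apply: eq_Rint => x; ring.
  have scale f f' : L2 mu f -> L2 mu f' ->
      \int[mu]_x (dil m T^-1 f x * dil m T^-1 f' x) = T ^+ 4 * \int[mu]_x (f x * f' x).
    move=> lf lf'; have lf1 := L2_dil m d0 lf; have lf2 := L2_dil m d0 lf'.
    have d4T : T ^+ 4 * T^-1 ^+ 4 = 1 by rewrite -exprMn mulfV ?gt_eqF// expr1n.
    have := dil_L2_adjoint d0 lf1 lf'; rewrite invrK.
    have -> : \int[mu]_x (dil m T (dil m T^-1 f) x * f' x) = \int[mu]_x (f x * f' x).
      by apply: eq_Rint => x; rewrite dilK.
    by move=> <-; rewrite mulrA d4T mul1r.
  have TT : T^-1 ^+ 4 * T ^+ 4 = 1 by rewrite -exprMn mulVf ?gt_eqF// expr1n.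
  have d40 : 0 < T^-1 ^+ 4 by rewrite exprn_gt0.
  have Qw0 : 0 <= l1 * (\int[mu]_x u x ^+ 2 + T ^+ 4 * \int[mu]_x u x ^+ 2 - 2 * \int[mu]_x (U x * u x)) +
     l2 * (\int[mu]_x v x ^+ 2 + T ^+ 4 * \int[mu]_x v x ^+ 2 - 2 * \int[mu]_x (V x * v x)) -
     2 * b * (\int[mu]_x (u x * v x) + T ^+ 4 * \int[mu]_x (u x * v x) -
       \int[mu]_x (U x * v x) - \int[mu]_x (V x * u x)).
    have := form _ _ (L2B lu hU.1) (L2B lv hV.1).
    rewrite !sqr_diff//; [|exact: hV.1|exact: hU.1].
    have -> : \int[mu]_x ((u x - U x) * (v x - V x)) = \int[mu]_x (u x * v x) +
        \int[mu]_x (U x * V x) - \int[mu]_x (U x * v x) - \int[mu]_x (V x * u x).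
      have i1 := L2M lu lv; have i2 := L2M hU.1 hV.1; have i3 := L2M hU.1 lv; have i4 := L2M hV.1 lu.
      rewrite -RintD// -RintB//; last exact: L1D.
      rewrite -RintB//; last by apply: L1B => //; exact: L1D.
      by apply: eq_Rint => x; ring.
    have sq f : \int[mu]_x f x ^+ 2 = \int[mu]_x (f x * f x) by apply: eq_Rint => x; rewrite expr2.
    by rewrite !sq !scale// !sq.
  rewrite [\int[mu]_x (v x * u x)]swap in u0.
  exact: (dilation_scalar c10 c20 T1 T2 TT d40 u0 v0 u1 u2 u3 ru1 ru2 wu v1 v2 v3 rv1 rv2 wv Qw0 Q0).
have hk : 0 <= 2 * 113 * Q + 4 * M.
  by rewrite addr_ge0 ?mulr_ge0// addr_ge0// mulr_ge0// mulr_ge0// ltW.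
rewrite leNgt; apply/negP => Qp.
set B := 2 * 113 * Q + 4 * M in key hk.
(* So small that B tau < Q, against the inequality Q <= B tau that [key] gives at T = 1 + tau. *)
pose tau := Num.min 1 (Q / (2 * (B + 1))).
have tau0 : 0 < tau by rewrite lt_min ltr01 divr_gt0// mulr_gt0//; lra.
have tau1 : tau <= 1 by rewrite ge_min lexx.
have tauB : 2 * tau * (B + 1) <= Q.
  have : tau <= Q / (2 * (B + 1)) by rewrite ge_min lexx orbT.
  by rewrite ler_pdivlMr ?mulr_gt0//; lra.
have := key (1 + tau); rewrite ltrDl tau0 => /(_ isT).
have -> : 1 + tau - 1 = tau by ring.
have -> : 1 + tau <= 2 by lra.
move=> /(_ isT); rewrite expr2 mulrCA ler_pM2l//.
by move: tauB tau0 hk Qp; move: (B) (Q) (tau) => ? ? ?; nra.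
Qed.

End pohozaev.

(** * Nonexistence *)

Section weak_solutions.
Variables (R : realType) (m h : nat).
Hypothesis hm : (m = 1 /\ h = 2 \/ m = 2 /\ h = 1)%N.
Local Notation N := m.+2.
Local Notation mu := (lebesgue_rV R N).
Implicit Types (u v w phi : 'rV[R]_N -> R) (g : 'I_N -> 'rV[R]_N -> R).

Lemma H1_has_wgrad u : H1 u -> has_wgrad u (fun i => wderiv i u).
Proof.
move=> [lu hu]; split; first exact: Lfun2_L2.
move=> i; have [g lg wg] := hu i.
rewrite /wderiv; case: xgetP => [G _ [lG wG]|/(_ g) h1]; first by split=> //; exact: Lfun2_L2.
by exfalso; apply: h1.
Qed.

(** Allows a solution that is nonnegative almost everywhere to be replaced by its absolute value,
    which is nonnegative at every point. *)
Lemma ae_eq_has_wgrad u v g : measurable_fun setT v -> {ae mu, forall x, u x = v x} ->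
  has_wgrad u g -> has_wgrad v g.
Proof.
move=> mv uv [[mu' lu] hu]; split.
  split => //; apply: (L1_ge0P (measurable_funX 2 mv)) => [x|]; first exact: sqr_ge0.
  have <- : (\int[mu]_x (u x ^+ 2)%:E = \int[mu]_x (v x ^+ 2)%:E)%E.
    apply: ae_eq_integral => //.
    - by apply/measurable_EFinP; exact: measurable_funX.
    - by apply/measurable_EFinP; exact: measurable_funX.
    - by apply: filterS uv => x /= ->.
  by rewrite -RintE// ltry.
move=> i; have [lg wg] := hu i; split => // phi tp; rewrite -wg//.
have mp := test_meas (test_partial i tp).
apply: ae_eq_Rint; [exact: measurable_funM|exact: measurable_funM|].
by apply: filterS uv => x /= ->.
Qed.

Lemma critical_exponentE : critical_exponent R N - 2 = (2 * h)%:R.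
Proof. by rewrite /critical_exponent; case: hm => -[-> ->]; field. Qed.

(** Passes to |u| and |v|, which are equal to u and v almost everywhere, turns the real power 2* - 2
    into the natural power 2h, and splits the integrals term by term before the extension to all of
    H^1. *)
Lemma weak_solution_solves u v (l c b : R) : H1 u -> H1 v ->
  {ae mu, forall x, 0 <= u x} -> {ae mu, forall x, 0 <= v x} ->
  weak_solution l u
    (fun x => c * `|u x| `^ (critical_exponent R N - 2) * u x + b * v x) ->
  solves h (fun x => `|u x|) (fun i => wderiv i u) l c (fun x => b * `|v x|).
Proof.
move=> Hu Hv u0 v0 eqn; have hu := H1_has_wgrad Hu; have hv := H1_has_wgrad Hv.
have mU : measurable_fun setT u := L2_meas hu.1.
have mV : measurable_fun setT v := L2_meas hv.1.
have uE : {ae mu, forall x, u x = `|u x|} by apply: filterS u0 => x /= ux; rewrite ger0_norm.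
have vE : {ae mu, forall x, v x = `|v x|} by apply: filterS v0 => x /= ux; rewrite ger0_norm.
have hu' : has_wgrad (fun x => `|u x|) (fun i => wderiv i u).
  by apply: ae_eq_has_wgrad uE hu; exact: measurableT_comp.
have lv' : L2 mu (fun x => `|v x|) := L2_norm hv.1.
have lg i : L2 mu (wderiv i u) by have [_ /(_ i)[]] := hu.
move=> Z G hZ; apply: (weak_eq_extend hm hu' _ _ hZ); first exact: L2Z.
move=> phi tp; have lp := test_L2 tp.
have lgp i : L1 mu (fun x => wderiv i u x * partial i phi x).
  by apply: L2M => //; exact/test_L2/test_partial.
have lup := L2M hu'.1 lp.
have lpow := L2M (L2_powS hm hu') (L2_powM hm hu' (has_wgrad_test tp)).
have lvp := L2M (L2Z b lv') lp.
rewrite -Rint_sum// -RintZ// -RintD//; [|exact: L1_sum|exact: L1Z].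
rewrite -[X in _ = X + _]RintZ// -RintD//; last exact: L1Z.
transitivity (\int[mu]_x (\sum_i wderiv i u x * partial i phi x + l * u x * phi x)).
  apply: ae_eq_Rint.
  - apply: measurable_funD; first exact: (L1_meas (L1_sum _ lgp)).
    exact: (L1_meas (L1Z l lup)).
  - apply: measurable_funD; first exact: (L1_meas (L1_sum _ lgp)).
    by apply: measurable_funM (test_meas tp); exact: measurable_funM.
  - by apply: filterS uE => x /= <-; rewrite mulrA.
rewrite eqn//; apply: ae_eq_Rint.
- apply: measurable_funM (test_meas tp); apply: measurable_funD.
    apply: measurable_funM => //; apply: measurable_funM => //.
    by apply: (measurableT_comp (measurable_powR _)); exact: measurableT_comp.
  exact: measurable_funM.
- by apply: measurable_funD; [exact: L1_meas (L1Z c lpow)|exact: L1_meas lvp].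
- apply: filterS2 uE vE => x /= ux vx; rewrite critical_exponentE powR_mulrn// -vx -ux.
  rewrite mulrDl; congr (_ + _); rewrite -!mulrA; congr (_ * _); rewrite !mulrA; congr (_ * _).
  by rewrite -exprSr -exprD addSn addnn mul2n.
Qed.

(** Testing the weak derivatives with the functions [partial i phi] turns the gradient form into the
    Laplacian form of the Liouville theorem. *)
Lemma superharmonic_wgrad w g : has_wgrad w g -> (forall x, 0 <= w x) ->
  (forall phi, test_function phi -> (forall x, 0 <= phi x) ->
    0 <= grad_product g (fun i => partial i phi)) -> \int[mu]_x w x ^+ 2 = 0.
Proof.
move=> hw w0 sup; have lw := hw.1.
have n34 : (N = 3 \/ N = 4)%N by case: hm => -[-> _]; [left|right].
have we : {ae mu, forall x, w x = 0}.
  apply: (superharmonic_L2_eq0 n34 lw w0) => phi tp phi0.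
  have tpp i := test_partial i (test_partial i tp).
  rewrite (eq_Rint _ (g := fun x => \sum_i w x * partial i (partial i phi) x)); last first.
    by move=> x; rewrite mulr_sumr.
  rewrite Rint_sum; last by move=> i; apply: L2M => //; exact: test_L2.
  rewrite (eq_bigr (fun i => - \int[mu]_x (g i x * partial i phi x))) => [|i _]; last first.
    by have [_ wg] := hw.2 i; exact/wg/test_partial.
  by rewrite sumrN oppr_le0; exact: sup.
transitivity (\int[mu]_x (0 : R)); last by rewrite /Rintegral integral0.
apply: ae_eq_Rint => //; first exact: (L1_meas (L2_sqr lw)).
by apply: filterS we => x /= ->; rewrite expr0n.
Qed.

Lemma grad_productDl g g' G (k : R) : (forall i, L2 mu (g i)) -> (forall i, L2 mu (g' i)) ->
  (forall i, L2 mu (G i)) ->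
  grad_product (fun i x => g i x + k * g' i x) G = grad_product g G + k * grad_product g' G.
Proof.
move=> lg lg' lG; rewrite /grad_product mulr_sumr -big_split; apply: eq_bigr => i _ /=.
rewrite -(RintZ k (L2M (lg' i) (lG i))) -RintD; [|exact: L2M|by apply: L1Z; exact: L2M].
by apply: eq_Rint => x; ring.
Qed.

Theorem no_nonnegative_solution u v gu gv (l1 l2 c1 c2 b : R) :
  has_wgrad u gu -> has_wgrad v gv -> (forall x, 0 <= u x) -> (forall x, 0 <= v x) ->
  0 < b -> 0 < c1 -> 0 < c2 ->
  0 < \int[mu]_x u x ^+ 2 -> 0 < \int[mu]_x v x ^+ 2 ->
  solves h u gu l1 c1 (fun x => b * v x) -> solves h v gv l2 c2 (fun x => b * u x) -> False.
Proof.
move=> hu hv u0 v0 b0 c10 c20 Iu Iv eu ev.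
(* Against a nonnegative test function the critical term is nonnegative and is dropped. *)
have sup f g l c f' phi : 0 < c -> (forall x, 0 <= f x) -> (forall x, 0 <= f' x) -> L2 mu f' ->
    solves h f g l c (fun x => b * f' x) -> test_function phi -> (forall x, 0 <= phi x) ->
    b * \int[mu]_x (f' x * phi x) <=
    grad_product g (fun i => partial i phi) + l * \int[mu]_x (f x * phi x).
  move=> c0 f0 f'0 lf' ef tp phi0; rewrite (ef _ _ (has_wgrad_test tp)).
  rewrite -(RintZ b (L2M lf' (test_L2 tp))).
  rewrite (eq_Rint _ (g := fun x => b * f' x * phi x)) => [|x]; last by rewrite mulrA.
  rewrite lerDr mulr_ge0//; first exact: ltW.
  by apply: Rint_ge0 => x; rewrite !mulr_ge0// exprn_ge0.
have pos f phi : (forall x, 0 <= f x) -> (forall x, 0 <= phi x) -> 0 <= \int[mu]_x (f x * phi x).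
  by move=> f0 phi0; apply: Rint_ge0 => x; exact: mulr_ge0.
have [l1n|l1p] := lerP l1 0.
  move: Iu; rewrite (superharmonic_wgrad hu u0) ?ltxx// => phi tp phi0.
  have := sup _ _ _ _ _ _ c10 u0 v0 hv.1 eu tp phi0.
  have := pos _ _ u0 phi0; have := pos _ _ v0 phi0.
  by move: (grad_product _ _) (\int[mu]_x _) (\int[mu]_x (u x * phi x)) => *; nra.
have [l2n|l2p] := lerP l2 0.
  move: Iv; rewrite (superharmonic_wgrad hv v0) ?ltxx// => phi tp phi0.
  have := sup _ _ _ _ _ _ c20 v0 u0 hu.1 ev tp phi0.
  have := pos _ _ u0 phi0; have := pos _ _ v0 phi0.
  by move: (grad_product _ _) (\int[mu]_x _) (\int[mu]_x (u x * phi x)) => *; nra.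
have [l12|l12] := lerP (l1 * l2) (b ^+ 2).
  (* With k l2 = b the terms in v cancel in the inequality for u + k v, and the coefficient k b - l1
     of u is nonnegative exactly when l1 l2 <= b^2. *)
  pose k := b / l2; have k0 : 0 < k by rewrite divr_gt0.
  have kl2 : k * l2 = b by rewrite divfK// gt_eqF.
  have hw := has_wgradD hu (has_wgradZ k hv).
  have w0 x : 0 <= u x + k * v x by rewrite addr_ge0// mulr_ge0// ltW.
  have e0 : \int[mu]_x (u x + k * v x) ^+ 2 = 0.
    apply: (superharmonic_wgrad hw w0) => phi tp phi0.
    rewrite grad_productDl; [|by move=> i; have [_ /(_ i)[]] := hu|
      by move=> i; have [_ /(_ i)[]] := hv|by move=> i; exact/test_L2/test_partial].
    have su := sup _ _ _ _ _ _ c10 u0 v0 hv.1 eu tp phi0.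
    have sv := sup _ _ _ _ _ _ c20 v0 u0 hu.1 ev tp phi0.
    have pu := pos _ _ u0 phi0; move: su sv pu.
    move: (grad_product gu _) (grad_product gv _) (\int[mu]_x (u x * _)) (\int[mu]_x (v x * _)).
    move=> Pu Pv A B su sv pu.
    have kb : l1 <= k * b by rewrite /k mulrAC ler_pdivlMr// -expr2.
    have h1 := ler_wpM2l (ltW k0) sv; have h2 := ler_wpM2r pu kb.
    have h3 : k * l2 * B = b * B by rewrite kl2.
    by move: su h1 h2 h3; clear; lra.
  have le_uw : \int[mu]_x u x ^+ 2 <= \int[mu]_x (u x + k * v x) ^+ 2.
    apply: Rint_le; [exact: (L2_sqr hu.1)|exact: (L2_sqr hw.1)|move=> x].
    by rewrite lerXn2r ?nnegrE// lerDl mulr_ge0// ltW.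
  by move: Iu; rewrite ltNge -e0 le_uw.
have pd x y : 0 <= l1 * x ^+ 2 + l2 * y ^+ 2 - 2 * b * (x * y).
  rewrite -(pmulr_rge0 _ l1p).
  have -> : l1 * (l1 * x ^+ 2 + l2 * y ^+ 2 - 2 * b * (x * y)) =
    (l1 * x - b * y) ^+ 2 + (l1 * l2 - b ^+ 2) * y ^+ 2 by ring.
  by rewrite addr_ge0 ?sqr_ge0// mulr_ge0 ?sqr_ge0// subr_ge0 ltW.
have := pohozaev hm hu hv c10 c20 pd eu ev; have := cauchy_schwarz hu.1 hv.1.
move: Iu Iv; move: (\int[mu]_x (u x * v x)) (\int[mu]_x u x ^+ 2) (\int[mu]_x v x ^+ 2).
move=> z x y x0 y0 zxy; rewrite subr_le0 => Q.
(* Strict positivity of Q: (l1 x + l2 y)^2 >= 4 l1 l2 x y > 4 b^2 x y >= (2 b z)^2, by the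
   arithmetic-geometric inequality, b^2 < l1 l2 and Cauchy-Schwarz. *)
have p0 : 0 < l1 * x + l2 * y by rewrite addr_gt0// mulr_gt0.
have : (l1 * x + l2 * y) ^+ 2 <= (2 * b * z) ^+ 2.
  by rewrite lerXn2r ?nnegrE ?(ltW p0)// (le_trans (ltW p0) Q).
apply/negP; rewrite -ltNge.
have xy0 : 0 < x * y by rewrite mulr_gt0.
have h1 : b ^+ 2 * z ^+ 2 <= b ^+ 2 * (x * y) by rewrite ler_wpM2l ?sqr_ge0.
have h2 : b ^+ 2 * (x * y) < l1 * l2 * (x * y) by rewrite ltr_pM2r.
by have := sqr_ge0 (l1 * x - l2 * y); lra.
Qed.

Lemma no_weak_solution u v (l1 l2 c1 c2 b : R) : 0 < b -> 0 < c1 -> 0 < c2 ->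
  H1 u -> H1 v -> {ae mu, forall x, 0 <= u x} -> {ae mu, forall x, 0 <= v x} ->
  weak_solution l1 u (fun x => c1 * `|u x| `^ (critical_exponent R N - 2) * u x + b * v x) ->
  weak_solution l2 v (fun x => c2 * `|v x| `^ (critical_exponent R N - 2) * v x + b * u x) ->
  0 < \int[mu]_x (u x ^+ 2) -> 0 < \int[mu]_x (v x ^+ 2) -> False.
Proof.
move=> b0 c10 c20 Hu Hv u0 v0 eu ev Iu Iv.
have hgrad f : H1 f -> {ae mu, forall x, 0 <= f x} ->
    has_wgrad (fun x => `|f x|) (fun i => wderiv i f).
  move=> Hf f0; have hf := H1_has_wgrad Hf; have mf := L2_meas hf.1.
  apply: ae_eq_has_wgrad hf; first exact: measurableT_comp.
  by apply: filterS f0 => x /= fx; rewrite ger0_norm.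
have sqE f : \int[mu]_x `|f x| ^+ 2 = \int[mu]_x (f x ^+ 2).
  by apply: eq_Rint => x; rewrite real_normK ?num_real.
apply: (no_nonnegative_solution (hgrad _ Hu u0) (hgrad _ Hv v0) _ _ b0 c10 c20 _ _
  (weak_solution_solves Hu Hv u0 v0 eu) (weak_solution_solves Hv Hu v0 u0 ev)) => //.
- by rewrite sqE.
- by rewrite sqE.
Qed.

End weak_solutions.

Theorem theorem1p3 (R : realType) (N : nat) (hN : N = 3%N \/ N = 4%N)
    (beta a b mu1 mu2 : R) (hbeta : 0 < beta) (ha : 0 < a) (hb : 0 < b)
    (hmu1 : 0 < mu1) (hmu2 : 0 < mu2) :
  let leb := lebesgue_rV R N in
  let p := critical_exponent R N in
  ~ exists (lambda1 lambda2 : R) (u v : 'rV[R]_N -> R),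
      (H1 u /\ H1 v) /\
      {ae leb, forall x, 0 <= u x} /\
      {ae leb, forall x, 0 <= v x} /\
      ~ ({ae leb, forall x, u x = 0} /\ {ae leb, forall x, v x = 0}) /\
      weak_solution lambda1 u
        (fun x => mu1 * `|u x| `^ (p - 2) * u x + beta * v x) /\
      weak_solution lambda2 v
        (fun x => mu2 * `|v x| `^ (p - 2) * v x + beta * u x) /\
      \int[leb]_x (u x ^+ 2) = a /\
      \int[leb]_x (v x ^+ 2) = b.
Proof.
move=> leb p [l1 [l2 [u [v [[Hu Hv] [u0 [v0 [_ [eu [ev [Iu Iv]]]]]]]]]]].
have Iu0 : 0 < \int[leb]_x (u x ^+ 2) by rewrite Iu.
have Iv0 : 0 < \int[leb]_x (v x ^+ 2) by rewrite Iv.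
case: hN => NE; subst N.
  have hm : (1 = 1 /\ 2 = 2 \/ 1 = 2 /\ 2 = 1)%N by left.
  exact: (no_weak_solution hm hbeta hmu1 hmu2 Hu Hv u0 v0 eu ev Iu0 Iv0).
have hm : (2 = 1 /\ 1 = 2 \/ 2 = 2 /\ 1 = 1)%N by right.
exact: (no_weak_solution hm hbeta hmu1 hmu2 Hu Hv u0 v0 eu ev Iu0 Iv0).
Qed.
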